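(* Suppose assumptions A1–A4 of the one-factor model hold. Suppose that, for each $p$, $L_p$ is a random linear subspace of $\mathbb{R}^p$ and $H_p$ is a Haar random subspace of $\mathbb{R}^p$, that $L_p$ and $H_p$ are independent of $\beta$ and $Z$, and that the sequences $\dim L_p$ and $\dim H_p$ are square root dominated. Let $L'_p=\mathrm{span}\{L_p,q^p\}$ and $L''_p=\mathrm{span}\{H_p,q^p\}$. Then, almost surely, (a) $\limsup_{p\to\infty}\|\hat h_{L'}-b\|\le \|\hat h_q-b\|_\infty$, (b) $\lim_{p\to\infty}\|\hat h_{L''}-b\| = \|\hat h_q-b\|_\infty$, and (c) $\lim_{p\to\infty}\|\hat h_{H}-b\| = \|h-b\|_\infty$, where $\|\hat h_q-b\|_\infty=\lim_{p\to\infty}\|\hat h_q-b\|$ and $\|h-b\|_\infty=\lim_{p\to\infty}\|h-b\|$.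
   Context: Model. Fix $n\ge 2$. Let $\beta=(\beta(1),\beta(2),\dots)$ be a random real sequence, $X\in\mathbb{R}^n$ a random vector, and $Z=(Z_{ij})_{i\ge1,1\le j\le n}$ a random array. For each $p$ let $\beta^p\in\mathbb{R}^p$ and $Z^p\in\mathbb{R}^{p\times n}$ be the truncations to the first $p$ entries/rows, and $R^p=\beta^pX^T+Z^p\in\mathbb{R}^{p\times n}$. Superscripts $p$ are dropped when clear. Put $\mu_p(\beta)=\frac1p\sum_{i=1}^p\beta(i)$ and $d_p(\beta)^2=\frac1p\sum_{i=1}^p\big(\frac{\beta(i)-\mu_p(\beta)}{\mu_p(\beta)}\big)^2$. A1: the $\beta(i)$ are uniformly bounded independent random variables, and $\mu_p(\beta)$, $d_p(\beta)$ converge (almost surely) to limits $\mu_\infty(\beta)\in(0,\infty)$, $d_\infty(\beta)\in(0,\infty)$. A2: $\beta$, $X$, $Z$ are jointly independent. A3: the entries of $X$ are iid with mean zero and variance $\sigma^2>0$; $X\ne0$ almost surely. A4: the entries $Z_{ij}$ have mean zero, variance $\delta^2\in(0,\infty)$ and uniformly bounded fourth moments; the $n$-dimensional rows of $Z$ are mutually independent, and within each row the entries are pairwise uncorrelated. Notation. $\|\cdot\|$ and $(\cdot,\cdot)$ are the Euclidean norm and inner product. $b=\beta^p/\|\beta^p\|$; $q=q^p=(1,\dots,1)/\sqrt p\in\mathbb{R}^p$. $h=h^p$ (the PCA estimator) is a unit eigenvector of $\frac1nR^p(R^p)^T$ for its largest eigenvalue $s_p^2$, with sign chosen so that $(h,q)\ge0$.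 $l_p^2$ is the average of the $n-1$ remaining nonzero eigenvalues, i.e. $l_p^2=\big(\mathrm{tr}(\frac1nR^p(R^p)^T)-s_p^2\big)/(n-1)$. $\psi_p=\sqrt{(s_p^2-l_p^2)/s_p^2}$. MAPS estimator. For a nontrivial proper linear subspace $L=L_p\subset\mathbb{R}^p$ with orthogonal projection $\mathrm{proj}_L$, $$\hat h_L=\frac{\tau_ph+\mathrm{proj}_L(h)}{\|\tau_ph+\mathrm{proj}_L(h)\|},\qquad \tau_p=\frac{\psi_p^2-\|\mathrm{proj}_L(h)\|^2}{1-\psi_p^2};$$ if $L$ is orthogonal to $h$, $\hat h_L=h$. The GPS estimator is $\hat h_q=\hat h_{\mathrm{span}\{q\}}$. Random subspaces. $L_p$ is a random linear subspace of $\mathbb{R}^p$ of dimension $k_p$ ($1\le k_p\le p-1$) if $L_p=\mathrm{span}\{\xi^pe_1,\dots,\xi^pe_{k_p}\}$ for some random variable $\xi^p$ with values in the orthogonal group $O(p)$, where $e_1,\dots,e_p$ is the standard basis of $\mathbb{R}^p$; it is independent of a random variable if $\xi^p$ is. It is a Haar random subspace if $\xi^p$ is distributed according to Haar measure on $O(p)$. A non-decreasing sequence $\{k_p\}$ of positive integers is square root dominated if $\sum_{p}k_p^2/p^2<\infty$. *)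

(* Defs.v *)
From HB Require Import structures.
From mathcomp Require Import all_boot all_order all_algebra.
From mathcomp Require Import all_classical all_reals all_analysis.

Set Implicit Arguments.
Unset Strict Implicit.
Unset Printing Implicit Defensive.

Import Order.TTheory GRing.Theory Num.Theory.
Import numFieldNormedType.Exports.

Local Open Scope classical_set_scope.
Local Open Scope ring_scope.

Section Euclidean.
Context {R : realType} {p : nat}.
Implicit Types (u v : 'cV[R]_p) (L : {vspace 'cV[R]_p}).

(* The library norm on matrices is the sup norm, hence explicit Euclidean
   operations. *)
Definition dot u v : R := \sum_i u i 0 * v i 0.

Definition enorm v : R := Num.sqrt (dot v v).

Definition normalize v : 'cV[R]_p := (enorm v)^-1 *: v.

(* Orthogonal projection of v onto L: the vector u of L such that v - u is
   orthogonal to L. It exists and is unique, see [orthoprojP] and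
   [orthoproj_unique]. *)
Definition orthoproj L v : 'cV[R]_p :=
  xget 0 [set u | u \in L /\ forall y, y \in L -> dot (v - u) y = 0].

Lemma dotC u v : dot u v = dot v u.
Proof. by apply: eq_bigr => i _; rewrite mulrC. Qed.

Lemma dotDl u1 u2 v : dot (u1 + u2) v = dot u1 v + dot u2 v.
Proof. by rewrite -big_split; apply: eq_bigr => i _; rewrite mxE mulrDl. Qed.

Lemma dotZl a u v : dot (a *: u) v = a * dot u v.
Proof. by rewrite mulr_sumr; apply: eq_bigr => i _; rewrite mxE mulrA. Qed.

Lemma dotBl u1 u2 v : dot (u1 - u2) v = dot u1 v - dot u2 v.
Proof. by rewrite -scaleN1r dotDl dotZl mulN1r. Qed.

Lemma dotDr u v1 v2 : dot u (v1 + v2) = dot u v1 + dot u v2.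
Proof. by rewrite dotC dotDl !(dotC u). Qed.

Lemma dotZr a u v : dot u (a *: v) = a * dot u v.
Proof. by rewrite dotC dotZl dotC. Qed.

Lemma dot0r u : dot u 0 = 0.
Proof. by apply: big1 => i _; rewrite mxE mulr0. Qed.

Lemma dot_eq0 v : dot v v = 0 -> v = 0.
Proof.
move=> /eqP; rewrite psumr_eq0 => [/allP vv0|i _]; last by rewrite -expr2 sqr_ge0.
apply/matrixP => i j; rewrite ord1 mxE; apply/eqP.
by have := vv0 i (mem_index_enum _); rewrite -expr2 sqrf_eq0.
Qed.

Lemma orthoproj_exists L v :
  exists u, u \in L /\ forall y, y \in L -> dot (v - u) y = 0.
Proof.
have <- : <<vbasis L>>%VS = L by apply: span_basis; exact: vbasisP.
elim: (tval (vbasis L)) v => [|x tl IHr] v.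
  exists 0; rewrite mem0v; split=> // y; rewrite span_nil memv0 => /eqP->.
  exact: dot0r.
have [x0 [x0r xx0]] := IHr x; have [v0 [v0r vv0]] := IHr v.
have [z Dz] : exists z, z = x - x0 by exists (x - x0).
rewrite -Dz in xx0.
have x0' : x0 \in <<x :: tl>>%VS by rewrite span_cons -[x0]add0r memv_add ?mem0v.
have v0' : v0 \in <<x :: tl>>%VS by rewrite span_cons -[v0]add0r memv_add ?mem0v.
have x' : x \in <<x :: tl>>%VS by rewrite memv_span ?mem_head.
exists (v0 + (dot (v - v0) z / dot z z) *: z); split.
  by rewrite rpredD// rpredZ// Dz rpredB.
move=> ?; rewrite span_cons => /memv_addP[_ /vlineP[a ->] [t tr ->]].
have -> : a *: x + t = a *: z + (a *: x0 + t).
  by rewrite addrA -scalerDr Dz subrK.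
have : a *: x0 + t \in <<tl>>%VS by rewrite rpredD// rpredZ.
move: (_ + t) => y ytl; rewrite opprD addrA; move: (v - v0) vv0 => y0 vv0.
rewrite dotBl !dotDr !dotZr !dotZl (vv0 y)// (xx0 y)// mulr0 !addr0.
have [/dot_eq0 ->|zz0] := eqVneq (dot z z) 0; last by rewrite divfK// subrr.
by rewrite !(dot0r, mulr0) subrr.
Qed.

Lemma orthoprojP L v :
  orthoproj L v \in L /\ forall y, y \in L -> dot (v - orthoproj L v) y = 0.
Proof.
have [u uP] := orthoproj_exists L v; rewrite /orthoproj.
by case: xgetP => [//|/(_ u) /(_ uP)].
Qed.

Lemma orthoproj_unique L v u :
  u \in L -> (forall y, y \in L -> dot (v - u) y = 0) -> orthoproj L v = u.
Proof.
move=> uL vu; have [u'L vu'] := orthoprojP L v.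
have wL : orthoproj L v - u \in L by rewrite rpredB.
apply/eqP; rewrite -subr_eq0; apply/eqP; apply: dot_eq0.
rewrite -[X in dot X _](_ : (v - u) - (v - orthoproj L v) = _); last first.
  by rewrite opprB addrC addrA subrK.
by rewrite dotBl vu// vu'// subrr.
Qed.

End Euclidean.

Section Estimators.
Context {R : realType} {p : nat}.
Implicit Types (v h : 'cV[R]_p) (L : {vspace 'cV[R]_p}) (S : 'M[R]_p).

Definition mean v : R := p%:R^-1 * \sum_i v i 0.

Definition dispersion v : R :=
  Num.sqrt (p%:R^-1 * \sum_i ((v i 0 - mean v) / mean v) ^+ 2).

Definition qvec : 'cV[R]_p := const_mx (Num.sqrt p%:R)^-1.

Definition max_eigenvalue S : R := sup [set a : R | eigenvalue S a].

Context {n : nat}.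
Implicit Type (Y : 'M[R]_(p, n)).

Definition sample_cov Y : 'M[R]_p := n%:R^-1 *: (Y *m Y^T).

Definition is_pca Y h : Prop :=
  [/\ sample_cov Y *m h = max_eigenvalue (sample_cov Y) *: h,
      enorm h = 1 & 0 <= dot h qvec].

Definition s2 Y : R := max_eigenvalue (sample_cov Y).

(* sample_cov Y has at most n nonzero eigenvalues: this is the average of those
   other than the largest one. *)
Definition l2 Y : R := (\tr (sample_cov Y) - s2 Y) / (n%:R - 1).

Definition psi Y : R := Num.sqrt ((s2 Y - l2 Y) / s2 Y).

Definition tau Y h L : R :=
  (psi Y ^+ 2 - enorm (orthoproj L h) ^+ 2) / (1 - psi Y ^+ 2).

Definition maps Y h L : 'cV[R]_p :=
  if orthoproj L h == 0 then h
  else normalize (tau Y h L *: h + orthoproj L h).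

Definition gps Y h : 'cV[R]_p := maps Y h <[qvec]>%VS.

End Estimators.
Arguments qvec {R} p.

Section Independence.
Context {R : realType} {d : measure_display} {T : measurableType d}.
Variable P : probability T R.

Definition sigma_gen {I : Type} {d'} {T' : measurableType d'}
    (X : I -> T -> T') : set (set T) :=
  <<s \bigcup_i g_sigma_algebra_preimage (X i) >>.

Definition indep2 (F G : set (set T)) : Prop :=
  forall A B, F A -> G B -> P (A `&` B) = (P A * P B)%E.

Definition mutual_indep {I : eqType} (F : I -> set (set T)) : Prop :=
  forall (s : seq I) (A : I -> set T), uniq s ->
    (forall i, i \in s -> F i (A i)) ->
    P (\big[setI/setT]_(i <- s) A i) = (\prod_(i <- s) P (A i))%E.

End Independence.

Section Model.
Context {R : realType} {d : measure_display} {T : measurableType d}.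
Variables (P : probability T R) (n : nat).
Variables (beta : nat -> {RV P >-> R}) (X : 'I_n -> {RV P >-> R}).
Variable Z : nat -> 'I_n -> {RV P >-> R}.

(* Indices start at 0: the entry beta(i) of the model is [beta i.-1], and the
   i-th row of the noise array is [Z i.-1]. *)
Definition beta_vec p (w : T) : 'cV[R]_p := \col_(i < p) beta i w.

Definition X_vec (w : T) : 'cV[R]_n := \col_(j < n) X j w.

Definition Z_mx p (w : T) : 'M[R]_(p, n) := \matrix_(i < p, j < n) Z i j w.

Definition returns p (w : T) : 'M[R]_(p, n) :=
  beta_vec p w *m (X_vec w)^T + Z_mx p w.

Definition b_vec p (w : T) : 'cV[R]_p := normalize (beta_vec p w).

Definition assumption1 : Prop :=
  [/\ exists C : R, forall i, {ae P, forall w, `|beta i w| <= C},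
      mutual_indep P (fun i => g_sigma_algebra_preimage (beta i)),
      {ae P, forall w, exists2 mu : R,
        0 < mu & mean (beta_vec p w) @[p --> \oo] --> mu} &
      {ae P, forall w, exists2 disp : R,
        0 < disp & dispersion (beta_vec p w) @[p --> \oo] --> disp}].

Definition assumption2 : Prop :=
  mutual_indep P (tnth [tuple sigma_gen beta; sigma_gen X;
    sigma_gen (fun ij : nat * 'I_n => Z ij.1 ij.2)]).

Definition assumption3 (sigma : R) : Prop :=
  [/\ mutual_indep P (fun j => g_sigma_algebra_preimage (X j)),
      forall j k (B : set R), measurable B ->
        distribution P (X j) B = distribution P (X k) B,
      forall j, ('E_P[X j] = 0)%E /\ variance P (X j) = (sigma ^+ 2)%:E,
      0 < sigma &
      {ae P, forall w, X_vec w != 0}].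

Definition assumption4 (delta : R) : Prop :=
  [/\ 0 < delta /\
      forall i j, ('E_P[Z i j] = 0)%E /\ variance P (Z i j) = (delta ^+ 2)%:E,
      exists C : R, forall i j, ('E_P[(fun w => Z i j w ^+ 4)%R] <= C%:E)%E,
      mutual_indep P (fun i => sigma_gen (Z i)) &
      forall i j k, j != k -> covariance P (Z i j) (Z i k) = 0%E].

End Model.

Definition orthogonal_group (R : realType) p : set 'M[R]_p :=
  [set g | g^T *m g = 1%:M].

(* p x p matrices with their Borel sigma-algebra. *)
Definition borel_mx (R : realType) p := g_sigma_algebraType (@open 'M[R]_p).

(* Haar measure on O(p), seen as a Borel probability measure on p x p matrices
   carried by O(p): it is invariant under left translations. *)
Definition is_haar (R : realType) p (mu : set (borel_mx R p) -> \bar R) : Prop :=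
  mu (@orthogonal_group R p) = 1%E /\
  forall (g : 'M[R]_p) (B : set (borel_mx R p)),
    orthogonal_group g -> measurable B ->
    mu ((fun x : 'M[R]_p => g *m x) @^-1` B) = mu B.

(* The span of the images M e_1, ..., M e_k of the first k basis vectors. *)
Definition span_cols (R : realType) p (k : nat) (M : 'M[R]_p) :
    {vspace 'cV[R]_p} :=
  <<[seq col j M | j : 'I_p <- enum 'I_p & (j < k)%N]>>%VS.

Section RandomSubspace.
Context {R : realType} {d : measure_display} {T : measurableType d}.
Context {P : probability T R} {p : nat}.
Implicit Types (L : T -> {vspace 'cV[R]_p}) (xi : {RV P >-> borel_mx R p}).

Definition random_subspace k xi L : Prop :=
  [/\ (1 <= k <= p.-1)%N,
      forall w, orthogonal_group (xi w : 'M[R]_p) &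
      forall w, L w = span_cols k (xi w)].

Definition haar_random_subspace k xi L : Prop :=
  random_subspace k xi L /\ is_haar (distribution P xi).

End RandomSubspace.

(* Dimension sequences start at p = 2, the first p for which R^p has a subspace
   of dimension between 1 and p - 1. *)
Definition sqrt_dominated (R : realType) (k : nat -> nat) : Prop :=
  [/\ forall p, (2 <= p)%N -> (0 < k p)%N,
      forall p m, (2 <= p)%N -> (p <= m)%N -> (k p <= k m)%N &
      (\sum_(2 <= p <oo) ((k p)%:R ^+ 2 / p%:R ^+ 2 : R)%:E < +oo)%E].

(* Main.v *)
(* Write Y = beta X^T + Z for the return matrix and h = Y chi / sqrt(n s_p^2) with
   chi a unit vector of R^n. By the law of large numbers (Rajchman's subsequence
   argument) Y^T Y / p converges to B^2 X X^T + delta^2 I, where B^2 is the limit of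
   |beta|^2 / p. The Rayleigh quotient then forces chi to align with X and s_p^2 to be
   asymptotic to p (B^2 |X|^2 + delta^2) / n, so that psi_p and (h, b) have the same
   limit psi.

   For a subspace V of square root dominated dimension, independent of Z, a fourth
   moment bound gives E |proj_V Z_j|^4 = O(k_p^2), which is summable after division by
   p^2; hence |proj_V Z_j| = o(sqrt p) almost surely and proj_V h is asymptotically
   psi proj_V b. Consequently the squared cosine between the MAPS estimator and b is
   asymptotically an increasing function of t = |proj_V b|^2 alone. For span{q} this t
   tends to c = lim (b, q)^2; for span{L, q} it is at least (b, q)^2; by the same moment
   bound, now applied to the Haar directions, |proj_H b| tends to 0, so t tends to 0 for
   H and to c for span{H, q}. *)

(* The vector [h] is built from the noise, so no moment bound applies to its projection directly.
   Instead the noise columns are projected: [h] is a multiple of [b] plus, divided by sqrt(n s_p^2),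
   a combination of the n noise columns with coefficients in [-1, 1], and n is fixed. Fourth moments
   are used because second moments would only give k_p / p, which is never summable, whereas k_p^2 /
   p^2 is what square root domination sums. Adjoining q costs one more direction, the normalised
   residual of q; it is a function of the random matrix alone, hence still independent of the noise.
   After these bounds everything is deterministic, on one path of an almost sure event. Since
   |proj_V b|^2 need not converge for V = span{L, q}, the error is compared with a function of this
   number through a difference tending to 0, and monotonicity then gives (a). The sign of the cosine
   comes from (h, q) >= 0 together with the positive limit of the means of beta. *)
From HB Require Import structures.
Require Import Defs.
From mathcomp Require Import all_boot all_order all_algebra.
From mathcomp Require Import all_classical all_reals all_analysis.
From mathcomp Require Import measurable_realfun ring lra.

Set Implicit Arguments.
Unset Strict Implicit.
Unset Printing Implicit Defensive.

Import Order.TTheory GRing.Theory Num.Theory.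
Import numFieldNormedType.Exports.
Local Open Scope classical_set_scope.
Local Open Scope ring_scope.

(** * Integrals of functions of two independent random elements *)

Section IndepFubini.
Context {R : realType} {d : measure_display} {T : measurableType d}.
Variable P : probability T R.
Context {d1 d2} {T1 : measurableType d1} {T2 : measurableType d2}.
Variables (U : T -> T1) (V : T -> T2).
Hypotheses (mU : measurable_fun setT U) (mV : measurable_fun setT V).
Hypothesis UV : indep2 P (g_sigma_algebra_preimage U) (g_sigma_algebra_preimage V).

HB.instance Definition _ := isMeasurableFun.Build _ _ _ _ U mU.
HB.instance Definition _ := isMeasurableFun.Build _ _ _ _ V mV.

Let W w := (U w, V w).
Let mW : measurable_fun setT W.
Proof. exact: measurable_fun_pair. Qed.
HB.instance Definition _ := isMeasurableFun.Build _ _ _ _ W mW.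

Let joint_prod A : measurable A ->
  (distribution P U \x distribution P V)%E A = distribution P W A.
Proof.
apply: product_measure_unique => B C mB mC.
rewrite /distribution /pushforward /=.
rewrite -UV; first by congr (P _).
- by exists B => //; rewrite setTI.
- by exists C => //; rewrite setTI.
Qed.

(** By independence the law of the pair is the product of the two laws. Both sides are integrals
    over [P], with [w'] an independent copy of the sample point. *)
Lemma indep_fubini_tonelli (f : T1 * T2 -> \bar R) :
  measurable_fun setT f -> (forall x, (0 <= f x)%E) ->
  (\int[P]_w f (U w, V w) = \int[P]_w \int[P]_w' f (U w, V w'))%E.
Proof.
move=> mf f0.
have := ge0_integral_distribution (P := P) (W : {mfun T >-> (T1 * T2)%type}) mf f0.
move=> fW; transitivity (\int[distribution P W]_z f z)%E => // {fW}.
rewrite -(eq_measure_integral (distribution P W) (fun A mA _ => joint_prod mA)).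
rewrite fubini_tonelli1//.
rewrite (ge0_integral_distribution (P := P) (U : {mfun T >-> T1})); last 2 first.
- exact: measurable_fun_fubini_tonelli_F.
- by move=> x; apply: integral_ge0.
apply: eq_integral => w _ /=; rewrite /fubini_F.
rewrite (ge0_integral_distribution (P := P) (V : {mfun T >-> T2}))//.
exact: measurableT_comp.
Qed.

Lemma indep_integral_le (f : T1 * T2 -> \bar R) (c : \bar R) :
  measurable_fun setT f -> (forall x, (0 <= f x)%E) ->
  (forall w, (\int[P]_w' f (U w, V w') <= c)%E) ->
  (\int[P]_w f (U w, V w) <= c)%E.
Proof.
move=> mf f0 fc; rewrite indep_fubini_tonelli//.
have -> : c = (\int[P]_w cst c w)%E.
  by rewrite integral_cst// [X in (_ * X)%E]probability_setT mule1.
apply: ge0_le_integral => //.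
  by move=> w _; apply: integral_ge0.
rewrite (_ : (fun w => _) = fubini_F (distribution P V) f \o U); last first.
  apply/funext => w; rewrite /= /fubini_F.
  rewrite (ge0_integral_distribution (P := P) (V : {mfun T >-> T2}))//.
  exact: measurableT_comp.
apply: measurableT_comp => //; exact: measurable_fun_fubini_tonelli_F.
Qed.

Lemma indep_Fubini (f : T1 * T2 -> \bar R) : measurable_fun setT f ->
  P.-integrable setT (fun w => f (U w, V w)) ->
  (\int[P]_w f (U w, V w) = \int[distribution P U]_x \int[distribution P V]_y f (x, y))%E.
Proof.
move=> mf fi.
have fi' : (distribution P U \x distribution P V)%E.-integrable setT f.
  apply/integrableP; split => //.
  rewrite (eq_measure_integral (distribution P W) (fun A mA _ => joint_prod mA)).
  rewrite ge0_integral_distribution//; last exact: measurableT_comp.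
  by case/integrableP: fi.
rewrite integral12_prod_meas1//.
rewrite (eq_measure_integral (distribution P W) (fun A mA _ => joint_prod mA)).
by rewrite integral_distribution.
Qed.

End IndepFubini.

Section IndepProduct.
Context {R : realType} {d : measure_display} {T : measurableType d}.
Variable P : probability T R.
Variables (f g : T -> R).
Hypotheses (intf : P.-integrable setT (EFin \o f))
  (intg : P.-integrable setT (EFin \o g)).
Hypothesis fg : indep2 P (g_sigma_algebra_preimage f) (g_sigma_algebra_preimage g).

Let mf : measurable_fun setT f.
Proof. by apply/measurable_EFinP; case/integrableP: intf. Qed.

Let mg : measurable_fun setT g.
Proof. by apply/measurable_EFinP; case/integrableP: intg. Qed.

HB.instance Definition _ := isMeasurableFun.Build _ _ _ _ f mf.
HB.instance Definition _ := isMeasurableFun.Build _ _ _ _ g mg.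

Let F (z : R * R) := (z.1 * z.2)%:E.
Let mF : measurable_fun setT F.
Proof. by apply/measurable_EFinP; exact: measurable_funM. Qed.

(** Tonelli gives E|fg| = E|f| E|g|, so first moments of the two factors suffice. *)
Lemma indep_integrableM : P.-integrable setT (fun w => (f w * g w)%:E).
Proof.
apply/integrableP; split; first by apply/measurable_EFinP; exact: measurable_funM.
rewrite (indep_fubini_tonelli mf mg fg (f := abse \o F)) /F //=; last first.
  exact: measurableT_comp.
rewrite (eq_integral (fun w => `|f w|%:E * \int[P]_w' `|g w'|%:E)%E); last first.
  move=> w _; rewrite -ge0_integralZl//=; last first.
    by apply/measurable_EFinP; exact: measurableT_comp.
  by apply: eq_integral => w' _; rewrite normrM.
have := intg => /integrableP[_]; set c := (\int[P]_w' _)%E => cfin.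
have cfin' : (\int[P]_w' `|g w'|%:E)%E \is a fin_num.
  by rewrite ge0_fin_numE// integral_ge0.
rewrite ge0_integralZr//=; last 2 first.
- by apply/measurable_EFinP; exact: measurableT_comp.
- by apply: integral_ge0.
by rewrite lte_mul_pinfty// ?integral_ge0// ge0_fin_numE ?integral_ge0//;
  case/integrableP: intf.
Qed.

Lemma indep_RintegralM :
  \int[P]_w (f w * g w) = (\int[P]_w f w) * \int[P]_w g w.
Proof.
rewrite /Rintegral -fineM ?integrable_fin_num//; congr fine.
rewrite (indep_Fubini mf mg fg mF indep_integrableM) /F/=.
have gi : (distribution P g).-integrable setT (fun y => y%:E).
  by apply: (integrable_pushforward mg) => //; exact/measurable_EFinP.
transitivity (\int[distribution P f]_x (x%:E * \int[P]_w (g w)%:E))%E.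
  apply: eq_integral => x _.
  transitivity (x%:E * \int[distribution P g]_y y%:E)%E.
    by rewrite -integralZl//; apply: eq_integral => y _; rewrite EFinM.
  by rewrite integral_distribution.
have gf : (\int[P]_w (g w)%:E)%E \is a fin_num by exact: integrable_fin_num.
rewrite -(fineK gf) integralZr//; last first.
  by apply: (integrable_pushforward mf) => //; exact/measurable_EFinP.
by rewrite integral_distribution.
Qed.

End IndepProduct.

(** * Sub-sigma-algebras, and independence of a group from the next member *)

Section SubSigmaAlgebra.
Context {R : realType} {d : measure_display} {T : measurableType d}.
Variable P : probability T R.

Lemma indep2S (F F' G G' : set (set T)) :
  F' `<=` F -> G' `<=` G -> indep2 P F G -> indep2 P F' G'.
Proof. by move=> FF GG FG A B /FF FA /GG GB; exact: FG. Qed.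

Lemma indep2C (F G : set (set T)) : indep2 P F G -> indep2 P G F.
Proof. by move=> FG A B GA FB; rewrite setIC FG// muleC. Qed.

Lemma preimage_measurable_fun d' (T' : measurableType d') (C : set (set T))
    (f : g_sigma_algebraType C -> T') :
  measurable_fun setT f -> @g_sigma_algebra_preimage d' T T' f `<=` <<s C >>.
Proof. by move=> mf A [B mB <-]; apply: mf. Qed.

Lemma measurable_fun_preimage d' (T' : measurableType d') (C : set (set T))
    (f : T -> T') :
  g_sigma_algebra_preimage f `<=` <<s C >> ->
  @measurable_fun _ _ (g_sigma_algebraType C) T' setT f.
Proof. by move=> fC _ B mB; apply: fC; exists B. Qed.

Lemma preimage_sub_measurable d' (T' : measurableType d') (f : T -> T') :
  measurable_fun setT f -> g_sigma_algebra_preimage f `<=` measurable.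
Proof. by move=> mf A [B mB <-]; apply: mf. Qed.

(** The identity, as a map into T with a smaller sigma-algebra, is a random element that generates
    nothing beyond it. Independence from the whole noise array, or from all of beta, thereby becomes
    independence of two random elements, the form required by the Fubini lemmas. *)
Lemma measurable_id_sub_sigma (C : set (set T)) : C `<=` measurable ->
  measurable_fun setT (id : T -> g_sigma_algebraType C).
Proof.
move=> CT _ B mB; rewrite setTI.
apply: (@smallest_sub _ (sigma_algebra setT) C measurable) => //.
exact: sigma_algebra_measurable.
Qed.

Lemma preimage_id_sub_sigma (C : set (set T)) :
  g_sigma_algebra_preimage (id : T -> g_sigma_algebraType C) `<=` <<s C >>.
Proof. by move=> A [B mB <-]; rewrite setTI. Qed.

Lemma measurable_fun_sub_sigma d' (T' : measurableType d') (C : set (set T))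
    (f : g_sigma_algebraType C -> T') : C `<=` measurable ->
  measurable_fun setT f -> @measurable_fun _ _ T T' setT f.
Proof. by move=> CT mf; exact: measurableT_comp mf (measurable_id_sub_sigma CT). Qed.

Lemma measurable_fun_sigma_gen (I : Type) d' (T' : measurableType d')
    (X : I -> T -> T') i :
  @measurable_fun _ _ (g_sigma_algebraType (\bigcup_i g_sigma_algebra_preimage (X i)))
    T' setT (X i).
Proof.
by apply: measurable_fun_preimage => A XA; apply: sub_gen_smallest; exists i.
Qed.

Lemma sigma_algebra_preimage d' (T' : measurableType d') (f : T -> T') :
  sigma_algebra setT (g_sigma_algebra_preimage f).
Proof.
exact: (@sigma_algebra_measurable _ (g_sigma_algebra_preimageType f)).
Qed.

Section Grouping.
Variable F : nat -> set (set T).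
Hypotheses (Fsigma : forall i, sigma_algebra setT (F i))
  (FT : forall i, F i `<=` measurable) (Find : mutual_indep P F).

Let cyl m : set (set T) := [set A | exists2 B : nat -> set T,
  (forall i, F i (B i)) & A = \big[setI/setT]_(i <- iota 0 m) B i].

Let F_setT i : F i setT.
Proof. by case: (Fsigma i) => F0 FC _; rewrite -(setD0 setT); exact: FC. Qed.

Let F_setI i A B : F i A -> F i B -> F i (A `&` B).
Proof.
rewrite -(sigma_algebra_id (Fsigma i)).
exact: (@measurableI _ (g_sigma_algebraType (F i))).
Qed.

Let P_cyl (B : nat -> set T) s : (forall i, F i (B i)) -> uniq s ->
  P (\big[setI/setT]_(i <- s) B i) = (\prod_(i <- s) P (B i))%E.
Proof. by move=> FB us; apply: Find. Qed.

Let sub_cyl m : \bigcup_(i in `I_m) F i `<=` cyl m.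
Proof.
move=> A [i /= im FA]; exists (fun j => if j == i then A else setT).
  by move=> j; case: eqVneq => [->|].
rewrite (big_rem i) ?mem_iota//= eqxx big_seq big1 ?setIT// => j.
by rewrite (rem_filter _ (iota_uniq _ _)) mem_filter /= => /andP[/negPf ->].
Qed.

(** For fixed B, intersecting with B and scaling by the probability of B give two finite measures
    that agree on [cyl m]. These cylinders form a pi-system containing every [F i] with i < m, so
    the measures agree on the generated sigma-algebra. *)
Lemma mutual_indep_group m : indep2 P <<s \bigcup_(i in `I_m) F i >> (F m).
Proof.
move=> A B FA FB; have mB := FT FB.
have PBfin : P B \is a fin_num by exact: fin_num_measure.
have PB0 : 0 <= fine (P B) by exact: fine_ge0.
have cylT : cyl m setT.
  by exists (fun=> setT) => //; rewrite big1.
have cylm : cyl m `<=` measurable.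
  move=> _ [C FC ->]; apply: bigsetI_measurable => i _; exact/FT.
rewrite muleC -(fineK PBfin).
apply: (g_sigma_algebra_measure_unique (cyl m) cylm (fun=> setT) (fun=> cylT) _
  (mrestr P mB) (mscale (NngNum PB0) P)) => //.
- by rewrite bigcup_const//; exists 0%N.
- move=> _ _ [C FC ->] [D FD ->]; exists (fun i => C i `&` D i).
    by move=> i; exact: F_setI.
  by rewrite big_split.
- move=> _ [C FC ->]; rewrite /mrestr.
  rewrite -[RHS]/((fine (P B))%:E * P (\big[setI/setT]_(i <- iota 0 m) C i))%E fineK//.
  (* Placing B at position m turns the product formula for m + 1 events into the required one. *)
  pose C' i := if i == m then B else C i.
  have FC' i : F i (C' i) by rewrite /C'; case: eqVneq => [->|].
  have C'm : C' m = B by rewrite /C' eqxx.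
  have CC' : forall i, i \in iota 0 m -> C' i = C i.
    by move=> i; rewrite mem_iota /= /C' => /ltn_eqF ->.
  have := P_cyl FC' (iota_uniq 0 m.+1).
  rewrite -addn1 iotaD add0n /= !big_cat /= !big_seq1 C'm => PC.
  have E1 : \big[setI/setT]_(i <- iota 0 m) C i = \big[setI/setT]_(i <- iota 0 m) C' i.
    by rewrite [LHS]big_seq [RHS]big_seq; apply: eq_bigr => i im; rewrite CC'.
  by rewrite muleC E1 -(P_cyl FC' (iota_uniq 0 m)) in PC *; exact: PC.
- by move=> k; rewrite /mrestr /= (le_lt_trans (probability_le1 _ _)) ?ltry// setTI.
- move: FA; apply: sub_smallest2r; first exact: smallest_sigma_algebra.
  exact: sub_cyl.
Qed.

End Grouping.
End SubSigmaAlgebra.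

(** * Fourth moments *)

Section Moments.
Context {R : realType} {d : measure_display} {T : measurableType d}.
Variable P : probability T R.
Implicit Types f g : T -> R.

Definition integrable4 f :=
  measurable_fun setT f /\ P.-integrable setT (fun w => (f w ^+ 4)%:E).

(** The monomial is at most M^4 with M = max(1, |x|, |y|), and M^4 is one of the three nonnegative
    summands on the right. *)
Lemma expr_mul_le4 (x y : R) (a b : nat) : (a + b <= 4)%N ->
  `|x ^+ a * y ^+ b| <= 1 + x ^+ 4 + y ^+ 4.
Proof.
move=> ab; pose M := Num.max 1 (Num.max `|x| `|y|).
have M1 : 1 <= M by rewrite le_max lexx.
have xM : `|x| <= M by rewrite !le_max lexx orbT.
have yM : `|y| <= M by rewrite !le_max lexx !orbT.
have M0 : 0 <= M by apply: le_trans M1.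
apply: (@le_trans _ _ (M ^+ 4)).
  rewrite normrM !normrX (@le_trans _ _ (M ^+ a * M ^+ b))//.
    by apply: ler_pM; rewrite ?exprn_ge0//; apply: lerXn2r; rewrite ?nnegrE.
  by rewrite -exprD ler_weXn2l.
have x4 : `|x| ^+ 4 = x ^+ 4 by rewrite -normrX ger0_norm// exprn_even_ge0.
have y4 : `|y| ^+ 4 = y ^+ 4 by rewrite -normrX ger0_norm// exprn_even_ge0.
have x0 : 0 <= x ^+ 4 by rewrite exprn_even_ge0.
have y0 : 0 <= y ^+ 4 by rewrite exprn_even_ge0.
rewrite /M; case: (leP 1 (Num.max `|x| `|y|)) => _; last by rewrite expr1n; lra.
by case: (leP `|x| `|y|) => _; rewrite ?x4 ?y4; lra.
Qed.

Lemma integrable_cstP (c : R) : P.-integrable setT (fun=> c%:E).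
Proof. exact: finite_measure_integrable_cst. Qed.

Lemma integrable4M f g a b : integrable4 f -> integrable4 g -> (a + b <= 4)%N ->
  P.-integrable setT (fun w => (f w ^+ a * g w ^+ b)%:E).
Proof.
move=> [mf f4] [mg g4] ab.
apply: (le_integrable measurableT _ _ (g := fun w => (1 + f w ^+ 4 + g w ^+ 4)%:E)).
- by apply/measurable_EFinP; apply: measurable_funM; exact: measurable_funX.
- move=> w _; rewrite /= lee_fin (le_trans (expr_mul_le4 _ _ ab))//.
  exact: ler_norm.
- under eq_fun do rewrite !EFinD; do 2?[apply: integrableD => //].
  exact: integrable_cstP.
Qed.

Lemma integrable4X f a : integrable4 f -> (a <= 4)%N ->
  P.-integrable setT (fun w => (f w ^+ a)%:E).
Proof.
move=> f4 a4; have := @integrable4M f f a 0 f4 f4; rewrite addn0 => /(_ a4).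
by under eq_fun do rewrite expr0 mulr1.
Qed.

Lemma integrable4_cst0 : integrable4 (fun=> 0).
Proof. by split => //; under eq_fun do rewrite expr0n /=; exact: integrable_cstP. Qed.

Lemma integrable4Z c f : integrable4 f -> integrable4 (fun w => c * f w).
Proof.
move=> [mf f4]; split; first exact: measurable_funM.
by under eq_fun do rewrite exprMn EFinM; exact: integrableZl.
Qed.

Lemma Rintegral_sumZ (I : Type) (r : seq I) (a : I -> R) (F : I -> T -> R) :
  (forall i, P.-integrable setT (EFin \o F i)) ->
  P.-integrable setT (fun w => (\sum_(i <- r) a i * F i w)%:E) /\
  \int[P]_w (\sum_(i <- r) a i * F i w) = \sum_(i <- r) a i * \int[P]_w F i w.
Proof.
move=> iF; elim: r => [|i r [ir IH]].
  split; first by under eq_fun do rewrite big_nil; exact: integrable_cstP.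
  rewrite big_nil (@eq_Rintegral _ _ _ P setT (fun=> 0)); last by move=> w _;
    rewrite big_nil.
  by rewrite Rintegral_cst// mul0r.
have iaF : P.-integrable setT (EFin \o (fun w => a i * F i w)).
  rewrite (_ : EFin \o _ = (fun w => (a i)%:E * (EFin \o F i) w)%E)//.
  exact: integrableZl.
split.
  by under eq_fun do rewrite big_cons EFinD; apply: integrableD.
rewrite big_cons -IH -RintegralZl// -RintegralD//.
by apply: eq_Rintegral => w _; rewrite big_cons.
Qed.

Lemma preimage_comp_sub f (phi : R -> R) : measurable_fun setT phi ->
  g_sigma_algebra_preimage (phi \o f) `<=` g_sigma_algebra_preimage f.
Proof.
move=> mphi A [B mB <-]; exists (phi @^-1` B); last by rewrite !setTI.
by rewrite -[X in measurable X]setTI; exact: mphi.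
Qed.

Section IndepPair.
Variables (f g : T -> R).
Hypotheses (f4 : integrable4 f) (g4 : integrable4 g).
Hypothesis fg : indep2 P (g_sigma_algebra_preimage f) (g_sigma_algebra_preimage g).

Lemma Rintegral_exprD_indep k : (k <= 4)%N ->
  \int[P]_w ((f w + g w) ^+ k) =
  \sum_(i < k.+1) 'C(k, i)%:R * ((\int[P]_w (f w ^+ (k - i))) * \int[P]_w (g w ^+ i)).
Proof.
move=> k4.
pose F (i : 'I_k.+1) w := f w ^+ (k - i) * g w ^+ i.
have iF i : P.-integrable setT (EFin \o F i).
  by apply: integrable4M => //; rewrite subnK// -ltnS.
rewrite (@eq_Rintegral _ _ _ P setT (fun w => \sum_(i < k.+1) 'C(k, i)%:R * F i w));
  last first.
  by move=> w _; rewrite exprDn; apply: eq_bigr => i _; rewrite mulr_natl.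
rewrite (Rintegral_sumZ _ _ iF).2; apply: eq_bigr => i _; congr (_ * _).
apply: indep_RintegralM.
- by apply: integrable4X => //; rewrite (leq_trans _ k4)// leq_subr.
- by apply: integrable4X => //; rewrite (leq_trans _ k4)// -ltnS.
- apply: indep2S fg.
  + apply: (@preimage_comp_sub f (fun x => x ^+ (k - i))); exact: measurable_funX.
  + apply: (@preimage_comp_sub g (fun x => x ^+ i)); exact: measurable_funX.
Qed.

End IndepPair.

Lemma integrable4D f g : integrable4 f -> integrable4 g ->
  integrable4 (fun w => f w + g w).
Proof.
move=> f4 g4; split; first by apply: measurable_funD; [case: f4|case: g4].
pose F (i : 'I_5) w := f w ^+ (4 - i) * g w ^+ i.
have iF i : P.-integrable setT (EFin \o F i).
  by apply: integrable4M => //; rewrite subnK// -ltnS.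
have := (@Rintegral_sumZ _ (index_enum _) (fun i : 'I_5 => 'C(4, i)%:R) F iF).1.
congr (integrable _ _ _); apply/funext => w; rewrite exprDn; congr EFin.
by apply: eq_bigr => i _; rewrite mulr_natl.
Qed.

Lemma mutual_indepS (I : eqType) (F G : I -> set (set T)) :
  (forall i, G i `<=` F i) -> mutual_indep P F -> mutual_indep P G.
Proof. by move=> GF FI s A us GA; apply: FI => // i /GA /GF. Qed.

(** Induction on the number of terms, carrying the first, second and fourth moments. In the
    expansion of (S + Y)^4, with S independent of Y, the terms containing S^3 Y or S Y^3 vanish
    since both means are 0, so no control of third moments enters. *)
Lemma moment4_lincomb (W : nat -> T -> R) (K v : R) :
  mutual_indep P (fun i => g_sigma_algebra_preimage (W i)) ->
  (forall i, integrable4 (W i)) -> (forall i, \int[P]_w W i w = 0) ->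
  (forall i, \int[P]_w (W i w ^+ 2) <= v) -> v ^+ 2 <= K ->
  (forall i, \int[P]_w (W i w ^+ 4) <= K) ->
  forall (u : nat -> R) m, integrable4 (fun w => \sum_(i < m) u i * W i w) /\
    \int[P]_w ((\sum_(i < m) u i * W i w) ^+ 4) <= 3 * K * (\sum_(i < m) u i ^+ 2) ^+ 2.
Proof.
move=> Wind W4 W1 Wv vK WK u m.
have v0 : 0 <= v.
  by apply: le_trans (Wv 0%N); apply: Rintegral_ge0 => w _; rewrite sqr_ge0.
have K0 : 0 <= K by apply: le_trans vK; rewrite sqr_ge0.
pose S m w := \sum_(i < m) u i * W i w; pose s m := \sum_(i < m) u i ^+ 2.
suff [] : [/\ integrable4 (S m), \int[P]_w S m w = 0,
    \int[P]_w (S m w ^+ 2) <= v * s m & \int[P]_w (S m w ^+ 4) <= 3 * K * s m ^+ 2].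
  by move=> ? _ _ ?; split.
elim: m => [|m [S4 S1 S2 IH]].
  have S0 : S 0%N = fun=> 0 by apply/funext => w; rewrite /S big_ord0.
  have R0 k : \int[P]_w (S 0%N w ^+ k.+1) = 0.
    under eq_Rintegral do rewrite S0 expr0n/=.
    by rewrite Rintegral_cst// mul0r.
  split; rewrite ?R0 /s ?big_ord0 ?mulr0 ?expr0n ?mulr0//.
    rewrite S0; exact: integrable4_cst0.
  by rewrite -[RHS](R0 0%N); apply: eq_Rintegral => w _; rewrite expr1.
pose Y w := u m * W m w.
have SE : S m.+1 = fun w => S m w + Y w.
  by apply/funext => w; rewrite /S big_ord_recr.
have Y4 : integrable4 Y by exact: integrable4Z.
have SY : indep2 P (g_sigma_algebra_preimage (S m)) (g_sigma_algebra_preimage Y).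
  have WT i : g_sigma_algebra_preimage (W i) `<=` measurable.
    by apply: preimage_sub_measurable; case: (W4 i).
  apply: indep2S (mutual_indep_group (fun i => sigma_algebra_preimage (W i)) WT Wind
    (m := m)).
  - apply: preimage_measurable_fun.
    apply: measurable_sum => i; apply: measurable_funM => //.
    apply: measurable_fun_preimage => A WA; apply: sub_gen_smallest.
    by exists i => /=.
  - by apply: (@preimage_comp_sub (W m) (fun x => u m * x)); exact: measurable_funM.
have EX k : (k <= 4)%N -> \int[P]_w (Y w ^+ k) = u m ^+ k * \int[P]_w (W m w ^+ k).
  move=> k4; rewrite -RintegralZl//; last exact: integrable4X.
  by apply: eq_Rintegral => w _; rewrite exprMn.
have E0 (h : T -> R) : \int[P]_w (h w ^+ 0) = 1.
  have P1 : fine (P setT) = 1 by rewrite probability_setT.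
  transitivity (\int[P]_w (cst 1 w)); first by [].
  by rewrite Rintegral_cst// mul1r P1.
have E1 (h : T -> R) : \int[P]_w (h w ^+ 1) = \int[P]_w h w by [].
have Y1 : \int[P]_w (Y w ^+ 1) = 0 by rewrite EX// E1 W1 mulr0.
have sS : s m.+1 = s m + u m ^+ 2 by rewrite /s big_ord_recr.
have s0 : 0 <= s m by apply: sumr_ge0 => i _; rewrite sqr_ge0.
have u0 : 0 <= u m ^+ 2 by rewrite sqr_ge0.
have Y2 : 0 <= \int[P]_w (Y w ^+ 2) <= u m ^+ 2 * v.
  rewrite Rintegral_ge0 => [/=|w _]; last by rewrite sqr_ge0.
  by rewrite EX// ler_wpM2l.
have Y4K : \int[P]_w (Y w ^+ 4) <= u m ^+ 4 * K.
  by rewrite EX// ler_wpM2l// exprn_even_ge0.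
have S20 : 0 <= \int[P]_w (S m w ^+ 2) by apply: Rintegral_ge0 => w _; rewrite sqr_ge0.
split.
- by rewrite SE; exact: integrable4D.
- rewrite SE -E1 Rintegral_exprD_indep// !big_ord_recl big_ord0 /= /bump /=.
  by rewrite subn0 subnn !E1 S1 -E1 Y1 !E0 !(mulr0, mul0r, addr0).
- rewrite SE Rintegral_exprD_indep// !big_ord_recl big_ord0 /= /bump /=.
  rewrite subn0 subnn !E0 (_ : (1 + 0 = 1)%N)// Y1 sS.
  by rewrite !(mulr0, mulr1, mul1r, add0r, addr0); lra.
- rewrite SE Rintegral_exprD_indep// !big_ord_recl big_ord0 /= /bump /=.
  rewrite !(add1n, add0n, addn0, subn0, subnn) Y1 !E0 E1 S1 sS.
  rewrite (_ : 4 - 2 = 2)%N// (_ : 'C(4, 2) = 6)%N// (_ : 'C(4, 4) = 1)%N//.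
  rewrite !(mulr0, mul0r, mulr1, mul1r, add0r, addr0).
  (* The surviving cross term has binomial coefficient 6 and must fit the middle term of 3K(s +
     u^2)^2, which explains both the factor 3 and the condition [v ^+ 2 <= K]. *)
  have h : (\int[P]_w (S m w ^+ 2)) * \int[P]_w (Y w ^+ 2) <= K * (s m * u m ^+ 2).
    apply: (@le_trans _ _ ((v * s m) * (u m ^+ 2 * v))).
      by apply: ler_pM => //; lra.
    rewrite [leLHS](_ : _ = v ^+ 2 * (s m * u m ^+ 2)); last by ring.
    by apply: ler_wpM2r => //; exact: mulr_ge0.
  have -> : 3 * K * (s m + u m ^+ 2) ^+ 2 = 3 * K * s m ^+ 2 +
    6 * (K * (s m * u m ^+ 2)) +
    3 * (u m ^+ 4 * K) by ring.
  have : 0 <= u m ^+ 4 * K by rewrite mulr_ge0// exprn_even_ge0.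
  by lra.
Qed.

End Moments.

(** * Almost sure convergence and Rajchman's law of large numbers *)

Section AlmostSure.
Context {R : realType} {d : measure_display} {T : measurableType d}.
Variable P : probability T R.

(** The expectations sum to at most M, so the series of the nonnegative [W m] is integrable, hence
    finite almost everywhere, and its terms tend to 0. This plays the part of Chebyshev with
    Borel-Cantelli. *)
Lemma ae_cvg0_summable (W : nat -> T -> R) (c : nat -> R) (M : R) :
  (forall m, measurable_fun setT (W m)) -> (forall m w, 0 <= W m w) ->
  (forall m, (\int[P]_w (W m w)%:E <= (c m)%:E)%E) ->
  (forall N, \sum_(m < N) c m <= M) ->
  {ae P, forall w, W m w @[m --> \oo] --> 0}.
Proof.
move=> mW W0 Wc cM.
have mEW m : measurable_fun setT (EFin \o W m) by exact/measurable_EFinP.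
have W0' m w : [set: T] w -> (0 <= (EFin \o W m) w)%E by rewrite lee_fin.
have intW : P.-integrable setT (fun w => \sum_(0 <= m <oo) (W m w)%:E)%E.
  apply/integrableP; split.
    by apply: (ge0_emeasurable_sum (P := xpredT)) => [m w Dw _|m _];
      [exact: (W0' m w Dw)|exact: mEW].
  rewrite (eq_integral (fun w => \sum_(0 <= m <oo) (EFin \o W m) w)%E); last first.
    by move=> w _; rewrite gee0_abs// nneseries_ge0// => m _ _; exact: W0'.
  rewrite integral_nneseries//; apply: (@le_lt_trans _ _ M%:E); last exact: ltry.
  apply: lime_le.
    by apply: is_cvg_nneseries => m _ _; apply: integral_ge0; exact: W0'.
  apply: nearW => N; rewrite big_mkord; apply: (@le_trans _ _ (\sum_(m < N) c m)%:E).
    by rewrite -sumEFin; apply: lee_sum => m _; exact: Wc.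
  by rewrite lee_fin.
have := integrable_ae measurableT intW; apply: filterS => w /(_ I) fw.
apply: cvg_series_cvg_0; apply: nondecreasing_is_cvgn.
  by apply: nondecreasing_series => m _ _; exact: W0.
exists (fine (\sum_(0 <= m <oo) (W m w)%:E)%E) => _ [N _ <-].
rewrite -lee_fin fineK// /series /= -sumEFin.
by apply: nneseries_lim_ge => m _ _; rewrite lee_fin.
Qed.

Lemma sum_inv_sqr_le N : \sum_(m < N) (m.+1%:R ^+ 2)^-1 <= 2 :> R.
Proof.
(* The sharper bound closes the induction, since 1/(N(N + 1)) telescopes; at N = 0 it reads 0 <= 2
   because the inverse of 0 is 0. *)
suff : \sum_(m < N) (m.+1%:R ^+ 2)^-1 <= 2 - N%:R^-1 :> R.
  by move/le_trans; apply; rewrite gerBl.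
elim: N => [|N IH]; first by rewrite big_ord0 invr0; lra.
rewrite big_ord_recr /=; case: N IH => [|N] IH; first by rewrite big_ord0; lra.
apply: le_trans (lerD IH (lexx _)) _.
have N0 : 0 < N.+1%:R :> R by [].
rewrite -(natr1 N.+1); set x : R := N.+1%:R in N0 *.
have -> : 2 - (x + 1)^-1 = 2 - x^-1 + (x * (x + 1))^-1 by field; lra.
by rewrite lerD2l lef_pV2 ?posrE; nra.
Qed.

Lemma sqr_cvg0 (u : nat -> R) : u m ^+ 2 @[m --> \oo] --> 0 -> u m @[m --> \oo] --> 0.
Proof.
move=> u2; apply/cvgr0Pnorm_lt => e e0.
have /cvgr0Pnorm_lt/(_ _ (exprn_gt0 2 e0)) := u2.
by apply: filterS => m; rewrite normrX ltr_pXn2r ?nnegrE// ltW.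
Qed.

Lemma sqrt_floor p : (0 < p)%N ->
  exists2 m, (0 < m)%N & (m ^ 2 <= p < m.+1 ^ 2)%N.
Proof.
move=> p0; have ex : exists m, (m ^ 2 <= p)%N by exists 0%N.
have bd m : (m ^ 2 <= p)%N -> (m <= p)%N.
  by move=> mp; apply: leq_trans mp; case: m => // m; rewrite -mulnn leq_pmulr.
case: (ex_maxnP ex bd) => m mp mmax; exists m.
  by apply: mmax; rewrite exp1n.
by rewrite mp /= ltnNge; apply/negP => /mmax; rewrite ltnn.
Qed.

Section Rajchman.
Variables (Y : nat -> T -> R) (K : R).
Hypotheses (mY : forall i, measurable_fun setT (Y i))
  (iY : forall i j, P.-integrable setT (fun w => (Y i w * Y j w)%:E))
  (YK : forall i, \int[P]_w (Y i w ^+ 2) <= K)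
  (Yorth : forall i j, i != j -> \int[P]_w (Y i w * Y j w) = 0).

Let S a k w := \sum_(i < k) Y (a + i)%N w.

Let mS a k : measurable_fun setT (S a k).
Proof. by apply: measurable_sum => i. Qed.

Let S2 a k : P.-integrable setT (fun w => (S a k w ^+ 2)%:E) /\
  \int[P]_w (S a k w ^+ 2) <= k%:R * K.
Proof.
have E w : S a k w ^+ 2 =
    \sum_(z : 'I_k * 'I_k) 1 * (Y (a + z.1)%N w * Y (a + z.2)%N w).
  rewrite expr2 /S big_distrlr pair_big /=.
  by apply: eq_bigr => z _; rewrite mul1r.
have [i1 i2] := @Rintegral_sumZ _ _ _ P _ (index_enum _) (fun=> 1)
  (fun (z : 'I_k * 'I_k) w => Y (a + z.1)%N w * Y (a + z.2)%N w) (fun z => iY _ _).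
split; first by under eq_fun do rewrite E.
rewrite (@eq_Rintegral _ _ _ P setT _ _ (fun w _ => E w)) i2.
rewrite -(pair_big xpredT xpredT
  (fun i j : 'I_k => 1 * \int[P]_w (Y (a + i)%N w * Y (a + j)%N w)))/=.
apply: (@le_trans _ _ (\sum_(i < k) K)); last by rewrite sumr_const card_ord mulr_natl.
apply: ler_sum => i _; rewrite (bigD1 i)//= mul1r big1 ?addr0.
  by apply: le_trans (YK (a + i)%N); rewrite le_eqVlt; apply/orP; left; apply/eqP.
by move=> j ji; rewrite Yorth ?mulr0// eqn_add2l eq_sym.
Qed.

(* [D m] controls all the averages over the block (m+1)^2 <= p < (m+2)^2. *)
Let D m w := ((S 0 (m.+1 ^ 2) w) ^+ 2 +
  \sum_(k < (m.+1 + m.+1).+1) (S (m.+1 ^ 2) k w) ^+ 2) / m.+1%:R ^+ 4.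

(** With x = m + 1, the sum up to the square contributes x^2 K and each of the 2x + 1 partial blocks
    at most 2x K. As x >= 1, x^2 + (2x + 1) 2x <= 7 x^2, and division by x^4 leaves a summable
    bound. *)
Let D_int m : (\int[P]_w (D m w)%:E <= ((7 * K) * (m.+1%:R ^+ 2)^-1)%:E)%E.
Proof.
have K0 : 0 <= K.
  by apply: le_trans (YK 0%N); apply: Rintegral_ge0 => w _; rewrite sqr_ge0.
set x : R := m.+1%:R; have x0 : 1 <= x by rewrite ler1n.
pose c : R := (x ^+ 4)^-1.
have [i1 e1] := S2 0 (m.+1 ^ 2).
have [i2 e2] := @Rintegral_sumZ _ _ _ P _ (index_enum _) (fun=> 1)
  (fun (k : 'I_(m.+1 + m.+1).+1) w => S (m.+1 ^ 2) k w ^+ 2) (fun k => (S2 _ k).1).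
have DE w : D m w = c * (S 0 (m.+1 ^ 2) w ^+ 2 +
    \sum_(k < (m.+1 + m.+1).+1) 1 * (S (m.+1 ^ 2) k w) ^+ 2).
  rewrite /D mulrC; congr (_ * (_ + _)).
  by apply: eq_bigr => k _; rewrite mul1r.
have i3 := integrableD measurableT i1 i2.
have i4 : P.-integrable setT (fun w => (D m w)%:E).
  under eq_fun do rewrite DE EFinM EFinD.
  exact: integrableZl.
rewrite -(fineK (integrable_fin_num measurableT i4)) lee_fin.
rewrite -/(Rintegral P setT (D m)).
rewrite (@eq_Rintegral _ _ _ P setT _ _ (fun w _ => DE w)) RintegralZl// RintegralD//.
rewrite e2 mulrC ler_pdivrMr ?exprn_gt0 ?(lt_le_trans _ x0)//.
have -> : 7 * K * (x ^+ 2)^-1 * x ^+ 4 = 7 * x ^+ 2 * K by field; lra.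
have xE : (m.+1 ^ 2)%:R = x ^+ 2 :> R by rewrite natrX.
have xE2 : (m.+1 + m.+1).+1%:R = x + x + 1 :> R by rewrite -natr1 natrD.
apply: (@le_trans _ _ (x ^+ 2 * K + (x + x + 1) * ((x + x) * K))); last first.
  rewrite mulrA -mulrDl ler_wpM2r//; nra.
apply: lerD; first by rewrite -xE.
apply: (@le_trans _ _ (\sum_(k < (m.+1 + m.+1).+1) (x + x) * K)); last first.
  by rewrite sumr_const card_ord -mulr_natl xE2.
apply: ler_sum => k _; rewrite mul1r; apply: le_trans (S2 _ k).2 _.
by rewrite ler_wpM2r// -natrD ler_nat -ltnS.
Qed.

(** The mean of p orthogonal variables has second moment O(1/p): not summable over all p, but
    summable along the squares. Between consecutive squares there are so few indices that the sum of
    the squared partial blocks can stand in for their maximum. *)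
Lemma rajchman : {ae P, forall w, p%:R^-1 * (\sum_(i < p) Y i w) @[p --> \oo] --> 0}.
Proof.
have : {ae P, forall w, D m w @[m --> \oo] --> 0}.
  apply: (@ae_cvg0_summable _ _ (7 * K * 2) _ _ D_int).
  - move=> m; apply: measurable_funM => //; apply: measurable_funD.
      exact: measurable_funX.
    by apply: measurable_sum => k; exact: measurable_funX.
  - move=> m w; rewrite divr_ge0 ?exprn_ge0// addr_ge0 ?sqr_ge0//.
    by apply: sumr_ge0 => k _; rewrite sqr_ge0.
  - move=> N; rewrite -mulr_sumr ler_wpM2l ?sum_inv_sqr_le// mulr_ge0//.
    by apply: le_trans (YK 0%N); apply: Rintegral_ge0 => w _; rewrite sqr_ge0.
apply: filterS => w Dw; apply: sqr_cvg0; apply/cvgr0Pnorm_lt => e e0.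
(* The factor 2 is spent in (A + B)^2 <= 2 (A^2 + B^2). *)
have e20 : 0 < e / 2 by rewrite divr_gt0.
have /cvgr0Pnorm_lt/(_ _ e20)[N _ DN] := Dw.
exists (N.+1 ^ 2)%N => // p /= Np.
have p0 : (0 < p)%N by apply: leq_trans Np.
have [[//|m] _ /andP[mp pm]] := sqrt_floor p0.
have Nm : (N <= m)%N.
  have : (N.+1 ^ 2 < m.+2 ^ 2)%N by apply: leq_ltn_trans pm.
  by rewrite ltn_exp2r.
have {}DN := DN m Nm.
have [k kle pE] : exists2 k, (k < (m.+1 + m.+1).+1)%N & p = (m.+1 ^ 2 + k)%N.
  exists (p - m.+1 ^ 2)%N; last by rewrite subnKC.
  rewrite ltn_subLR//; apply: leq_trans pm _.
  by rewrite -(addn1 m.+1) sqrnD exp1n muln1 -addnA leq_add2l add1n mul2n -addnn.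
have SE : \sum_(i < p) Y i w = S 0 (m.+1 ^ 2) w + S (m.+1 ^ 2) k w.
  by rewrite pE big_split_ord.
set M : R := m.+1%:R; have M0 : 0 < M by [].
have pM : M ^+ 2 <= p%:R by rewrite -natrX ler_nat.
have D0 : 0 <= D m w.
  rewrite divr_ge0 ?exprn_ge0// addr_ge0 ?sqr_ge0//.
  by apply: sumr_ge0 => j _; rewrite sqr_ge0.
rewrite ger0_norm ?sqr_ge0// SE.
set A := S 0 _ w; set B := S _ k w.
have AB : A ^+ 2 + B ^+ 2 <= D m w * M ^+ 4.
  rewrite /D divfK; last by rewrite expf_neq0// gt_eqF.
  rewrite lerD2l (bigD1 (Ordinal kle))//= lerDl.
  by apply: sumr_ge0 => j _; rewrite sqr_ge0.
have AB2 : (A + B) ^+ 2 <= 2 * (A ^+ 2 + B ^+ 2).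
  by have := sqr_ge0 (A - B); rewrite sqrrB sqrrD; lra.
move: DN; rewrite ger0_norm// => DN.
rewrite exprMn exprVn mulrC ltr_pdivrMr ?exprn_gt0 ?ltr0n//.
apply: le_lt_trans AB2 _.
apply: (@lt_le_trans _ _ (e * M ^+ 4)).
  have M4 : 0 < M ^+ 4 by exact: exprn_gt0.
  by nra.
rewrite ler_pM2l//.
have -> : M ^+ 4 = (M ^+ 2) ^+ 2 by rewrite -exprM.
by apply: lerXn2r; rewrite // nnegrE ?exprn_ge0// ltW.
Qed.

End Rajchman.
End AlmostSure.

(** * Averages of the noise array *)

Section ModelMoments.
Context {R : realType} {d : measure_display} {T : measurableType d}.
Variable P : probability T R.

Lemma mutual_indep_pair (I : eqType) (F : I -> set (set T)) i j :
  mutual_indep P F -> i != j -> indep2 P (F i) (F j).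
Proof.
move=> FI ij A B FA FB.
have := FI [:: i; j] (fun k => if k == i then A else B).
rewrite !big_cons !big_nil setIT mule1 eqxx eq_sym (negPf ij); apply.
  by rewrite /= inE ij.
by move=> k; rewrite !inE => /orP[] /eqP->; rewrite ?eqxx// eq_sym (negPf ij).
Qed.

Lemma integrable2M (f g : T -> R) :
  measurable_fun setT f -> measurable_fun setT g ->
  P.-integrable setT (fun w => (f w ^+ 2)%:E) ->
  P.-integrable setT (fun w => (g w ^+ 2)%:E) ->
  P.-integrable setT (fun w => (f w * g w)%:E).
Proof.
move=> mf mg f2 g2.
apply: (le_integrable measurableT _ _ (g := fun w => (f w ^+ 2 + g w ^+ 2)%:E)).
- by apply/measurable_EFinP; exact: measurable_funM.
- move=> w _; rewrite /= lee_fin normrM [leRHS]ger0_norm ?addr_ge0 ?sqr_ge0//.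
  rewrite -(real_normK (num_real (f w))) -(real_normK (num_real (g w))).
  by have := sqr_ge0 (`|f w| - `|g w|); rewrite sqrrB; nra.
- by under eq_fun do rewrite EFinD; apply: integrableD.
Qed.

Lemma ae_bounded_integrable (f : T -> R) (C : R) : measurable_fun setT f ->
  {ae P, forall w, `|f w| <= C} -> P.-integrable setT (EFin \o f).
Proof.
move=> mf fC; apply/integrableP; split; first exact/measurable_EFinP.
apply: (@le_lt_trans _ _ (\int[P]_w `|C|%:E)%E); last first.
  by rewrite integral_cst//= probability_setT mule1 ltry.
apply: ae_ge0_le_integral => //.
- by apply: measurableT_comp => //; exact/measurable_EFinP.
- by apply: filterS fC => w gw _; rewrite lee_fin (le_trans gw)// ler_norm.
Qed.

Lemma ae_le_Rintegral_cst (f : T -> R) (C : R) : measurable_fun setT f ->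
  (forall w, 0 <= f w) -> {ae P, forall w, f w <= C} -> 0 <= C ->
  \int[P]_w f w <= C.
Proof.
move=> mf f0 fC C0; rewrite -lee_fin /Rintegral fineK; last first.
  apply: integrable_fin_num => //; apply: (ae_bounded_integrable (C := C)) => //.
  by apply: filterS fC => w; rewrite ger0_norm.
have <- : (\int[P]_w C%:E = C%:E)%E by rewrite integral_cst//= probability_setT mule1.
apply: ae_ge0_le_integral => //.
- by move=> w _; rewrite lee_fin.
- exact/measurable_EFinP.
- by apply: filterS fC => w fw _; rewrite lee_fin.
Qed.

Section Noise.
Variables (n : nat) (Z : nat -> 'I_n -> {RV P >-> R}) (delta : R).
Hypothesis A4 : assumption4 Z delta.

Local Notation Zgen := (sigma_gen (fun ij : nat * 'I_n => Z ij.1 ij.2 : T -> R)).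

(** One constant serves both roles in [moment4_lincomb]: it bounds the fourth moments and also the
    square of the variance, whence the maximum taken as witness. *)
Lemma noise_moments : exists2 K : R, delta ^+ 4 <= K & forall i j,
  [/\ integrable4 P (Z i j), \int[P]_w Z i j w = 0,
      \int[P]_w (Z i j w ^+ 2) = delta ^+ 2 & \int[P]_w (Z i j w ^+ 4) <= K].
Proof.
case: A4 => -[d0 Zm] [C ZC] _ _.
have Z4 i j : integrable4 P (Z i j).
  split => //; apply/integrableP; split.
    by apply/measurable_EFinP; exact: measurable_funX.
  apply: le_lt_trans (ltry C); have := ZC i j; rewrite unlock.
  by under [X in _ -> (X <= _)%E]eq_integral do rewrite gee0_abs ?lee_fin
    ?exprn_even_ge0//.
have Z0 i j : \int[P]_w Z i j w = 0.
  by have [EZ _] := Zm i j; move: EZ; rewrite unlock /Rintegral => ->.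
exists (Num.max C (delta ^+ 4)); first by rewrite le_max lexx orbT.
move=> i j; split => //.
  have [EZ] := Zm i j; rewrite /variance covariance.unlock EZ /= unlock => VZ.
  rewrite /Rintegral (_ : \int[P]_w _ = (delta ^+ 2)%:E)%E//.
  rewrite -VZ; apply: eq_integral => w _; congr EFin.
  by transitivity ((Z i j w - 0) * (Z i j w - 0)); first by rewrite !subr0 expr2.
rewrite le_max; apply/orP; left; rewrite -lee_fin /Rintegral fineK.
  by have := ZC i j; rewrite unlock.
by apply: integrable_fin_num => //; case: (Z4 i j).
Qed.

Lemma noise_covariance i j k :
  \int[P]_w (Z i j w * Z i k w) = (j == k)%:R * delta ^+ 2.
Proof.
have [K _ ZK] := noise_moments.
have [->|jk] := eqVneq j k.
  by rewrite mul1r; have [_ _ <- _] := ZK i k; apply: eq_Rintegral => w _; rewrite expr2.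
case: A4 => -[_ Zm] _ _ /(_ i j k jk).
have [Ej _] := Zm i j; have [Ek _] := Zm i k.
rewrite covariance.unlock Ej Ek /= unlock mul0r => C0.
rewrite /Rintegral (_ : \int[P]_w _ = 0)%E// -[RHS]C0.
apply: eq_integral => w _; congr EFin.
by transitivity ((Z i j w - 0) * (Z i k w - 0)); first by rewrite !subr0.
Qed.

Lemma noise_row i j : g_sigma_algebra_preimage (Z i j : T -> R) `<=` sigma_gen (Z i).
Proof. by move=> A ZA; apply: sub_gen_smallest; exists j. Qed.

Lemma noise_rows_indep i l j k : i != l ->
  \int[P]_w (Z i j w * Z l k w) = 0.
Proof.
move=> il; have [K _ ZK] := noise_moments.
have [Zij Zij0 _ _] := ZK i j; have [Zlk _ _ _] := ZK l k.
rewrite indep_RintegralM ?Zij0 ?mul0r//.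
- exact: (integrable4X Zij (a := 1)).
- exact: (integrable4X Zlk (a := 1)).
- case: A4 => _ _ Zind _; apply: indep2S (mutual_indep_pair Zind il); exact: noise_row.
Qed.

Lemma noise_mean_cvg j :
  {ae P, forall w, p%:R^-1 * (\sum_(i < p) Z i j w) @[p --> \oo] --> 0}.
Proof.
have [K _ ZK] := noise_moments.
apply: (@rajchman _ _ _ P (fun i => Z i j) (delta ^+ 2)) => //.
- move=> i l; have [Zi _ _ _] := ZK i j; have [Zl _ _ _] := ZK l j.
  exact: (integrable4M (a := 1) (b := 1) Zi Zl).
- by move=> i; have [_ _ -> _] := ZK i j.
- by move=> i l il; exact: noise_rows_indep.
Qed.

(** Within a row the mean of the product is given by pairwise uncorrelation; after centring,
    different rows are orthogonal by independence, and the fourth moments of the entries bound the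
    second moments of the products. *)
Lemma noise_gram_cvg j k :
  {ae P, forall w, p%:R^-1 * (\sum_(i < p) Z i j w * Z i k w) @[p --> \oo]
     --> (j == k)%:R * delta ^+ 2}.
Proof.
have [K _ ZK] := noise_moments; set c := _ * _.
pose Y i w := Z i j w * Z i k w - c.
have iZZ i : P.-integrable setT (EFin \o (fun w => Z i j w * Z i k w)).
  have [Zj _ _ _] := ZK i j; have [Zk _ _ _] := ZK i k.
  exact: (integrable4M (a := 1) (b := 1) Zj Zk).
have iZZ2 i : P.-integrable setT (fun w => ((Z i j w * Z i k w) ^+ 2)%:E).
  have [Zj _ _ _] := ZK i j; have [Zk _ _ _] := ZK i k.
  by under eq_fun do rewrite exprMn; exact: (integrable4M (a := 2) (b := 2) Zj Zk).
have mY i : measurable_fun setT (Y i).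
  by apply: measurable_funB => //; exact: measurable_funM.
have iY i : P.-integrable setT (EFin \o Y i).
  rewrite (_ : EFin \o _ = (fun w => (Z i j w * Z i k w)%:E - c%:E)%E)//.
  by apply: integrableB => //; [exact: iZZ|exact: integrable_cstP].
have Y0 i : \int[P]_w Y i w = 0.
  rewrite (RintegralB (f2 := fun=> c) measurableT (iZZ i) (integrable_cstP P c)).
  rewrite noise_covariance Rintegral_cst//.
  by rewrite (_ : fine (P setT) = 1) ?mulr1 ?subrr// probability_setT.
have YE i w : Y i w ^+ 2 = (Z i j w * Z i k w) ^+ 2 - (2 * c) * (Z i j w * Z i k w) +
  c ^+ 2.
  by rewrite /Y; ring.
have iY2a i : P.-integrable setT
  (EFin \o (fun w => (Z i j w * Z i k w) ^+ 2 - (2 * c) * (Z i j w * Z i k w))).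
  rewrite (_ : EFin \o _ = (fun w => ((Z i j w * Z i k w) ^+ 2)%:E - (2 * c)%:E *
    (Z i j w * Z i k w)%:E)%E)//.
  by apply: integrableB => //; apply: integrableZl => //; exact: iZZ.
have iY2 i : P.-integrable setT (fun w => (Y i w ^+ 2)%:E).
  under eq_fun do rewrite YE EFinD.
  by apply: integrableD => //; [exact: iY2a|exact: integrable_cstP].
have Y2K i : \int[P]_w (Y i w ^+ 2) <= 2 * K + c ^+ 2.
  have [Zj _ _ Zj4] := ZK i j; have [Zk _ _ Zk4] := ZK i k.
  have Zj4i : P.-integrable setT (EFin \o (fun w => Z i j w ^+ 4)) by case: Zj.
  have Zk4i : P.-integrable setT (EFin \o (fun w => Z i k w ^+ 4)) by case: Zk.
  rewrite (@eq_Rintegral _ _ _ P setT _ _ (fun w _ => YE i w)).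
  rewrite (RintegralD (f2 := fun=> c ^+ 2) measurableT (iY2a i) (integrable_cstP P _)).
  have i2c : P.-integrable setT (EFin \o (fun w => 2 * c * (Z i j w * Z i k w))).
    exact: (integrableZl measurableT (2 * c) (iZZ i)).
  rewrite (RintegralB measurableT (iZZ2 i) i2c) (RintegralZl _ measurableT (iZZ i))
    noise_covariance Rintegral_cst// -/c.
  rewrite (_ : fine (P setT) = 1) ?mulr1; last by rewrite probability_setT.
  have : \int[P]_w ((Z i j w * Z i k w) ^+ 2) <=
      \int[P]_w (Z i j w ^+ 4 + Z i k w ^+ 4).
    have i44 := integrableD measurableT Zj4i Zk4i.
    apply: (le_Rintegral measurableT (iZZ2 i) i44) => w _;
      have := sqr_ge0 (Z i j w ^+ 2 - Z i k w ^+ 2).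
    by rewrite sqrrB -!exprM exprMn; have := sqr_ge0 (Z i j w * Z i k w);
      rewrite exprMn; lra.
  rewrite RintegralD//; have := sqr_ge0 c; lra.
have Yorth i l : i != l -> \int[P]_w (Y i w * Y l w) = 0.
  move=> il; rewrite indep_RintegralM ?Y0 ?mul0r//.
  have sub m : g_sigma_algebra_preimage (Y m) `<=` sigma_gen (Z m : 'I_n -> T -> R).
    apply: preimage_measurable_fun; apply: measurable_funB => //.
    by apply: measurable_funM; apply: measurable_fun_preimage; exact: noise_row.
  case: A4 => _ _ Zind _; apply: indep2S (mutual_indep_pair Zind il); exact: sub.
have := @rajchman _ _ _ P Y (2 * K + c ^+ 2) mY
  (fun i l => integrable2M (mY i) (mY l) (iY2 i) (iY2 l)) Y2K Yorth.
apply: filterS => w Yw.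
(* The factor p^-1 * p is kept so that the identity holds for every p: it is 0 at p = 0 and 1
   afterwards. *)
have -> : (fun p => p%:R^-1 * \sum_(i < p) Z i j w * Z i k w) =
    (fun p => p%:R^-1 * (\sum_(i < p) Y i w) + c * (p%:R^-1 * p%:R)).
  apply/funext => p; rewrite /Y sumrB sumr_const card_ord -mulr_natr.
  by ring.
rewrite -[X in _ --> X]add0r; apply: cvgD => //.
rewrite -[X in _ --> X]mulr1; apply: cvgMr.
apply: (@cvg_trans _ (cst 1 @ \oo)); last exact: cvg_cst.
by apply: near_eq_cvg; exists 1%N => // p /= p0; rewrite mulVf// pnatr_eq0 -lt0n.
Qed.

Section Factor.
Variables (beta : nat -> {RV P >-> R}) (C : R).
Hypotheses (betaC : forall i, {ae P, forall w, `|beta i w| <= C})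
  (betaZ : indep2 P (sigma_gen (fun i => beta i : T -> R)) Zgen).

(** Orthogonality comes from the noise: the expectation of beta_i beta_l Z_ij Z_lj factors, and its
    noise factor vanishes when i <> l. *)
Lemma noise_factor_cvg j :
  {ae P, forall w, p%:R^-1 * (\sum_(i < p) beta i w * Z i j w) @[p --> \oo] --> 0}.
Proof.
have [K _ ZK] := noise_moments.
have ibb i l : P.-integrable setT (EFin \o (fun w => beta i w * beta l w)).
  apply: (ae_bounded_integrable (C := C ^+ 2)); first exact: measurable_funM.
  apply: filterS2 (betaC i) (betaC l) => w iC lC.
  by rewrite normrM expr2 ler_pM.
have b2C i : \int[P]_w (beta i w * beta i w) <= C ^+ 2.
  apply: ae_le_Rintegral_cst; rewrite ?sqr_ge0//; first exact: measurable_funM.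
    by move=> w; rewrite -expr2 sqr_ge0.
  apply: filterS (betaC i) => w iC.
  by rewrite -expr2 -(real_normK (num_real (beta i w))) ler_pXn2r// ?nnegrE//
    (le_trans _ iC).
have iZZ i l : P.-integrable setT (EFin \o (fun w => Z i j w * Z l j w)).
  have [Zi _ _ _] := ZK i j; have [Zl _ _ _] := ZK l j.
  exact: (integrable4M (a := 1) (b := 1) Zi Zl).
have ind i l : indep2 P (g_sigma_algebra_preimage (fun w => beta i w * beta l w))
    (g_sigma_algebra_preimage (fun w => Z i j w * Z l j w)).
  apply: indep2S betaZ.
    apply: preimage_measurable_fun; apply: measurable_funM.
      exact: (@measurable_fun_sigma_gen _ T _ _ R (fun i => beta i : T -> R) i).
    exact: (@measurable_fun_sigma_gen _ T _ _ R (fun i => beta i : T -> R) l).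
  by apply: preimage_measurable_fun; apply: measurable_funM;
    [exact: (@measurable_fun_sigma_gen _ T _ _ R (fun ij : nat * 'I_n => Z ij.1 ij.2 :
      T -> R) (i, j))
    |exact: (@measurable_fun_sigma_gen _ T _ _ R (fun ij : nat * 'I_n => Z ij.1 ij.2 :
      T -> R) (l, j))].
have YE i l w : (beta i w * Z i j w) * (beta l w * Z l j w) =
  (beta i w * beta l w) * (Z i j w * Z l j w) by ring.
apply: (@rajchman _ _ _ P (fun i w => beta i w * Z i j w) (C ^+ 2 * delta ^+ 2)).
- by move=> i; exact: measurable_funM.
- by move=> i l; under eq_fun do rewrite YE; exact: indep_integrableM.
- move=> i; under eq_Rintegral do rewrite expr2 YE.
  rewrite indep_RintegralM// noise_covariance eqxx mul1r.
  by rewrite ler_wpM2r ?sqr_ge0.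
- move=> i l il; under eq_Rintegral do rewrite YE.
  by rewrite indep_RintegralM// noise_rows_indep// mulr0.
Qed.

End Factor.
End Noise.
End ModelMoments.

(** * Fourth moments of the noise along random directions *)

Lemma sqr_sum_le (R : realFieldType) (I : Type) (s : seq I) (a : I -> R) :
  (\sum_(i <- s) a i) ^+ 2 <= (size s)%:R * \sum_(i <- s) a i ^+ 2.
Proof.
elim: s => [|i s IH]; first by rewrite !big_nil expr0n mul0r.
rewrite !big_cons /= -natr1.
set S := \sum_(j <- s) a j in IH *; set Q := \sum_(j <- s) _ in IH *.
have Q0 : 0 <= Q by apply: sumr_ge0 => j _; rewrite sqr_ge0.
case: s => [|j s] /= in S Q Q0 IH *.
  by rewrite /S /Q !big_nil; lra.
set n : R := _.+1%:R in IH *; have n0 : 0 < n by [].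
have h : 2 * (a i * S) <= n * a i ^+ 2 + Q.
  rewrite -(ler_pM2l n0).
  by have := sqr_ge0 (n * a i - S); rewrite sqrrB; nra.
by rewrite sqrrD; nra.
Qed.

Section RandomVectors.
Context {R : realType} {d : measure_display} {T : measurableType d}.
Variable P : probability T R.

Lemma measurable_coord p (i j : 'I_p) :
  measurable_fun setT (fun M : borel_mx R p => (M : 'M[R]_p) i j).
Proof.
apply: (measurability _ (RGenOInfty.measurableE R)).
move=> _ [_ [x ->] <-]; rewrite setTI; apply: sub_gen_smallest.
apply: (@open_comp _ _ (fun M : 'M[R]_p => M i j)).
  by move=> M _; exact: coord_continuous.
by rewrite set_itvE; exact: open_gt.
Qed.

(** Inversion is not continuous at 0, so measurability passes through the power function with
    exponent -1. *)
Lemma measurable_sqrtV : measurable_fun setT (fun x : R => (Num.sqrt x)^-1).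
Proof.
have -> : (fun x : R => (Num.sqrt x)^-1) = (fun x => (Num.sqrt x) `^ (-1)).
  by apply/funext => x; rewrite powR_inv1// sqrtr_ge0.
apply: (measurableT_comp (measurable_powR _)).
by apply: continuous_measurable_fun; exact: sqrt_continuous.
Qed.

(** Origin of the factor k_p^2: the square of a sum of k squares is at most k times the sum of the
    fourth powers, and this sum has expectation at most k B. *)
Lemma integral_sum_sqr_le (I : Type) (s : seq I) (F : I -> T -> R) (B : R) :
  (forall i, measurable_fun setT (F i)) ->
  (forall i, (\int[P]_w (F i w ^+ 4)%:E <= B%:E)%E) ->
  (\int[P]_w ((\sum_(i <- s) F i w ^+ 2) ^+ 2)%:E <= ((size s)%:R ^+ 2 * B)%:E)%E.
Proof.
move=> mF FB.
have mF4 i : measurable_fun setT (fun w => (F i w ^+ 4)%:E).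
  by apply/measurable_EFinP; exact: measurable_funX.
have F40 i w : (0 <= (F i w ^+ 4)%:E)%E by rewrite lee_fin exprn_even_ge0.
apply: (@le_trans _ _ (\int[P]_w ((size s)%:R%:E * \sum_(i <- s) (F i w ^+ 4)%:E))%E).
  apply: ge0_le_integral => //.
  - by move=> w _; rewrite lee_fin sqr_ge0.
  - apply/measurable_EFinP; apply: measurable_funX.
    by apply: measurable_sum => i; exact: measurable_funX.
  - by apply: measurable_funeM; exact: emeasurable_sum.
  - move=> w _; rewrite sumEFin -EFinM lee_fin.
    by under [in leRHS]eq_bigr do rewrite (exprM _ 2 2); exact: sqr_sum_le.
rewrite ge0_integralZl//; last 2 first.
- exact: emeasurable_sum.
- by move=> w _; apply: sume_ge0.
rewrite expr2 -mulrA [leRHS]EFinM; apply: lee_wpmul2l; first by rewrite lee_fin.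
rewrite ge0_integral_sum//.
apply: (@le_trans _ _ (\sum_(i <- s) B%:E)%E); first exact: lee_sum.
by rewrite sumEFin lee_fin big_const_seq count_predT iter_addr_0 mulr_natl.
Qed.

Section Noise.
Variables (n : nat) (Z : nat -> 'I_n -> {RV P >-> R}) (delta K : R).
Hypothesis A4 : assumption4 Z delta.
Hypotheses (dK : delta ^+ 4 <= K) (ZK : forall i j,
  [/\ integrable4 P (Z i j), \int[P]_w Z i j w = 0,
      \int[P]_w (Z i j w ^+ 2) = delta ^+ 2 & \int[P]_w (Z i j w ^+ 4) <= K]).

(** Once [xi] is frozen, the direction is a fixed vector of norm at most 1 and [moment4_lincomb]
    applies to the independent entries of a noise column. A general measurable [U] covers matrix
    columns and the residual direction of q at once. *)
Lemma noise_dot4 p (xi : {RV P >-> borel_mx R p}) (U : 'M[R]_p -> 'cV[R]_p) j :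
  indep2 P (g_sigma_algebra_preimage xi)
    (sigma_gen (fun ij : nat * 'I_n => Z ij.1 ij.2)) ->
  (forall i, measurable_fun setT (fun M : borel_mx R p => U M i 0)) ->
  (forall w, dot (U (xi w)) (U (xi w)) <= 1) ->
  (\int[P]_w (dot (U (xi w)) (col j (Z_mx Z p w)) ^+ 4)%:E <= (3 * K)%:E)%E.
Proof.
move=> xiZ mU U1.
have K0 : 0 <= K by apply: le_trans dK; rewrite exprn_even_ge0.
pose C := \bigcup_ij g_sigma_algebra_preimage (Z ij.1 ij.2 : T -> R).
have CT : C `<=` measurable by move=> A [ij _]; exact: preimage_sub_measurable.
pose V : T -> g_sigma_algebraType C := id.
have mV : measurable_fun setT V by exact: measurable_id_sub_sigma.
pose f (z : borel_mx R p * g_sigma_algebraType C) :=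
  ((\sum_(i < p) U z.1 i 0 * Z i j z.2) ^+ 4)%:E.
have mf : measurable_fun setT f.
  apply/measurable_EFinP; apply: measurable_funX; apply: measurable_sum => i.
  apply: measurable_funM; first by apply: (measurableT_comp (mU i)).
  apply: (@measurableT_comp _ _ _ _ (g_sigma_algebraType C) R (Z i j : T -> R)) => //.
  exact: (@measurable_fun_sigma_gen _ T _ _ R (fun ij : nat * 'I_n => Z ij.1 ij.2 : T ->
    R) (_, _)).
have f0 z : (0 <= f z)%E by rewrite lee_fin exprn_even_ge0.
have E w w' : dot (U (xi w)) (col j (Z_mx Z p w')) = \sum_(i < p) U (xi w) i 0 * Z i j w'.
  by apply: eq_bigr => i _; rewrite !mxE.
under eq_integral do rewrite E.
apply: (indep_integral_le (measurable_funPT xi) mV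
  (indep2S (@subset_refl _ _) (@preimage_id_sub_sigma _ _ C) xiZ) mf f0).
move=> w; rewrite /f /=.
(* Linear combinations were treated for coefficients indexed by nat, so the vector is extended by
   0. *)
pose u i := if insub i is Some o then U (xi w) o 0 else 0.
have uE (i : 'I_p) : u i = U (xi w) i 0 by rewrite /u valK.
have Zind : mutual_indep P (fun i => g_sigma_algebra_preimage (Z i j : T -> R)).
  by case: A4 => _ _ Zind _; apply: mutual_indepS Zind => i; exact: noise_row.
have [[_ i4] i4K] : integrable4 P (fun w' => \sum_(i < p) u i * Z i j w') /\
    \int[P]_w' ((\sum_(i < p) u i * Z i j w') ^+ 4) <= 3 * K * (\sum_(i < p) u i ^+ 2)
      ^+ 2.
  apply: (@moment4_lincomb _ _ _ P (fun i => Z i j) K (delta ^+ 2)) => //;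
    try by move=> i; case: (ZK i j).
    by move=> i; case: (ZK i j) => _ _ -> _.
  by rewrite -exprM.
rewrite (eq_integral (fun w' => ((\sum_(i < p) u i * Z i j w') ^+ 4)%:E)); last first.
  by move=> w' _; under [in RHS]eq_bigr do rewrite uE.
rewrite -(fineK (integrable_fin_num measurableT i4)) lee_fin.
apply: le_trans i4K _; rewrite -[leRHS]mulr1; apply: ler_wpM2l; first exact: mulr_ge0.
rewrite (_ : \sum_(i < p) _ = dot (U (xi w)) (U (xi w))); last first.
  by apply: eq_bigr => i _; rewrite uE expr2.
apply: exprn_ile1 => //; apply: sumr_ge0 => i _; by rewrite -expr2 sqr_ge0.
Qed.

End Noise.
End RandomVectors.

(** * Fourth moment of a Haar distributed direction *)

Lemma dot_mxE (R : realType) p (x y : 'cV[R]_p) : x^T *m y = (dot x y)%:M.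
Proof.
apply/matrixP => i j; rewrite !ord1 !mxE eqxx mulr1n.
by apply: eq_bigr => k _; rewrite !mxE.
Qed.

Lemma dot_mulmx_tr (R : realType) p n (A : 'M[R]_(p, n)) (x : 'cV[R]_n) (y : 'cV[R]_p) :
  dot (A *m x) y = dot x (A^T *m y).
Proof.
have : (dot (A *m x) y)%:M = (dot x (A^T *m y))%:M :> 'M[R]_1.
  by rewrite -!dot_mxE trmx_mul mulmxA.
by move=> /matrixP/(_ 0 0); rewrite !mxE.
Qed.

Section Householder.
Context {R : realType} {p : nat}.
Implicit Types (x y v : 'cV[R]_p) (g : 'M[R]_p).

Lemma dot_ge0 v : 0 <= dot v v.
Proof. by apply: sumr_ge0 => i _; rewrite -expr2 sqr_ge0. Qed.

Lemma normr_coord_le1 v i : dot v v <= 1 -> `|v i 0| <= 1.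
Proof.
move=> v1; rewrite -(expr_le1 (n := 2))// real_normK ?num_real//.
apply: le_trans v1; rewrite /dot (bigD1 i)//= -expr2 lerDl.
by apply: sumr_ge0 => j _; rewrite -expr2 sqr_ge0.
Qed.

(** The Householder reflection in the hyperplane orthogonal to x - y sends x to y; equality of the
    norms gives (x - y, x) = |x - y|^2 / 2. *)
Lemma orthogonal_transitive x y : dot x x = dot y y ->
  exists2 g : 'M[R]_p, orthogonal_group g & g^T *m x = y.
Proof.
move=> xy; have [->|nxy] := eqVneq x y.
  by exists 1%:M; rewrite /orthogonal_group /= ?trmx1 ?mul1mx// mulmx1.
pose v := x - y; pose c := 2 / dot v v.
have v0 : dot v v != 0.
  by apply: contra_neq nxy => /dot_eq0/eqP; rewrite subr_eq0 => /eqP.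
pose g := 1%:M - c *: (v *m v^T).
have gT : g^T = g by rewrite /g linearB linearZ /= trmx1 trmx_mul trmxK.
exists g; rewrite ?gT.
  pose A := v *m v^T.
  have AA : A *m A = dot v v *: A.
    by rewrite /A mulmxA -(mulmxA v) dot_mxE mul_mx_scalar -scalemxAl.
  have cc : c *: (c *: (dot v v *: A)) = c *: A + c *: A.
    by rewrite !scalerA -scalerDl; congr (_ *: _); rewrite /c; field.
  rewrite /orthogonal_group /= gT /g -/A mulmxBl mul1mx mulmxBr mulmx1.
  by rewrite -scalemxAl -scalemxAr AA cc opprB addrK subrK.
rewrite /g mulmxBl mul1mx -scalemxAl -mulmxA dot_mxE mul_mx_scalar scalerA.
have -> : c * dot v x = 1.
  have -> : dot v x = dot v v / 2.
    have -> : dot v v = dot v x - dot v y by rewrite dotC {1}/v dotBl !(dotC _ v).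
    by rewrite /v !dotBl -xy (dotC y x); lra.
  by rewrite /c; field.
by rewrite scale1r /v opprB addrC subrK.
Qed.

End Householder.

Section Haar.
Context {R : realType} {d : measure_display} {T : measurableType d}.
Variables (P : probability T R) (p : nat).
Variable xi : {RV P >-> borel_mx R p}.
Hypotheses (xiO : forall w, orthogonal_group (xi w : 'M[R]_p))
  (xi_haar : is_haar (distribution P xi)).
Variable l : 'I_p.

Let y w : 'cV[R]_p := col l (xi w).
Let F x : R := \int[P]_w (dot (y w) x ^+ 4).

Lemma orthogonal_col w : dot (col l (xi w)) (col l (xi w)) = 1.
Proof.
have /matrixP/(_ l l) := xiO w; rewrite !mxE eqxx /= mulr1n => <-.
by apply: eq_bigr => i _; rewrite !mxE.
Qed.

Let my i : measurable_fun setT (fun w => y w i 0).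
Proof.
under eq_fun do rewrite mxE.
apply: (measurableT_comp (measurable_coord i l)); exact: measurable_funPT.
Qed.

Let mdot x : measurable_fun setT (fun w => dot (y w) x).
Proof. by apply: measurable_sum => i; exact: measurable_funM. Qed.

Let dot_le w x : `|dot (y w) x| <= \sum_i `|x i 0|.
Proof.
apply: le_trans (ler_norm_sum _ _ _) _; apply: ler_sum => i _.
by rewrite normrM -[leRHS]mul1r ler_wpM2r// normr_coord_le1// orthogonal_col.
Qed.

Let iF x z a b : P.-integrable setT (fun w => (dot (y w) x ^+ a * dot (y w) z ^+ b)%:E).
Proof.
apply: (ae_bounded_integrable (C := (\sum_i `|x i 0|) ^+ a * (\sum_i `|z i 0|) ^+ b)).
  by apply: measurable_funM; exact: measurable_funX.
apply: aeW => w; rewrite normrM !normrX; apply: ler_pM; rewrite ?exprn_ge0//.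
  by apply: lerXn2r; rewrite ?nnegrE// sumr_ge0.
by apply: lerXn2r; rewrite ?nnegrE// sumr_ge0.
Qed.

Let iF1 x a : P.-integrable setT (fun w => (dot (y w) x ^+ a)%:E).
Proof. by have := iF x x a 0; under eq_fun do rewrite expr0 mulr1. Qed.

Let measurable_mulmx (g : 'M[R]_p) :
  measurable_fun setT (fun M : borel_mx R p => (g *m M : borel_mx R p)).
Proof.
apply: (@measurability _ _ (borel_mx R p) (borel_mx R p) setT _ (@open 'M[R]_p)) => // _
  [B oB <-]; rewrite setTI; apply: sub_gen_smallest.
apply: (@open_comp _ _ (fun M : 'M[R]_p => g *m M)) => // M _.
have FM : Filter (nbhs (M : 'M[R]_p)) := nbhs_filter M.
apply/cvg_ballP => e e0.
have H i j : \forall N \near M, ball ((g *m M) i j) e ((g *m N) i j).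
  have : (fun N : 'M[R]_p => (g *m N) i j) @ M --> (g *m M) i j.
    under [X in X @ _ --> _]funext do rewrite mxE.
    rewrite mxE; apply: (cvg_big (op := +%R)); first exact: add_continuous.
    by move=> k _; apply: cvgMr; exact: coord_continuous.
  by move=> /cvg_ballP; apply.
have := filter_forall FM (fun i => filter_forall FM (fun j => H i j)).
by apply: filterS => N NM; split.
Qed.

(** Pairing x with a column of g M is pairing g^T x with the same column of M, so left invariance of
    the law applies. *)
Let F_invariant (g : 'M[R]_p) x : orthogonal_group g -> F (g^T *m x) = F x.
Proof.
move=> gO; pose f (M : borel_mx R p) := (dot (col l M) x ^+ 4)%:E.
have mf : measurable_fun setT f.
  apply/measurable_EFinP; apply: measurable_funX; apply: measurable_sum => i.
  apply: measurable_funM => //; under eq_fun do rewrite mxE.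
  exact: measurable_coord.
have f0 M : (0 <= f M)%E by rewrite lee_fin exprn_even_ge0.
rewrite /F /Rintegral; congr fine.
transitivity (\int[distribution P xi]_M f (g *m M))%E.
  rewrite ge0_integral_distribution//;
    last exact: (measurableT_comp mf (measurable_mulmx g)).
  apply: eq_integral => w _ /=; congr (_ ^+ 4)%:E.
  by rewrite -dot_mulmx_tr /y !colE mulmxA.
transitivity (\int[distribution P xi]_M f M)%E; last first.
  by rewrite ge0_integral_distribution.
transitivity (\int[pushforward (distribution P xi)
  (fun M : borel_mx R p => (g *m M : borel_mx R p))]_M f M)%E.
  by rewrite (ge0_integral_pushforward (measurable_mulmx g)).
by apply: eq_measure_integral => A mA _; exact: (xi_haar.2 g A gO mA).
Qed.

Let FE x z : dot x x = dot z z -> F x = F z.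
Proof. by move=> /orthogonal_transitive[g gO <-]; rewrite F_invariant. Qed.

Let FZ c x : F (c *: x) = c ^+ 4 * F x.
Proof.
rewrite /F -RintegralZl//; last exact: iF1.
by apply: eq_Rintegral => w _; rewrite dotZr exprMn.
Qed.

Let e (i : 'I_p) : 'cV[R]_p := delta_mx i 0.

Let dot_e i x : dot x (e i) = x i 0.
Proof.
rewrite /dot (bigD1 i)//= mxE !eqxx mulr1 big1 ?addr0// => k ki.
by rewrite mxE (negPf ki) mulr0.
Qed.

(** By invariance the moment depends on |x| only; let m be its value at unit vectors. The vectors
    e_i + e_j and e_i - e_j have squared length 2, and (a + b)^4 + (a - b)^4 = 2 a^4 + 12 a^2 b^2 +
    2 b^4 then yields E(y_i^2 y_j^2) = m / 3 for i <> j. Since |y| = 1, all these moments and the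
    E(y_i^4) = m sum to 1, whence p^2 m / 3 <= 1. *)
Lemma haar_dot4 x :
  (\int[P]_w (dot (col l (xi w)) x ^+ 4)%:E <= (3 / p%:R ^+ 2 * dot x x ^+ 2)%:E)%E.
Proof.
rewrite -(fineK (integrable_fin_num measurableT (iF1 x 4))) lee_fin.
have p0 : 0 < p%:R :> R by rewrite ltr0n; apply: leq_ltn_trans (ltn_ord l).
pose m := F (e l).
have ee i j : dot (e i) (e j) = (i == j)%:R by rewrite dot_e mxE eqxx andbT eq_sym.
have me i : F (e i) = m by apply: FE; rewrite !ee !eqxx.
have Fx : F x = dot x x ^+ 2 * m.
  have -> : F x = F (enorm x *: e l).
    apply: FE; rewrite dotZl dotZr ee eqxx mulr1 -expr2 sqr_sqrtr//.
    exact: dot_ge0.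
  rewrite FZ (exprM _ 2 2) sqr_sqrtr//.
  by apply: sumr_ge0 => i _; rewrite -expr2 sqr_ge0.
rewrite -[leLHS]/(F x) Fx mulrC; apply: ler_wpM2r; first exact: sqr_ge0.
have m0 : 0 <= m by apply: Rintegral_ge0 => w _; rewrite exprn_even_ge0.
pose G i j := \int[P]_w (dot (y w) (e i) ^+ 2 * dot (y w) (e j) ^+ 2).
have Gij i j : i != j -> G i j = m / 3.
  move=> ij.
  have D : dot (e i + e j) (e i + e j) = 2.
    by rewrite dotDl !dotDr !ee !eqxx (eq_sym j i) (negPf ij) /=; lra.
  have D' : dot (e i - e j) (e i - e j) = 2.
    by rewrite -scaleN1r dotDl !dotDr !dotZl !dotZr !ee !eqxx (eq_sym j i) (negPf ij)
      /=; lra.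
  have s2 : dot (Num.sqrt 2 *: e l) (Num.sqrt 2 *: e l) = 2.
    by rewrite dotZl dotZr ee eqxx mulr1 -expr2 sqr_sqrtr.
  have s4 : F (Num.sqrt 2 *: e l) = 4 * m.
    by rewrite FZ (exprM _ 2 2) sqr_sqrtr// -/m; ring.
  have E1 : F (e i + e j) = 4 * m by rewrite -s4; apply: FE; rewrite D s2.
  have E2 : F (e i - e j) = 4 * m by rewrite -s4; apply: FE; rewrite D' s2.
  have : F (e i + e j) + F (e i - e j) = 2 * F (e i) + 12 * G i j + 2 * F (e j).
    have iA k : P.-integrable setT (EFin \o (fun w => 2 * dot (y w) (e k) ^+ 4)).
      exact: (integrableZl measurableT 2 (iF1 (e k) 4)).
    have iB : P.-integrable setT
        (EFin \o (fun w => 12 * (dot (y w) (e i) ^+ 2 * dot (y w) (e j) ^+ 2))).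
      exact: (integrableZl measurableT 12 (iF (e i) (e j) 2 2)).
    have iAB := integrableD measurableT (iA i) iB.
    rewrite /F /G -(RintegralD measurableT (iF1 (e i + e j) 4) (iF1 (e i - e j) 4)).
    rewrite -(RintegralZl 2 measurableT (iF1 (e i) 4))
      -(RintegralZl 2 measurableT (iF1 (e j) 4)).
    rewrite -(RintegralZl 12 measurableT (iF (e i) (e j) 2 2)).
    rewrite -(RintegralD measurableT (iA i) iB) -(RintegralD measurableT iAB (iA j)).
    apply: eq_Rintegral => w _.
    by rewrite -scaleN1r !dotDr dotZr; ring.
  by rewrite E1 E2 !me; lra.
have Gii i : G i i = m.
  by rewrite -(me i); apply: eq_Rintegral => w _; rewrite -exprD.
have GS : \sum_i \sum_j G i j = 1.
  have [_] := @Rintegral_sumZ _ _ _ P _ (index_enum _) (fun=> 1)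
    (fun (z : 'I_p * 'I_p) w => dot (y w) (e z.1) ^+ 2 * dot (y w) (e z.2) ^+ 2)
    (fun z => iF (e z.1) (e z.2) 2 2).
  under [X in _ = X -> _]eq_bigr do rewrite mul1r.
  rewrite -(pair_big xpredT xpredT (fun i j => G i j))/= => <-.
  transitivity (\int[P]_w cst 1 w); last first.
    rewrite Rintegral_cst// (_ : fine (P setT) = 1) ?mulr1// probability_setT//.
  apply: eq_Rintegral => w _; under eq_bigr do rewrite mul1r.
  rewrite -(pair_big xpredT xpredT (fun i j => dot (y w) (e i) ^+ 2 * dot (y w) (e j) ^+
    2))/=.
  rewrite -big_distrlr /= (_ : \sum_i _ = 1) ?mulr1//.
  by rewrite -(orthogonal_col w); apply: eq_bigr => i _; rewrite dot_e expr2.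
have : \sum_(i < p) \sum_(j < p) m / 3 <= 1.
  rewrite -[leRHS]GS; apply: ler_sum => i _; apply: ler_sum => j _.
  by have [->|ij] := eqVneq i j; [rewrite Gii; lra|rewrite Gij].
rewrite !sumr_const !card_ord -(mulr_natl (m / 3)) -(mulr_natl (_ * (m / 3))) mulrA
  -expr2 => h.
rewrite ler_pdivlMr ?exprn_gt0//. lra.
Qed.

End Haar.

(** * Energy of projections onto random subspaces *)

Section Energy.
Context {R : realType} {p : nat}.
Implicit Types (x v : 'cV[R]_p) (M : 'M[R]_p).

Definition first_cols k : seq 'I_p := [seq l : 'I_p <- enum 'I_p | (l < k)%N].

(** A formula explicit in the matrix, so that measurability is visible, whereas [orthoproj] is
    defined by a choice; the two agree on orthogonal matrices. *)
Definition cols_proj k M x : 'cV[R]_p :=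
  \sum_(l <- first_cols k) dot (col l M) x *: col l M.

(** The Gram-Schmidt vector that q adds to orthonormal first columns. If q already lies in their
    span, the residual is 0 and so is its normalisation. *)
Definition residual_dir k M : 'cV[R]_p :=
  normalize (qvec p - cols_proj k M (qvec p)).

(** For orthogonal M, the squared length of the projection of x onto [span_cols k M]. *)
Definition energy k M x : R := \sum_(l <- first_cols k) dot (col l M) x ^+ 2.

Lemma size_first_cols k : (size (first_cols k) <= k)%N.
Proof.
rewrite -(size_map val) -[leqRHS](size_iota 0); apply: uniq_leq_size.
  by rewrite map_inj_uniq; [rewrite filter_uniq// enum_uniq|exact: val_inj].
by move=> _ /mapP[l + ->]; rewrite mem_filter mem_iota add0n => /andP[-> _].
Qed.

Lemma enorm_sqr v : enorm v ^+ 2 = dot v v.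
Proof. by rewrite sqr_sqrtr// dot_ge0. Qed.

Lemma dot_normalize v : dot (normalize v) (normalize v) = (v != 0)%:R.
Proof.
rewrite /normalize dotZl dotZr mulrA -expr2 exprVn enorm_sqr.
have [->|v0] := eqVneq v 0; first by rewrite dot0r mulr0.
by rewrite mulVf//; apply: contra_neq v0 => /dot_eq0.
Qed.

(** Covers the zero vector, whose normalisation is 0, so bounds on [b] and on the residual direction
    are available at every p. *)
Lemma dot_normalize_le1 v : dot (normalize v) (normalize v) <= 1.
Proof. by rewrite dot_normalize; case: eqVneq. Qed.

End Energy.

Section EnergyAlmostSure.
Context {R : realType} {d : measure_display} {T : measurableType d}.
Variable P : probability T R.

Lemma measurable_dot d' (T' : measurableType d') p (u v : T' -> 'cV[R]_p) :
  (forall i, measurable_fun setT (fun w => u w i 0)) ->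
  (forall i, measurable_fun setT (fun w => v w i 0)) ->
  measurable_fun setT (fun w => dot (u w) (v w)).
Proof. by move=> mu mv; apply: measurable_sum => i; exact: measurable_funM. Qed.

Lemma measurable_normalize d' (T' : measurableType d') p (u : T' -> 'cV[R]_p) i :
  (forall i, measurable_fun setT (fun w => u w i 0)) ->
  measurable_fun setT (fun w => normalize (u w) i 0).
Proof.
move=> mu; under eq_fun do rewrite mxE; apply: measurable_funM => //.
by apply: (measurableT_comp (@measurable_sqrtV R)); exact: measurable_dot.
Qed.

Lemma measurable_col p (l i : 'I_p) :
  measurable_fun setT (fun M : borel_mx R p => col l (M : 'M[R]_p) i 0).
Proof. by under eq_fun do rewrite mxE; exact: measurable_coord. Qed.

Lemma measurable_residual_dir p k (i : 'I_p) :
  measurable_fun setT (fun M : borel_mx R p => residual_dir k M i 0).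
Proof.
apply: measurable_normalize => {}i.
under eq_fun do rewrite !mxE summxE.
apply: measurable_funB => //; apply: measurable_sum => l.
under eq_fun do rewrite mxE; apply: measurable_funM; last exact: measurable_col.
by apply: measurable_dot => // j; exact: measurable_col.
Qed.

Lemma sqrt_dominated_bound (k : nat -> nat) : sqrt_dominated R k ->
  exists2 S : R, 0 <= S & forall N, \sum_(m < N) ((k m.+2)%:R ^+ 2 / m.+2%:R ^+ 2) <= S.
Proof.
move=> [_ _]; set S := (\sum_(2 <= p <oo) _)%E => Sfin.
have t0 m : (0 <= ((k m)%:R ^+ 2 / m%:R ^+ 2 : R)%:E)%E.
  by rewrite lee_fin divr_ge0 ?exprn_ge0.
have S0 : (0 <= S)%E by apply: nneseries_ge0 => m _ _.
have SE : S \is a fin_num by rewrite ge0_fin_numE.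
exists (fine S); first exact: fine_ge0.
move=> N; rewrite -lee_fin fineK// -sumEFin.
apply: (@le_trans _ _ (\sum_(2 <= m < N.+2) ((k m)%:R ^+ 2 / m%:R ^+ 2 : R)%:E)%E).
  by rewrite !big_add1 big_mkord.
by apply: nneseries_lim_ge => m _ _.
Qed.

Section Noise.
Variables (n : nat) (Z : nat -> 'I_n -> {RV P >-> R}) (delta : R).
Hypothesis A4 : assumption4 Z delta.
Variables (k : nat -> nat) (xi : forall p, {RV P >-> borel_mx R p}).
Hypotheses (k_dom : sqrt_dominated R k)
  (xiO : forall p, (2 <= p)%N -> forall w, orthogonal_group (xi p w : 'M[R]_p))
  (xiZ : forall p, (2 <= p)%N ->
    indep2 P (g_sigma_algebra_preimage (xi p))
      (sigma_gen (fun ij : nat * 'I_n => Z ij.1 ij.2))).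

(** The squared total over k_p + 1 directions has expectation at most 3K(k_p + 1)^2, summable after
    division by p^2. Carrying the residual term along settles L and span{L, q} together. *)
Lemma energy_noise_ae j : {ae P, forall w,
  p%:R^-1 * (energy (k p) (xi p w) (col j (Z_mx Z p w)) +
    dot (residual_dir (k p) (xi p w)) (col j (Z_mx Z p w)) ^+ 2) @[p --> \oo] --> 0}.
Proof.
have [K dK ZK] := noise_moments A4.
have K0 : 0 <= K by apply: le_trans dK; rewrite exprn_even_ge0.
have [S S0 kS] := sqrt_dominated_bound k_dom.
(* [None] indexes the residual direction of q, and [Some l] the column l. *)
pose U p (o : option 'I_p) (M : 'M[R]_p) :=
  if o is Some l then col l M else residual_dir (k p) M.
pose s p : seq (option 'I_p) := None :: map some (first_cols (k p)).
pose F p o w := dot (U p o (xi p w)) (col j (Z_mx Z p w)).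
pose W m w := ((\sum_(o <- s m.+2) F m.+2 o w ^+ 2) ^+ 2) / m.+2%:R ^+ 2.
have mF p o : measurable_fun setT (F p o).
  apply: measurable_dot => i; last first.
    by under eq_fun do rewrite !mxE; exact: measurable_funPT.
  apply: (measurableT_comp (f := fun M : borel_mx R p => U p o M i 0)) => //.
  by case: o => [l|] /=; [exact: measurable_col|exact: measurable_residual_dir].
have mW m : measurable_fun setT (fun w => (\sum_(o <- s m.+2) F m.+2 o w ^+ 2) ^+ 2).
  by apply: measurable_funX; apply: measurable_sum => o; exact: measurable_funX.
have : {ae P, forall w, W m w @[m --> \oo] --> 0}.
  apply: (@ae_cvg0_summable _ _ _ P W
    (fun m => 12 * K * ((k m.+2)%:R ^+ 2 / m.+2%:R ^+ 2)) (12 * K * S)).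
  - by move=> m; apply: measurable_funM; [exact: mW|exact: measurable_cst].
  - by move=> m w; rewrite /W divr_ge0 ?sqr_ge0.
  - move=> m.
    have m0 : 0 <= (m.+2%:R ^+ 2)^-1 :> R by rewrite invr_ge0 exprn_ge0.
    rewrite (eq_integral (fun w => (m.+2%:R ^+ 2)^-1%:E *
        ((\sum_(o <- s m.+2) F m.+2 o w ^+ 2) ^+ 2)%:E)%E); last first.
      by move=> w _; rewrite -EFinM mulrC.
    rewrite ge0_integralZl//; last 2 first.
    + exact/measurable_EFinP.
    + by move=> w _; rewrite lee_fin sqr_ge0.
    have -> : 12 * K * ((k m.+2)%:R ^+ 2 / m.+2%:R ^+ 2) =
        (m.+2%:R ^+ 2)^-1 * (12 * K * (k m.+2)%:R ^+ 2) by rewrite mulrA mulrC.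
    rewrite EFinM; apply: lee_wpmul2l; first by rewrite lee_fin.
    apply: le_trans (@integral_sum_sqr_le _ _ _ P _ (s m.+2) (F m.+2) (3 * K) (mF _) _) _.
      move=> o; apply: (@noise_dot4 _ _ _ P n Z delta K A4 dK ZK m.+2 (xi m.+2)
        (U m.+2 o) j (@xiZ m.+2 isT)).
        by case: o => [l|] i /=; [exact: measurable_col|exact: measurable_residual_dir].
      move=> w; case: o => [l|] /=; last exact: dot_normalize_le1.
      by rewrite orthogonal_col//; exact: xiO.
    rewrite lee_fin /= size_map.
    have [k0 _ _] := k_dom; have {k0} k1 := k0 m.+2 isT.
    (* Here k + 1 <= 2k because k >= 1, which is where 12 = 4 * 3 comes from. *)
    apply: (@le_trans _ _ ((2 * (k m.+2)%:R) ^+ 2 * (3 * K))).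
      apply: ler_wpM2r; first exact: mulr_ge0.
      apply: lerXn2r; rewrite ?nnegrE ?mulr_ge0// -natrM ler_nat mul2n -addnn.
      by rewrite -add1n leq_add// size_first_cols.
    by rewrite exprMn; lra.
  - move=> N; rewrite -mulr_sumr ler_wpM2l// mulr_ge0//.
apply: filterS => w Ww.
have : (\sum_(o <- s m.+2) F m.+2 o w ^+ 2) / m.+2%:R @[m --> \oo] --> 0.
  by apply: sqr_cvg0; under eq_fun do rewrite exprMn exprVn.
move=> H; rewrite -(cvg_shiftn 2); apply: cvg_trans H; apply: near_eq_cvg.
by apply: nearW => m; rewrite /= addn2 mulrC big_cons big_map addrC.
Qed.

End Noise.

Section Factor.
Variables (C : set (set T)) (k : nat -> nat) (xi : forall p, {RV P >-> borel_mx R p}).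
Hypotheses (CT : C `<=` measurable) (k_dom : sqrt_dominated R k)
  (xiO : forall p, (2 <= p)%N -> forall w, orthogonal_group (xi p w : 'M[R]_p))
  (xi_haar : forall p, (2 <= p)%N -> is_haar (distribution P (xi p)))
  (xiC : forall p, (2 <= p)%N -> indep2 P (g_sigma_algebra_preimage (xi p)) <<s C >>).

(** Compared with the noise bound the roles are reversed: the vector is frozen and the Haar matrix
    integrated, so each column contributes a fourth moment at most 3 / p^2 and the squared energy
    has expectation at most 3 k_p^2 / p^2. The sigma-algebra generated by [C] is the one that
    carries the vector. *)
Lemma energy_haar_ae (b : forall p, T -> 'cV[R]_p) :
  (forall p i, @measurable_fun _ _ (g_sigma_algebraType C) R setT (fun w => b p w i 0)) ->
  (forall p w, dot (b p w) (b p w) <= 1) ->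
  {ae P, forall w, energy (k p) (xi p w) (b p w) @[p --> \oo] --> 0}.
Proof.
move=> mb b1.
have mb' p i : measurable_fun setT (fun w => b p w i 0).
  exact: (measurable_fun_sub_sigma CT (mb p i)).
have [S S0 kS] := sqrt_dominated_bound k_dom.
pose F p (l : 'I_p) w := dot (col l (xi p w)) (b p w).
have mF p l : measurable_fun setT (@F p l).
  apply: measurable_dot => // i.
  by apply: (measurableT_comp (f := fun M : borel_mx R p => col l M i 0)) => //;
    exact: measurable_col.
pose V : T -> g_sigma_algebraType C := id.
have mV : measurable_fun setT V by exact: measurable_id_sub_sigma.
have F4 p (l : 'I_p) : (2 <= p)%N ->
    (\int[P]_w (@F p l w ^+ 4)%:E <= (3 / p%:R ^+ 2)%:E)%E.
  move=> p2.
  pose f (z : g_sigma_algebraType C * borel_mx R p) :=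
    (dot (col l z.2) (b p z.1) ^+ 4)%:E.
  have mf : measurable_fun setT f.
    apply/measurable_EFinP; apply: measurable_funX; apply: measurable_dot => i.
      by apply: (measurableT_comp (measurable_col l i)).
    exact: (measurableT_comp (mb p i)).
  have f0 z : (0 <= f z)%E by rewrite lee_fin exprn_even_ge0.
  apply: (indep_integral_le mV (measurable_funPT (xi p))
    (indep2S (@preimage_id_sub_sigma _ _ C) (@subset_refl _ _) (indep2C (xiC p2))) mf
      f0) => w.
  have := haar_dot4 (xiO p2) (xi_haar p2) l (b p w).
  move/le_trans; apply; rewrite lee_fin -[leRHS]mulr1; apply: ler_wpM2l.
    by rewrite divr_ge0 ?exprn_ge0.
  by apply: exprn_ile1 => //; exact: dot_ge0.
pose W m w := energy (k m.+2) (xi m.+2 w) (b m.+2 w) ^+ 2.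
have mW m : measurable_fun setT (W m).
  by apply: measurable_funX; apply: measurable_sum => l; apply: measurable_funX;
    exact: mF.
have : {ae P, forall w, W m w @[m --> \oo] --> 0}.
  apply: (@ae_cvg0_summable _ _ _ P W
    (fun m => 3 * ((k m.+2)%:R ^+ 2 / m.+2%:R ^+ 2)) (3 * S)) => //.
  - by move=> m w; rewrite sqr_ge0.
  - move=> m.
    apply: le_trans (@integral_sum_sqr_le _ _ _ P _ (first_cols (k m.+2)) (@F m.+2) _
      (mF _) (fun l => F4 _ l isT)) _.
    rewrite lee_fin mulrCA; apply: ler_wpM2l => //; apply: ler_wpM2r.
      by rewrite invr_ge0 exprn_ge0.
    by apply: lerXn2r; rewrite ?nnegrE// ler_nat size_first_cols.
  - by move=> N; rewrite -mulr_sumr ler_wpM2l.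
apply: filterS => w Ww.
by rewrite -(cvg_shiftn 2); under eq_fun do rewrite addn2; exact: sqr_cvg0.
Qed.

End Factor.
End EnergyAlmostSure.

(** * Orthogonal projections and the Rayleigh quotient *)

Section Projections.
Context {R : realType} {p : nat}.
Implicit Types (x y v q : 'cV[R]_p) (L : {vspace 'cV[R]_p}) (M : 'M[R]_p).

Lemma dot_sumr (I : Type) (s : seq I) (F : I -> 'cV[R]_p) x :
  dot x (\sum_(i <- s) F i) = \sum_(i <- s) dot x (F i).
Proof.
elim: s => [|i s IH]; first by rewrite !big_nil dot0r.
by rewrite !big_cons dotDr IH.
Qed.

Lemma dotNr x y : dot x (- y) = - dot x y.
Proof. by rewrite -scaleN1r dotZr mulN1r. Qed.

Lemma dotBr x y z : dot x (y - z) = dot x y - dot x z.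
Proof. by rewrite dotDr dotNr. Qed.

Lemma dot_span0 (X : seq 'cV[R]_p) v y :
  (forall x, x \in X -> dot v x = 0) -> y \in <<X>>%VS -> dot v y = 0.
Proof.
move=> vX; rewrite -[X in <<X>>%VS]in_tupleE => /coord_span ->.
rewrite dot_sumr big1// => i _; rewrite dotZr vX ?mulr0//.
by rewrite /= mem_nth.
Qed.

Lemma dot_cauchy_schwarz x y : dot x y ^+ 2 <= dot x x * dot y y.
Proof.
have [y0|y0] := eqVneq (dot y y) 0.
  by rewrite (dot_eq0 y0) !dot0r expr0n mulr0.
have yp : 0 < dot y y by rewrite lt0r y0 dot_ge0.
have := dot_ge0 (dot y y *: x - dot x y *: y).
rewrite !dotBl !dotBr !dotZl !dotZr (dotC y x) => h.
by rewrite -(ler_pM2l yp); nra.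
Qed.

Lemma normr_dot_le x y : `|dot x y| <= enorm x * enorm y.
Proof.
rewrite -sqrtrM ?dot_ge0// -sqrtr_sqr; apply: ler_wsqrtr.
exact: dot_cauchy_schwarz.
Qed.

Lemma enorm_ge0 x : 0 <= enorm x. Proof. exact: sqrtr_ge0. Qed.

Lemma enormZ a x : enorm (a *: x) = `|a| * enorm x.
Proof. by rewrite /enorm dotZl dotZr mulrA -expr2 sqrtrM ?sqr_ge0// sqrtr_sqr. Qed.

Lemma enormD x y : enorm (x + y) <= enorm x + enorm y.
Proof.
rewrite -(ler_pXn2r (n := 2)) ?nnegrE ?addr_ge0 ?enorm_ge0//.
rewrite sqrrD !enorm_sqr dotDl !dotDr (dotC y x).
have := normr_dot_le x y; have := ler_norm (dot x y); lra.
Qed.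

Lemma enorm0 : enorm (0 : 'cV[R]_p) = 0. Proof. by rewrite /enorm dot0r sqrtr0. Qed.

Lemma enorm_sum (I : Type) (s : seq I) (F : I -> 'cV[R]_p) :
  enorm (\sum_(i <- s) F i) <= \sum_(i <- s) enorm (F i).
Proof.
elim: s => [|i s IH]; first by rewrite !big_nil enorm0.
by rewrite !big_cons (le_trans (enormD _ _))// lerD2l.
Qed.

Lemma orthoproj_mem L v : orthoproj L v \in L. Proof. by case: (orthoprojP L v). Qed.

Lemma orthoprojD L x y : orthoproj L (x + y) = orthoproj L x + orthoproj L y.
Proof.
apply: orthoproj_unique => [|z zL]; first by rewrite rpredD ?orthoproj_mem.
rewrite opprD addrACA dotDl; have [_ ->//] := orthoprojP L x.
by have [_ ->//] := orthoprojP L y; rewrite addr0.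
Qed.

Lemma orthoprojZ L a x : orthoproj L (a *: x) = a *: orthoproj L x.
Proof.
apply: orthoproj_unique => [|z zL]; first by rewrite rpredZ ?orthoproj_mem.
by rewrite -scalerBr dotZl; have [_ ->//] := orthoprojP L x; rewrite mulr0.
Qed.

Lemma orthoproj_sum L (I : Type) (s : seq I) (F : I -> 'cV[R]_p) :
  orthoproj L (\sum_(i <- s) F i) = \sum_(i <- s) orthoproj L (F i).
Proof.
elim: s => [|i s IH]; last by rewrite !big_cons orthoprojD IH.
by rewrite !big_nil -(scale0r 0) orthoprojZ !scale0r.
Qed.

Lemma dot_orthoproj L x y : y \in L -> dot (orthoproj L x) y = dot x y.
Proof.
move=> yL; have [_ /(_ y yL)] := orthoprojP L x.
by rewrite dotBl => /eqP; rewrite subr_eq0 => /eqP.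
Qed.

Lemma dot_orthoproj_id L x : dot (orthoproj L x) (orthoproj L x) = dot x (orthoproj L x).
Proof. by rewrite dot_orthoproj// orthoproj_mem. Qed.

Lemma dot_orthoprojC L x y : dot (orthoproj L x) y = dot (orthoproj L x) (orthoproj L y).
Proof. by rewrite dotC -(dot_orthoproj (L := L))// 1?dotC// orthoproj_mem. Qed.

Lemma dot_orthoproj_le L x : dot (orthoproj L x) (orthoproj L x) <= dot x x.
Proof.
have := dot_ge0 (x - orthoproj L x).
by rewrite dotBl !dotBr (dotC _ x) -dot_orthoproj_id; lra.
Qed.

Lemma enorm_orthoproj_le L x : enorm (orthoproj L x) <= enorm x.
Proof. exact/ler_wsqrtr/dot_orthoproj_le. Qed.

(** Taken at y = q, this is the lower bound on |proj b|^2 over span{L, q} behind part (a). *)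
Lemma dot_sqr_le_orthoproj L x y : y \in L -> dot y y = 1 ->
  dot x y ^+ 2 <= dot (orthoproj L x) (orthoproj L x).
Proof.
move=> yL y1; rewrite -(dot_orthoproj x yL).
by apply: le_trans (dot_cauchy_schwarz _ _) _; rewrite y1 mulr1.
Qed.

Lemma orthoproj_line q x : dot q q = 1 -> orthoproj <[q]> x = dot x q *: q.
Proof.
move=> q1; apply: orthoproj_unique => [|y /vlineP[c ->]].
  by rewrite rpredZ// memv_line.
by rewrite dotZr dotBl dotZl q1 mulr1 subrr mulr0.
Qed.

(** One Gram-Schmidt step. If q lies in L, then u = 0 and the sum of the two spaces is L, so the
    formula persists. *)
Lemma orthoproj_addv_line L q x :
  let u := normalize (q - orthoproj L q) in
  orthoproj (L + <[q]>) x = orthoproj L x + dot u x *: u.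
Proof.
pose r := q - orthoproj L q; move=> u.
have uE : u = normalize r by [].
clearbody u.
have rL y : y \in L -> dot u y = 0.
  by move=> yL; rewrite uE dotZl; have [_ ->//] := orthoprojP L q; rewrite mulr0.
have uL' : u \in (L + <[q]>)%VS.
  rewrite uE; apply/rpredZ/rpredB; first by apply: (subvP (addvSr L <[q]>));
    exact: memv_line.
  by apply: (subvP (addvSl L <[q]>)); exact: orthoproj_mem.
apply: orthoproj_unique => [|_ /memv_addP[y yL [_ /vlineP[c ->] ->]]].
  apply: rpredD; last exact: rpredZ.
  by apply: (subvP (addvSl L <[q]>)); exact: orthoproj_mem.
have L0 z : z \in L -> dot (x - (orthoproj L x + dot u x *: u)) z = 0.
  move=> zL; rewrite opprD addrA dotBl dotZl (rL z)// mulr0 subr0.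
  by have [_ ->] := orthoprojP L x.
rewrite dotDr L0// add0r dotZr; move: L0; set W := x - _ => L0.
have -> : dot W q = dot W r by rewrite dotBr (L0 (orthoproj L q)) ?subr0 ?orthoproj_mem.
apply/eqP; rewrite mulf_eq0; apply/orP; right; apply/eqP; rewrite /W {W L0}.
have [r0|r0] := eqVneq r 0; first by rewrite r0 dot0r.
have nr0 : enorm r != 0.
  by rewrite sqrtr_eq0 -ltNge lt0r dot_ge0 andbT; apply: contra_neq r0 => /dot_eq0.
have rE : r = enorm r *: u by rewrite uE /normalize scalerA mulfV// scale1r.
have u1 : dot u u = 1 by rewrite uE dot_normalize r0.
rewrite rE dotZr opprD addrA !dotBl dotZl u1 mulr1 (dotC (orthoproj L x))
  (rL (orthoproj L x)) ?orthoproj_mem//.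
by rewrite subr0 dotC subrr mulr0.
Qed.

Lemma orthoproj_span_cols k M x : orthogonal_group M ->
  orthoproj (span_cols k M) x = cols_proj k M x.
Proof.
move=> MO; have colM i j : dot (col i M) (col j M) = (i == j)%:R.
  have /matrixP/(_ i j) := MO; rewrite !mxE => <-.
  by apply: eq_bigr => l _; rewrite !mxE.
have mem l : l \in first_cols k -> col l M \in span_cols k M.
  by move=> lk; apply: memv_span; apply: map_f.
apply: orthoproj_unique => [|y].
  by rewrite /cols_proj big_seq; apply: rpred_sum => l /mem lM; exact: rpredZ.
apply: dot_span0 => _ /mapP[l lk ->].
rewrite dotBl /cols_proj (dotC (\sum_(_ <- _) _)) dot_sumr (bigD1_seq l)//=; last first.
  by rewrite filter_uniq// enum_uniq.
rewrite dotZr colM eqxx mulr1 big1 ?addr0 ?(dotC x) ?subrr// => j jl.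
by rewrite dotZr colM eq_sym (negPf jl) mulr0.
Qed.

Lemma dot_orthoproj_span_cols k M x : orthogonal_group M ->
  dot (orthoproj (span_cols k M) x) (orthoproj (span_cols k M) x) = energy k M x.
Proof.
move=> MO; rewrite dot_orthoproj_id orthoproj_span_cols// dot_sumr.
by apply: eq_bigr => l _; rewrite dotZr (dotC x) expr2.
Qed.

Lemma dot_orthoproj_addv_line L q x (u := normalize (q - orthoproj L q)) :
  dot (orthoproj (L + <[q]>) x) (orthoproj (L + <[q]>) x) =
  dot (orthoproj L x) (orthoproj L x) + dot u x ^+ 2.
Proof.
by rewrite dot_orthoproj_id orthoproj_addv_line dotDr dotZr -dot_orthoproj_id (dotC x)
  expr2.
Qed.

Lemma dot_qvec : (0 < p)%N -> dot (qvec p) (qvec p) = 1 :> R.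
Proof.
move=> p0; rewrite /dot (eq_bigr (fun=> p%:R^-1)); last first.
  by move=> i _; rewrite !mxE -expr2 exprVn sqr_sqrtr.
by rewrite sumr_const card_ord -(mulr_natl p%:R^-1) mulfV// pnatr_eq0 -lt0n.
Qed.

Lemma dot_qvecr x : dot x (qvec p) = Num.sqrt p%:R * mean x.
Proof.
have [p0|p0] := eqVneq (p%:R : R) 0.
  rewrite p0 sqrtr0 mul0r /dot big1// => i _.
  by rewrite !mxE p0 sqrtr0 invr0 mulr0.
have s0 : Num.sqrt p%:R != 0 :> R by rewrite sqrtr_eq0 -ltNge lt0r p0 /=.
have sp : Num.sqrt p%:R * p%:R^-1 = (Num.sqrt p%:R)^-1 :> R.
  by apply: (mulfI s0); rewrite mulrA -expr2 sqr_sqrtr// !mulfV.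
rewrite /dot /mean mulrA sp mulr_sumr.
by apply: eq_bigr => i _; rewrite mxE mulrC.
Qed.

End Projections.

Section Rayleigh.
Context {R : realType} {m : nat}.
Implicit Types (x y v : 'cV[R]_m) (A S : 'M[R]_m).

Lemma dot_mulmx_le A : exists2 C : R, 0 <= C & forall x,
  dot (A *m x) (A *m x) <= C * dot x x.
Proof.
exists (\sum_i dot (row i A)^T (row i A)^T); first by apply: sumr_ge0 => i _;
  exact: dot_ge0.
move=> x; rewrite mulr_suml; apply: ler_sum => i _.
rewrite -expr2 (_ : (A *m x) i 0 = dot (row i A)^T x); first exact: dot_cauchy_schwarz.
by rewrite mxE; apply: eq_bigr => j _; rewrite !mxE.
Qed.

Lemma psd_cauchy_schwarz A x y : A^T = A -> (forall v, 0 <= dot v (A *m v)) ->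
  dot x (A *m y) ^+ 2 <= dot x (A *m x) * dot y (A *m y).
Proof.
move=> AT A0; have Axy : dot y (A *m x) = dot x (A *m y).
  by rewrite -{1}AT -dot_mulmx_tr dotC.
have form s t : dot (s *: x + t *: y) (A *m (s *: x + t *: y)) =
    s ^+ 2 * dot x (A *m x) + 2 * (s * t) * dot x (A *m y) + t ^+ 2 * dot y (A *m y).
  by rewrite mulmxDr -!scalemxAr dotDl !dotDr !dotZl !dotZr Axy; ring.
set a := dot x _ in form *; set b := dot x _ in form *; set c := dot y _ in form *.
have a0 : 0 <= a by exact: A0.
have c0 : 0 <= c by exact: A0.
have [cz|cz] := eqVneq c 0.
  (* With c = 0 the form is affine in t, so b must vanish: otherwise t = -(a + 1) / (2b) gives the
     value -1. *)
  have h t : 0 <= a + 2 * t * b by have := A0 (1 *: x + t *: y); rewrite form cz; lra.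
  have [->|b0] := eqVneq b 0; first by rewrite expr0n mulr_ge0.
  have := h (- (a + 1) / (2 * b)).
  by rewrite (_ : 2 * _ * b = - (a + 1)); [move=> ?; lra|field].
have := A0 (c *: x + (- b) *: y); rewrite form.
have cp : 0 < c by rewrite lt0r cz.
by move=> h; rewrite -(ler_pM2l cp); lra.
Qed.

(* A positive semidefinite matrix which is not singular is coercive; hence the
   supremum of the Rayleigh quotient, where coercivity fails, is an eigenvalue. *)
Lemma rayleigh_le_max_eigenvalue S v : S^T = S ->
  dot v (S *m v) <= max_eigenvalue S * dot v v.
Proof.
move=> ST; have [->|v0] := eqVneq v 0; first by rewrite mulmx0 !dot0r mulr0.
have vv : 0 < dot v v.
  by rewrite lt0r dot_ge0 andbT; apply: contra_neq v0 => /dot_eq0.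
pose Q := [set a : R | exists2 x, dot x x = 1 & a = dot x (S *m x)].
have [C C0 SC] := dot_mulmx_le S.
have QC : has_ubound Q.
  exists (1 + C) => _ [x x1 ->].
  have := dot_cauchy_schwarz x (S *m x); rewrite x1 mul1r.
  by have := SC x; rewrite x1; have := sqr_ge0 (dot x (S *m x) - 1); rewrite sqrrB; nra.
pose w := normalize v.
have w1 : dot w w = 1 by rewrite dot_normalize v0.
have Q0 : Q !=set0 by exists (dot w (S *m w)), w.
have supQ : has_sup Q by split.
pose l := sup Q; pose A := l%:M - S.
have AE x : dot x (A *m x) = l * dot x x - dot x (S *m x).
  by rewrite mulmxBl mul_scalar_mx dotBr dotZr.
have Sl x : dot x (S *m x) <= l * dot x x.
  have [->|x0] := eqVneq x 0; first by rewrite mulmx0 !dot0r mulr0.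
  have xx : 0 < dot x x.
    by rewrite lt0r dot_ge0 andbT; apply: contra_neq x0 => /dot_eq0.
  have : dot (normalize x) (S *m normalize x) <= l.
    by apply: sup_upper_bound => //; exists (normalize x); rewrite // dot_normalize x0.
  rewrite -scalemxAr dotZl dotZr mulrA -expr2 exprVn enorm_sqr.
  by rewrite mulrC ler_pdivrMr.
have A0 x : 0 <= dot x (A *m x) by rewrite AE subr_ge0.
have AT : A^T = A by rewrite linearB /= ST tr_scalar_mx.
have lS : eigenvalue S l.
  case: (boolP (eigenvalue S l)) => // nl; exfalso.
  (* The eigenspace is by definition the kernel of S - l, so the matrix is invertible when l is not
     an eigenvalue. *)
  have Bunit : S - l%:M \in unitmx.
    rewrite -row_free_unit -kermx_eq0; apply: contraNT nl => h; exact: h.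
  have [D D0 BD] := dot_mulmx_le (invmx (S - l%:M)).
  have [E E0 AE2] := dot_mulmx_le A.
  (* Coercivity: |x|^2 <= D |Ax|^2 by invertibility, and Cauchy-Schwarz for the form of A at Ax and
     x gives |Ax|^4 <= (1 + E) |Ax|^2 (x, Ax). *)
  have co x : dot x x <= (D * (1 + E)) * dot x (A *m x).
    set s := dot (A *m x) (A *m x).
    have h1 : dot x x <= D * s.
      have := BD ((S - l%:M) *m x); rewrite mulmxA mulVmx// mul1mx.
      by rewrite -opprB mulNmx -scaleN1r dotZl dotZr mulN1r mulN1r opprK.
    apply: le_trans h1 _; rewrite -mulrA; apply: ler_wpM2l => //.
    have s0 : 0 <= s by exact: dot_ge0.
    have h2 : dot (A *m x) (A *m (A *m x)) <= (1 + E) * s.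
      have := AE2 (A *m x); have := dot_ge0 (A *m x - A *m (A *m x)).
      by rewrite dotBl !dotBr (dotC (A *m (A *m x)) (A *m x)) -/s; nra.
    have h3 := psd_cauchy_schwarz (A *m x) x AT A0; rewrite -/s in h3.
    have [->|sn] := eqVneq s 0; first by rewrite mulr_ge0 ?A0// addr_ge0.
    have sp : 0 < s by rewrite lt0r sn.
    have q0 := A0 x.
    rewrite -(ler_pM2l sp) -expr2; apply: le_trans h3 _.
    by rewrite mulrA (mulrC s); apply: ler_wpM2r.
  set K := D * (1 + E) in co; have K0 : 0 <= K by rewrite mulr_ge0// addr_ge0.
  have K1 : 0 < K + 1 by lra.
  have eps : 0 < (K + 1)^-1 by rewrite invr_gt0.
  (* A near-maximiser x of the Rayleigh quotient has (x, Ax) < 1 / (K + 1), against 1 <= K (x,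
     Ax). *)
  have [_ [x x1 ->]] := sup_adherent eps supQ; rewrite -/l => xl.
  have := co x; rewrite AE x1 mulr1; apply/negP; rewrite -ltNge.
  apply: (@le_lt_trans _ _ (K * (K + 1)^-1)); first by apply: ler_wpM2l => //; lra.
  by rewrite ltr_pdivrMr//; lra.
apply: le_trans (Sl v) _; apply: ler_wpM2r; first exact: ltW.
apply: sup_upper_bound => //; split; first by exists l.
(* The supremum defining [max_eigenvalue] must be over a bounded set: l bounds every eigenvalue.
   Eigenvectors are rows here, and symmetry of S allows transposing them. *)
exists l => a /eigenvalueP[u uS u0].
have u0' : u^T != 0 by apply: contra_neq u0 => u0; rewrite -(trmxK u) u0 trmx0.
have uu : 0 < dot u^T u^T.
  by rewrite lt0r dot_ge0 andbT; apply: contra_neq u0' => /dot_eq0.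
rewrite -(ler_pM2r uu); apply: le_trans (Sl u^T).
by rewrite -[X in X *m _]ST -trmx_mul uS linearZ /= dotZr.
Qed.

End Rayleigh.

(** * Asymptotics of the MAPS error *)

Section Asymptotic.
Context {R : realType}.
Implicit Types x y u v : nat -> R.

Lemma cvg_eqfun x y (l : R) : x =1 y -> x p @[p --> \oo] --> l -> y p @[p --> \oo] --> l.
Proof. by move=> /funext ->. Qed.

(** Convergence towards a moving target, since |proj b|^2 on span{L, q} need not have a limit. *)
Definition asym x y : Prop := x p - y p @[p --> \oo] --> 0.

Definition seq_bounded x : Prop := exists M, forall p, `|x p| <= M.

Lemma asym_le x y u (K : R) : u p @[p --> \oo] --> 0 ->
  (\forall p \near \oo, `|x p - y p| <= K * `|u p|) -> asym x y.
Proof.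
move=> u0 xy; apply/cvgr0Pnorm_lt => e e0.
have K1 : 0 < `|K| + 1 by rewrite ltr_wpDl.
have /cvgr0Pnorm_lt/(_ _ (divr_gt0 e0 K1)) := u0.
apply: filterS2 xy => p /le_lt_trans xy; rewrite ltr_pdivlMr// => up; apply: xy.
apply: le_lt_trans up; rewrite mulrC; apply: ler_wpM2l => //.
by have := ler_norm K; lra.
Qed.

Lemma asym_refl x : asym x x.
Proof. by rewrite /asym; under eq_fun do rewrite subrr; exact: cvg_cst. Qed.

Lemma asym_near x x' y : (\forall p \near \oo, x p = x' p) -> asym x y -> asym x' y.
Proof.
move=> xx'; apply: cvg_trans; apply: near_eq_cvg.
by apply: filterS xx' => p ->.
Qed.

Lemma asym_cst x (l : R) : x p @[p --> \oo] --> l <-> asym x (fun=> l).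
Proof. by split => ?; apply/subr_cvg0. Qed.

Lemma asym_cvg x y (l : R) : asym x y -> y p @[p --> \oo] --> l -> x p @[p --> \oo] --> l.
Proof.
move=> xy yl; rewrite -[l]add0r (_ : x = fun p => x p - y p + y p); last first.
  by apply/funext => p; rewrite subrK.
exact: cvgD.
Qed.

Lemma asymD x x' y y' : asym x y -> asym x' y' ->
  asym (fun p => x p + x' p) (fun p => y p + y' p).
Proof.
move=> xy xy'; rewrite /asym -[X in _ --> X](addr0 0).
under eq_fun do rewrite opprD addrACA.
exact: cvgD.
Qed.

Lemma asymN x y : asym x y -> asym (fun p => - x p) (fun p => - y p).
Proof.
move=> xy; rewrite /asym -[X in _ --> X]oppr0; under eq_fun do rewrite -opprD.
exact: cvgN.
Qed.

Lemma asymB x x' y y' : asym x y -> asym x' y' ->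
  asym (fun p => x p - x' p) (fun p => y p - y' p).
Proof. by move=> xy /asymN xy'; exact: asymD. Qed.

Lemma cvg0_bounded u v : u p @[p --> \oo] --> 0 -> seq_bounded v ->
  u p * v p @[p --> \oo] --> 0.
Proof.
move=> u0 [M vM]; have : asym (fun p => u p * v p) (fun=> 0).
  apply: (asym_le (K := M) u0); apply: nearW => p; rewrite subr0 normrM mulrC.
  by apply: ler_wpM2r => //; exact: vM.
by move=> h; apply/asym_cst.
Qed.

Lemma asymM x x' y y' : seq_bounded y -> seq_bounded y' -> asym x y -> asym x' y' ->
  asym (fun p => x p * x' p) (fun p => y p * y' p).
Proof.
move=> by_ by' xy xy'; rewrite /asym.
have -> : (fun p => x p * x' p - y p * y' p) = (fun p =>
    (x p - y p) * (x' p - y' p) + ((x p - y p) * y' p + (x' p - y' p) * y p)).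
  by apply/funext => p; ring.
rewrite -[X in _ --> X](addr0 0); apply: cvgD.
  by rewrite -[X in _ --> X](mulr0 0); exact: cvgM.
by rewrite -[X in _ --> X](addr0 0); apply: cvgD; exact: cvg0_bounded.
Qed.

(** Eventually x >= c / 2, so |1/x - 1/y| = |x - y| / (x y) <= (2 / c^2) |x - y|. *)
Lemma asym_invr x y (c : R) : 0 < c -> (forall p, c <= y p) -> asym x y ->
  asym (fun p => (x p)^-1) (fun p => (y p)^-1).
Proof.
move=> c0 yc xy; apply: (asym_le (K := 2 / c ^+ 2) xy).
have c20 : 0 < c / 2 by rewrite divr_gt0.
have /cvgr0Pnorm_lt/(_ _ c20) := xy; apply: filterS => p xyp.
have yp := yc p; have xp : c / 2 <= x p.
  by move: xyp; rewrite ltr_norml => /andP[]; lra.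
have x0 : 0 < x p by lra.
have y0 : 0 < y p by lra.
have -> : (x p)^-1 - (y p)^-1 = - ((x p - y p) / (x p * y p)) by field; lra.
rewrite normrN normrM mulrC; apply: ler_wpM2r => //.
have xyc : c ^+ 2 / 2 <= x p * y p.
  by rewrite expr2 mulrAC; apply: ler_pM => //; lra.
have cc : 0 < c ^+ 2 / 2 by rewrite divr_gt0// exprn_gt0.
rewrite normfV gtr0_norm ?mulr_gt0//.
have -> : 2 / c ^+ 2 = (c ^+ 2 / 2)^-1 by field; lra.
by rewrite lef_pV2// posrE mulr_gt0.
Qed.

(** A uniform modulus of continuity. A negative a, which an approximating sequence may take, has
    square root 0. *)
Lemma sqrt_dist_le (a b : R) : 0 <= b -> `|Num.sqrt a - Num.sqrt b| <= Num.sqrt `|a - b|.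
Proof.
move=> b0; have [a0|a0] := ltP a 0.
  rewrite ltr0_sqrtr// sub0r normrN ger0_norm ?sqrtr_ge0//.
  by apply: ler_wsqrtr; rewrite ler0_norm; lra.
rewrite -sqrtr_sqr; apply: ler_wsqrtr.
have -> : a - b = (Num.sqrt a - Num.sqrt b) * (Num.sqrt a + Num.sqrt b).
  by rewrite -subr_sqr !sqr_sqrtr.
rewrite normrM -(real_normK (num_real (_ - _))) expr2; apply: ler_wpM2l => //.
have sa := sqrtr_ge0 a; have sb := sqrtr_ge0 b.
by rewrite [leRHS]ger0_norm ?addr_ge0// ler_norml; apply/andP; split; lra.
Qed.

Lemma asym_sqrt x y : (forall p, 0 <= y p) -> asym x y ->
  asym (fun p => Num.sqrt (x p)) (fun p => Num.sqrt (y p)).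
Proof.
move=> y0 xy; apply: (asym_le (K := 1) (u := fun p => Num.sqrt `|x p - y p|)).
  have : `|x p - y p| @[p --> \oo] --> (0 : R).
    by rewrite -[X in _ --> X](normr0 R); exact: cvg_norm.
  move=> xy'; rewrite -[X in _ --> X](@sqrtr0 R).
  by apply: (cvg_comp _ _ xy'); exact: sqrt_continuous.
apply: nearW => p; rewrite mul1r [leRHS]ger0_norm ?sqrtr_ge0//.
exact: sqrt_dist_le.
Qed.

Lemma seq_bounded_itv x (a b : R) : (forall p, a <= x p <= b) -> seq_bounded x.
Proof.
move=> xab; exists (`|a| + `|b|) => p; have /andP[] := xab p.
have := ler_norm b; have := ler_norm (- a); rewrite normrN => ? ? ? ?.
by rewrite ler_norml; apply/andP; split; have := normr_ge0 a; have := normr_ge0 b; lra.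
Qed.

Lemma seq_bounded_cst (c : R) : seq_bounded (fun=> c).
Proof. by exists `|c|. Qed.

Lemma seq_boundedD x y : seq_bounded x -> seq_bounded y ->
  seq_bounded (fun p => x p + y p).
Proof.
by move=> [M xM] [N yN]; exists (M + N) => p; rewrite (le_trans (ler_normD _ _))// lerD.
Qed.

Lemma seq_boundedM x y : seq_bounded x -> seq_bounded y ->
  seq_bounded (fun p => x p * y p).
Proof. by move=> [M xM] [N yN]; exists (M * N) => p; rewrite normrM ler_pM. Qed.

End Asymptotic.

(** * The MAPS error as a function of the squared length of the projection of b *)

Section MapsError.
Context {R : realType}.
Variable s : R.
Hypothesis s01 : 0 < s < 1.

Let a := s ^+ 2.

Let a01 : 0 < a < 1.
Proof.
by rewrite /a exprn_gt0 ?expr_lt1//; case/andP: s01 => // /ltW.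
Qed.

(* The limiting squared cosine of the angle between the MAPS estimator and b,
   when the PCA estimator has squared cosine s^2 and |proj_L b|^2 = t. *)
Definition maps_cos2 (t : R) := (a + t * (1 - 2 * a)) / (1 - a * t).

(** Distance between two unit vectors with this cosine. *)
Definition maps_dist (t : R) := Num.sqrt (2 - 2 * Num.sqrt (maps_cos2 t)).

Let num_gt0 t : 0 <= t <= 1 -> Num.min a (1 - a) <= a + t * (1 - 2 * a).
Proof.
move=> /andP[t0 t1]; have /andP[a0 a1] := a01.
have -> : a + t * (1 - 2 * a) = a * (1 - t) + t * (1 - a) by ring.
by rewrite ge_min; case: (leP a (1 - a)) => h; apply/orP; [left|right]; nra.
Qed.

Let den_gt0 t : 0 <= t <= 1 -> 1 - a <= 1 - a * t.
Proof. by move=> /andP[t0 t1]; have /andP[a0 a1] := a01; nra. Qed.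

Let min_gt0 : 0 < Num.min a (1 - a).
Proof. by have /andP[a0 a1] := a01; rewrite lt_min a0 subr_gt0. Qed.

(** After cross multiplication the difference is (u - t)(1 - a)^2. *)
Lemma maps_cos2_mono t u : 0 <= t <= 1 -> 0 <= u <= 1 -> t <= u ->
  maps_cos2 t <= maps_cos2 u.
Proof.
move=> t01 u01 tu; have /andP[a0 a1] := a01.
have dt := den_gt0 t01; have du := den_gt0 u01.
rewrite /maps_cos2 ler_pdivrMr ?(lt_le_trans _ dt) ?subr_gt0// mulrAC.
rewrite ler_pdivlMr ?(lt_le_trans _ du) ?subr_gt0//.
rewrite -subr_ge0.
have -> : (a + u * (1 - 2 * a)) * (1 - a * t) - (a + t * (1 - 2 * a)) * (1 - a * u) =
  (u - t) * (1 - a) ^+ 2 by ring.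
by rewrite mulr_ge0 ?sqr_ge0// subr_ge0.
Qed.

Lemma maps_cos2_ge0 t : 0 <= t <= 1 -> 0 <= maps_cos2 t.
Proof.
move=> t01; have := num_gt0 t01; have := den_gt0 t01; have := min_gt0.
by have /andP[a0 a1] := a01; move=> h1 h2 h3; rewrite divr_ge0//; lra.
Qed.

Lemma maps_cos2_le1 t : 0 <= t <= 1 -> maps_cos2 t <= 1.
Proof.
move=> t01; have /andP[a0 a1] := a01; have /andP[t0 t1] := t01.
apply: le_trans (maps_cos2_mono t01 (_ : 0 <= 1 <= 1) t1) _; first by rewrite ler01 lexx.
by rewrite /maps_cos2 ler_pdivrMr; lra.
Qed.

Lemma maps_dist_anti t u : 0 <= t <= 1 -> 0 <= u <= 1 -> t <= u ->
  maps_dist u <= maps_dist t.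
Proof.
move=> t01 u01 tu; apply: ler_wsqrtr.
by have := ler_wsqrtr (maps_cos2_mono t01 u01 tu); lra.
Qed.

Lemma maps_dist0 : maps_dist 0 = Num.sqrt (2 - 2 * s).
Proof.
rewrite /maps_dist /maps_cos2 mul0r addr0 mulr0 subr0 divr1 sqrtr_sqr ger0_norm//.
by case/andP: s01 => /ltW.
Qed.

Lemma asym_maps_dist (x y : nat -> R) : (forall p, 0 <= y p <= 1) -> asym x y ->
  asym (fun p => maps_dist (x p)) (fun p => maps_dist (y p)).
Proof.
move=> y01 xy; have /andP[a0 a1] := a01.
have yb : seq_bounded y by exact: seq_bounded_itv y01.
have cb c := @seq_bounded_cst R c; have cr (c : R) := @asym_refl R (fun=> c).
have num : asym (fun p => a + x p * (1 - 2 * a)) (fun p => a + y p * (1 - 2 * a)).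
  by apply: asymD => //; exact: asymM.
have den : asym (fun p => (1 - a * x p)^-1) (fun p => (1 - a * y p)^-1).
  apply: (@asym_invr _ _ _ (1 - a)); first by rewrite subr_gt0.
    by move=> p; exact: den_gt0.
  by apply: asymB => //; exact: asymM.
have f : asym (fun p => maps_cos2 (x p)) (fun p => maps_cos2 (y p)).
  apply: asymM => //; first by apply: seq_boundedD => //; exact: seq_boundedM.
  apply: (@seq_bounded_itv _ _ 0 (1 - a)^-1) => p.
  have dp := den_gt0 (y01 p).
  by rewrite invr_ge0 lef_pV2 ?posrE; lra.
apply: asym_sqrt => [p|].
  rewrite subr_ge0 -[leRHS]mulr1 ler_wpM2l// -[leRHS]sqrtr1.
  by apply: ler_wsqrtr; exact: maps_cos2_le1.
apply: asymB => //; apply: asymM => //.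
  apply: (@seq_bounded_itv _ _ 0 1) => p; rewrite sqrtr_ge0 -[leRHS]sqrtr1.
  by apply: ler_wsqrtr; exact: maps_cos2_le1.
by apply: asym_sqrt => // p; exact: maps_cos2_ge0.
Qed.

Section Limit.
Variables (n : nat) (Y : forall p, 'M[R]_(p, n)) (h b : forall p, 'cV[R]_p)
  (V : forall p, {vspace 'cV[R]_p}).
Hypotheses (psiY : psi (Y p) @[p --> \oo] --> s)
  (h1 : \forall p \near \oo, enorm (h p) = 1)
  (b1 : \forall p \near \oo, enorm (b p) = 1)
  (b_le1 : forall p, dot (b p) (b p) <= 1)
  (hb : dot (h p) (b p) @[p --> \oo] --> s)
  (Vhb : enorm (orthoproj (V p) (h p) - s *: orthoproj (V p) (b p)) @[p --> \oo] --> 0).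

Let t p := dot (orthoproj (V p) (b p)) (orthoproj (V p) (b p)).

(** Put v = tau h + proj h. Then |proj h|^2 ~ a t, (proj h, b) ~ s t and tau ~ a(1 - t) / (1 - a),
    so (v, b) ~ s(a + t(1 - 2a)) / (1 - a) and |v|^2 ~ a(a + t(1 - 2a))(1 - a t) / (1 - a)^2. The
    quotient of (v, b) by |v| is then asymptotic to the square root of [maps_cos2 t]. *)
Lemma maps_err_asym :
  asym (fun p => enorm (maps (Y p) (h p) (V p) - b p)) (fun p => maps_dist (t p)).
Proof.
have /andP[a0 a1] := a01; have /andP[s0 s1] := s01.
have a1' : 1 - a != 0 by rewrite subr_eq0 gt_eqF.
have t01 p : 0 <= t p <= 1.
  by rewrite dot_ge0 (le_trans (dot_orthoproj_le _ _)).
have tb : seq_bounded t by exact: seq_bounded_itv t01.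
have cb c := @seq_bounded_cst R c; have cr (c : R) := @asym_refl R (fun=> c).
pose rho p := enorm (orthoproj (V p) (h p)) ^+ 2.
pose m p := dot (orthoproj (V p) (h p)) (b p).
pose g p := dot (h p) (b p).
pose ta p := (psi (Y p) ^+ 2 - rho p) / (1 - psi (Y p) ^+ 2).
have psi2 : asym (fun p => psi (Y p) ^+ 2) (fun=> a).
  have psis := proj1 (asym_cst _ _) psiY; exact: (asymM (cb s) (cb s) psis psis).
have mt : asym m (fun p => s * t p).
  apply: (asym_le (K := 1) Vhb); apply: nearW => p.
  have -> : m p - s * t p = dot (orthoproj (V p) (h p) - s *: orthoproj (V p) (b p))
    (b p).
    by rewrite dotBl dotZl (dot_orthoprojC _ (b p)).
  apply: le_trans (normr_dot_le _ _) _; rewrite mul1r [leRHS]ger0_norm ?enorm_ge0//.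
  rewrite -[leRHS]mulr1; apply: ler_wpM2l; first exact: enorm_ge0.
  by rewrite -sqrtr1; exact: ler_wsqrtr.
have rt : asym rho (fun p => a * t p).
  apply: (asym_le (K := 1 + s) Vhb); apply: filterS h1 => p hp.
  set u := orthoproj (V p) (h p); set v := orthoproj (V p) (b p).
  have -> : rho p - a * t p = dot (u - s *: v) (u + s *: v).
    by rewrite /rho enorm_sqr dotBl !dotDr !dotZl !dotZr (dotC v u) -/u -/v /t -/v /a;
      ring.
  apply: le_trans (normr_dot_le _ _) _; rewrite [in leRHS]ger0_norm ?enorm_ge0// mulrC.
  apply: ler_wpM2r; first exact: enorm_ge0.
  apply: le_trans (enormD _ _) _; rewrite enormZ gtr0_norm//; apply: lerD.
    by rewrite -hp; exact: enorm_orthoproj_le.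
  rewrite -[leRHS]mulr1; apply: ler_wpM2l; first exact: ltW.
  apply: le_trans (enorm_orthoproj_le _ _) _.
  by rewrite -sqrtr1; exact: ler_wsqrtr.
have atb : seq_bounded (fun p => a * t p) by exact: seq_boundedM.
pose ta' p := (a - a * t p) / (1 - a).
have tat : asym ta ta'.
  apply: asymM => //.
  - apply: seq_boundedD => //; apply: (@seq_bounded_itv _ _ (- a) 0) => p.
    by have /andP[t0 t1] := t01 p; apply/andP; split; nra.
  - exact: asymB.
  - apply: (@asym_invr _ _ _ (1 - a)); rewrite ?subr_gt0//.
    exact: asymB.
have ta'01 p : 0 <= ta' p <= a / (1 - a).
  have /andP[t0 t1] := t01 p.
  by rewrite divr_ge0 ?ler_pM2r ?invr_gt0 ?subr_gt0//; nra.
have ta'b : seq_bounded ta' by exact: seq_bounded_itv ta'01.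
have stb : seq_bounded (fun p => s * t p) by exact: seq_boundedM.
pose N p := ta p * g p + m p; pose D p := ta p ^+ 2 + 2 * ta p * rho p + rho p.
have NE : asym N (fun p => ta' p * s + s * t p).
  apply: asymD => //; exact: (asymM ta'b (cb s) tat (proj1 (asym_cst _ _) hb)).
pose D' p := ta' p ^+ 2 + 2 * ta' p * (a * t p) + a * t p.
have DE : asym D D'.
  apply: asymD => //; apply: asymD; first exact: (asymM ta'b ta'b tat tat).
  apply: asymM => //; first exact: (seq_boundedM (cb 2) ta'b).
  exact: (asymM (cb 2) ta'b (cr 2) tat).
have D'E p : D' p = a * (a + t p * (1 - 2 * a)) * (1 - a * t p) / (1 - a) ^+ 2.
  by rewrite /D' /ta'; field.
(* A lower bound for D', uniform in t, obtained factor by factor; dividing by (1 - a)^2 <= 1 only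
   increases D'. It keeps the division by |v| under control. *)
pose c := a * Num.min a (1 - a) * (1 - a).
have c0 : 0 < c by rewrite !mulr_gt0// subr_gt0.
have D'c p : c <= D' p.
  have n0 := num_gt0 (t01 p); have d0 := den_gt0 (t01 p).
  rewrite D'E ler_pdivlMr ?exprn_gt0 ?subr_gt0//.
  have m0 := min_gt0.
  apply: (@le_trans _ _ c).
    rewrite -[leRHS]mulr1; apply: ler_wpM2l; first exact: ltW.
    by rewrite exprn_ile1//; lra.
  rewrite /c; apply: ler_pM => //; [rewrite mulr_ge0//; exact: ltW|lra|].
  by apply: ler_wpM2l => //; exact: ltW.
have sD : asym (fun p => (Num.sqrt (D p))^-1) (fun p => (Num.sqrt (D' p))^-1).
  apply: (@asym_invr _ _ _ (Num.sqrt c)); first by rewrite sqrtr_gt0.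
    by move=> p; exact: ler_wsqrtr.
  apply: asym_sqrt => // p; exact: le_trans (ltW c0) (D'c p).
have cos : asym (fun p => N p / Num.sqrt (D p)) (fun p => Num.sqrt (maps_cos2 (t p))).
  have -> : (fun p => Num.sqrt (maps_cos2 (t p))) =
      (fun p => (ta' p * s + s * t p) * (Num.sqrt (D' p))^-1).
    apply/funext => p.
    have n0 := num_gt0 (t01 p); have d0 := den_gt0 (t01 p); have m0 := min_gt0.
    have D0 : 0 < D' p by exact: lt_le_trans (D'c p).
    have -> : ta' p * s + s * t p = s * (a + t p * (1 - 2 * a)) / (1 - a).
      by rewrite /ta'; field.
    set N' := s * _ / _.
    have N0 : 0 <= N' by rewrite divr_ge0 ?mulr_ge0//; lra.
    rewrite -sqrtrV ?(ltW D0)// -{1}(ger0_norm N0) -sqrtr_sqr -sqrtrM ?sqr_ge0//.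
    congr Num.sqrt; rewrite D'E /maps_cos2 /N' /a; field.
    rewrite -/a; repeat (apply/andP; split) => //; rewrite ?gt_eqF//; lra.
  apply: asymM => //; first by apply: seq_boundedD => //; exact: seq_boundedM.
  apply: (@seq_bounded_itv _ _ 0 (Num.sqrt c)^-1) => p.
  rewrite invr_ge0 sqrtr_ge0 /= lef_pV2 ?posrE ?sqrtr_gt0//; first exact: ler_wsqrtr.
  exact: lt_le_trans (D'c p).
have err : asym (fun p => Num.sqrt (2 - 2 * (N p / Num.sqrt (D p))))
  (fun p => maps_dist (t p)).
  apply: asym_sqrt => [p|].
    rewrite subr_ge0 -[leRHS]mulr1 ler_wpM2l// -[leRHS]sqrtr1.
    by apply: ler_wsqrtr; exact: maps_cos2_le1.
  apply: asymB => //; apply: asymM => //.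
  apply: (@seq_bounded_itv _ _ 0 1) => p; rewrite sqrtr_ge0 -[leRHS]sqrtr1.
  by apply: ler_wsqrtr; exact: maps_cos2_le1.
apply: asym_near err.
have Dpos : \forall p \near \oo, 0 < D p.
  have /cvgr0Pnorm_lt/(_ _ c0) := DE; apply: filterS => p.
  by have := D'c p; rewrite ltr_norml => ? /andP[]; lra.
(* When the projection of h vanishes, [maps] returns h. The formula N / sqrt(D) still gives (h, b)
   if tau > 0, which holds eventually as psi^2 tends to a, strictly between 0 and 1. *)
have tapos : \forall p \near \oo, rho p = 0 -> 0 < ta p.
  have e0 : 0 < Num.min a (1 - a) by exact: min_gt0.
  have /cvgr0Pnorm_lt/(_ _ e0) := psi2; apply: filterS => p.
  rewrite lt_min ltr_norml [in X in _ && X]ltr_norml => /andP[/andP[h1' _] /andP[_ h2']].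
  by move=> r0; rewrite /ta r0 subr0 divr_gt0//; lra.
apply: filterS2 (filterI h1 b1) (filterI Dpos tapos) => p [hp bp] [Dp tp].
have hh : dot (h p) (h p) = 1 by rewrite -enorm_sqr hp expr1n.
have bb : dot (b p) (b p) = 1 by rewrite -enorm_sqr bp expr1n.
have dist u : dot u u = 1 -> enorm (u - b p) = Num.sqrt (2 - 2 * dot u (b p)).
  move=> uu; rewrite /enorm; congr Num.sqrt.
  by rewrite dotBl !dotBr uu bb (dotC (b p) u); ring.
rewrite /maps; have [V0|V0] := eqVneq (orthoproj (V p) (h p)) 0.
  have r0 : rho p = 0 by rewrite /rho V0 enorm0 expr0n.
  rewrite dist// /N /D /m r0 V0 (dotC 0) dot0r !mulr0 !addr0 sqrtr_sqr gtr0_norm ?tp//.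
  by rewrite mulrAC mulfV ?mul1r// gt_eqF// tp.
have -> : tau (Y p) (h p) (V p) = ta p by [].
set v := ta p *: h p + orthoproj (V p) (h p).
have vv : dot v v = D p.
  rewrite dotDl !dotDr !dotZl !dotZr hh (dotC (orthoproj _ _) (h p)) -dot_orthoproj_id.
  by rewrite -enorm_sqr -/(rho p) /D; ring.
have vb : dot v (b p) = N p by rewrite dotDl dotZl.
rewrite dist; last first.
  rewrite dot_normalize; case: eqVneq => // v0.
  by move: Dp; rewrite -vv v0 dot0r ltxx.
by rewrite dotZl vb /enorm vv (mulrC (N p)).
Qed.

End Limit.
End MapsError.

(** * Limits of the PCA quantities *)

Section SampleCovariance.
Context {R : realType} {p n : nat}.
Variables (Y : 'M[R]_(p, n)) (h : 'cV[R]_p).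
Hypotheses (n_gt0 : (0 < n)%N) (hP : is_pca Y h).

Let n0 : n%:R != 0 :> R. Proof. by rewrite pnatr_eq0 -lt0n. Qed.

Lemma pca_gram : Y *m (Y^T *m h) = (n%:R * s2 Y) *: h.
Proof.
have [+ _ _] := hP; rewrite /sample_cov -scalemxAl -mulmxA => hS.
by rewrite -scalerA -hS scalerA mulfV// scale1r.
Qed.

Lemma dot_pca_coeff : dot (Y^T *m h) (Y^T *m h) = n%:R * s2 Y.
Proof.
have [_ h1 _] := hP.
by rewrite -dot_mulmx_tr pca_gram dotZl -enorm_sqr h1 expr1n mulr1.
Qed.

(** Transfers the Rayleigh bound from Y Y^T to Y^T Y: with v = Yx, |v|^4 = (x, Y^T v)^2 <= |x|^2
    |Y^T v|^2, and the last factor is at most [n * s2 Y] times |v|^2. *)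
Lemma dot_mulmx_le_s2 (x : 'cV[R]_n) : dot (Y *m x) (Y *m x) <= n%:R * s2 Y * dot x x.
Proof.
set v := Y *m x.
have ST : (sample_cov Y)^T = sample_cov Y by rewrite linearZ /= trmx_mul trmxK.
have ray := rayleigh_le_max_eigenvalue v ST.
have vS : n%:R * dot v (sample_cov Y *m v) = dot (Y^T *m v) (Y^T *m v).
  rewrite -scalemxAl dotZr mulrA mulfV// mul1r -mulmxA.
  by rewrite (dotC v) dot_mulmx_tr.
have cs : dot v v ^+ 2 <= dot x x * dot (Y^T *m v) (Y^T *m v).
  by rewrite {1}/v dot_mulmx_tr; exact: dot_cauchy_schwarz.
have s0 : 0 <= n%:R * s2 Y by rewrite -dot_pca_coeff dot_ge0.
have [->|v0] := eqVneq (dot v v) 0; first by rewrite mulr_ge0// dot_ge0.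
have vp : 0 < dot v v by rewrite lt0r v0 dot_ge0.
rewrite -(ler_pM2l vp) -expr2; apply: le_trans cs _.
have key : dot (Y^T *m v) (Y^T *m v) <= n%:R * s2 Y * dot v v.
  by rewrite -vS -mulrA; apply: ler_wpM2l.
have -> : dot v v * (n%:R * s2 Y * dot x x) = dot x x * (n%:R * s2 Y * dot v v) by ring.
by apply: ler_wpM2l => //; exact: dot_ge0.
Qed.

Lemma mxtrace_sample_cov :
  \tr (sample_cov Y) = n%:R^-1 * \sum_j dot (col j Y) (col j Y).
Proof.
rewrite /sample_cov linearZ /= mxtrace_mulC; congr (_ * _).
apply: eq_bigr => j _; rewrite mxE; apply: eq_bigr => i _; by rewrite !mxE.
Qed.

End SampleCovariance.

Section MeanLinear.
Context {R : realType} {p : nat}.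
Implicit Types x y : 'cV[R]_p.

Lemma meanD x y : mean (x + y) = mean x + mean y.
Proof.
by rewrite /mean -mulrDr -big_split; congr (_ * _); apply: eq_bigr => i _; rewrite mxE.
Qed.

Lemma meanZ a x : mean (a *: x) = a * mean x.
Proof.
rewrite /mean mulrCA; congr (_ * _).
by rewrite mulr_sumr; apply: eq_bigr => i _; rewrite mxE.
Qed.

Lemma mean_sum (I : Type) (s : seq I) (F : I -> 'cV[R]_p) :
  mean (\sum_(i <- s) F i) = \sum_(i <- s) mean (F i).
Proof.
elim: s => [|i s IH]; last by rewrite !big_cons meanD IH.
by rewrite !big_nil -(scale0r 0) meanZ mul0r.
Qed.

(** The mean square is the squared mean plus the variance; hence the value mu^2 (1 + disp^2) for the
    limit B^2 of |beta|^2 / p. *)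
Lemma dispersion_sqr x : (0 < p)%N -> mean x != 0 ->
  mean x ^+ 2 * (1 + dispersion x ^+ 2) = p%:R^-1 * dot x x.
Proof.
move=> p0 m0; rewrite /dispersion sqr_sqrtr; last first.
  by rewrite mulr_ge0// sumr_ge0// => i _; rewrite sqr_ge0.
have pn0 : p%:R != 0 :> R by rewrite pnatr_eq0 -lt0n.
have mE : \sum_i x i 0 = p%:R * mean x by rewrite mulrA mulfV// mul1r.
rewrite (eq_bigr (fun i => (mean x ^+ 2)^-1 * (x i 0 * x i 0 - 2 * mean x * x i 0 +
  mean x ^+ 2))).
  rewrite -mulr_sumr big_split /= sumrB -mulr_sumr mE sumr_const card_ord
    -(mulr_natl (_ ^+ 2)).
  by rewrite -/(dot x x); field; apply/andP.
by move=> i _; field.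
Qed.

Lemma mulmx_colE n (z : 'M[R]_(p, n)) (y : 'cV[R]_n) : z *m y = \sum_j y j 0 *: col j z.
Proof.
apply/matrixP => i j; rewrite ord1 mxE summxE; apply: eq_bigr => k _.
by rewrite !mxE mulrC.
Qed.

End MeanLinear.

(** * Leading eigenvector of a rank one signal plus noise, along one path *)

Section PcaLimit.
Context {R : realType} {n : nat}.
Variables (n_ge2 : (2 <= n)%N) (u : forall p, 'cV[R]_p) (x : 'cV[R]_n)
  (z : forall p, 'M[R]_(p, n)) (h : forall p, 'cV[R]_p) (mu disp delta : R).
Let Y p := u p *m x^T + z p.
Hypotheses (mu0 : 0 < mu) (disp0 : 0 < disp) (delta0 : 0 < delta) (x0 : x != 0)
  (u_mean : mean (u p) @[p --> \oo] --> mu)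
  (u_disp : dispersion (u p) @[p --> \oo] --> disp)
  (z_gram : forall j k, p%:R^-1 * dot (col j (z p)) (col k (z p)) @[p --> \oo]
     --> (j == k)%:R * delta ^+ 2)
  (z_factor : forall j, p%:R^-1 * dot (u p) (col j (z p)) @[p --> \oo] --> 0)
  (z_mean : forall j, mean (col j (z p)) @[p --> \oo] --> 0)
  (h_pca : forall p, (1 <= p)%N -> is_pca (Y p) (h p)).

Let B2 := mu ^+ 2 * (1 + disp ^+ 2).
Let X2 := dot x x.
Let lam := B2 * X2 + delta ^+ 2.
Let U p := p%:R^-1 * dot (u p) (u p).

(** Square root of the share of the signal in [lam], the limit of [n * s2 / p]. *)
Definition pca_cos := Num.sqrt (B2 * X2 / lam).
(** The limit mu^2 / B^2 of (b, q)^2. *)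
Definition mean_cos2 := (1 + disp ^+ 2)^-1.

Let B2_gt0 : 0 < B2.
Proof. by rewrite mulr_gt0 ?exprn_gt0// ltr_pwDl// sqr_ge0. Qed.

Let X2_gt0 : 0 < X2.
Proof. by rewrite lt0r dot_ge0 andbT; apply: contra_neq x0 => /dot_eq0. Qed.

Let lam_gt0 : 0 < lam.
Proof. by rewrite addr_gt0 ?exprn_gt0// mulr_gt0. Qed.

Let near_p0 : \forall p \near \oo, (0 < p)%N.
Proof. by exists 1%N. Qed.

Lemma pca_cos_itv : 0 < pca_cos < 1.
Proof.
have BX : 0 < B2 * X2 by exact: mulr_gt0.
rewrite /pca_cos; apply/andP; split; first by rewrite sqrtr_gt0 divr_gt0.
rewrite -[ltRHS]sqrtr1 ltr_sqrt// ltr_pdivrMr// mul1r ltrDl.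
exact: exprn_gt0.
Qed.

Let U_cvg : U p @[p --> \oo] --> B2.
Proof.
have H : mean (u p) ^+ 2 * (1 + dispersion (u p) ^+ 2) @[p --> \oo] --> B2.
  apply: cvgM; first exact: cvgM.
  by apply: cvgD; [exact: cvg_cst|exact: cvgM].
apply: cvg_trans H; apply: near_eq_cvg.
have : \forall p \near \oo, 0 < mean (u p) by exact: (cvgr_gt mu).
by apply: filterS2 near_p0 => p p0 m0; rewrite /U dispersion_sqr// gt_eqF.
Qed.

Let YE p (y : 'cV[R]_n) : Y p *m y = dot x y *: u p + z p *m y.
Proof. by rewrite mulmxDl -mulmxA dot_mxE mul_mx_scalar. Qed.

Let cvg_sum (F : 'I_n -> nat -> R) (l : 'I_n -> R) :
  (forall j, F j p @[p --> \oo] --> l j) -> \sum_j F j p @[p --> \oo] --> \sum_j l j.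
Proof.
move=> Fl; apply: (cvg_big (op := +%R)); first exact: add_continuous.
by move=> j _; exact: Fl.
Qed.

Let noise_factor (y : nat -> 'cV[R]_n) : (forall j, seq_bounded (fun p => y p j 0)) ->
  p%:R^-1 * dot (u p) (z p *m y p) @[p --> \oo] --> 0.
Proof.
move=> yb; rewrite [X in _ --> X](_ : 0 = \sum_(j < n) 0); last by rewrite big1.
rewrite (_ : (fun p => _) =
  fun p => \sum_j (p%:R^-1 * dot (u p) (col j (z p)) * y p j 0)).
  by apply: cvg_sum => j; apply: cvg0_bounded.
apply/funext => p; rewrite mulmx_colE dot_sumr mulr_sumr; apply: eq_bigr => j _.
by rewrite dotZr mulrCA mulrC.
Qed.

Let noise_mean (y : nat -> 'cV[R]_n) : (forall j, seq_bounded (fun p => y p j 0)) ->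
  mean (z p *m y p) @[p --> \oo] --> 0.
Proof.
move=> yb; rewrite [X in _ --> X](_ : 0 = \sum_(j < n) 0); last by rewrite big1.
rewrite (_ : (fun p => _) = fun p => \sum_j (mean (col j (z p)) * y p j 0)).
  by apply: cvg_sum => j; apply: cvg0_bounded.
apply/funext => p; rewrite mulmx_colE mean_sum; apply: eq_bigr => j _.
by rewrite meanZ mulrC.
Qed.

Let noise_gram (y : nat -> 'cV[R]_n) : (forall j, seq_bounded (fun p => y p j 0)) ->
  asym (fun p => p%:R^-1 * dot (z p *m y p) (z p *m y p))
       (fun p => delta ^+ 2 * dot (y p) (y p)).
Proof.
move=> yb; rewrite /asym [X in _ --> X](_ : 0 = \sum_(j < n) \sum_(k < n) 0); last first.
  by rewrite big1// => j _; rewrite big1.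
rewrite (_ : (fun p => _) = fun p => \sum_j \sum_k
    ((p%:R^-1 * dot (col j (z p)) (col k (z p)) - (j == k)%:R * delta ^+ 2) *
      (y p j 0 * y p k 0))).
  apply: cvg_sum => j; apply: cvg_sum => k; apply: cvg0_bounded; last exact: seq_boundedM.
  by apply/subr_cvg0.
apply/funext => p.
have E : dot (z p *m y p) (z p *m y p) =
    \sum_j \sum_k dot (col j (z p)) (col k (z p)) * (y p j 0 * y p k 0).
  rewrite {1}mulmx_colE dotC dot_sumr; apply: eq_bigr => j _.
  rewrite mulmx_colE dotC dot_sumr; apply: eq_bigr => k _.
  by rewrite dotZl dotZr; ring.
rewrite E mulr_sumr /dot mulr_sumr -sumrB; apply: eq_bigr => j _.
rewrite [RHS](eq_bigr (fun k => p%:R^-1 * dot (col j (z p)) (col k (z p)) *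
    (y p j 0 * y p k 0) - (j == k)%:R * (delta ^+ 2 * (y p j 0 * y p k 0)))); last first.
  by move=> k _; rewrite mulrBl mulrA.
rewrite sumrB; congr (_ - _).
  by rewrite mulr_sumr; apply: eq_bigr => k _; rewrite [LHS]mulrA.
rewrite (bigD1 j)//= eqxx mul1r big1 ?addr0// => k kj.
by rewrite eq_sym (negPf kj) mul0r.
Qed.

(** The vector may vary with p, bounded coordinates being enough for n fixed. This permits y =
    [chi], of which no limit is known yet, besides x and the basis vectors. *)
Let quad (y : nat -> 'cV[R]_n) : (forall j, seq_bounded (fun p => y p j 0)) ->
  asym (fun p => p%:R^-1 * dot (Y p *m y p) (Y p *m y p))
       (fun p => B2 * dot x (y p) ^+ 2 + delta ^+ 2 * dot (y p) (y p)).
Proof.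
move=> yb.
have xyb : seq_bounded (fun p => dot x (y p)).
  rewrite (_ : (fun p => _) = fun p => \sum_j (x j 0 * y p j 0))//.
  elim: (index_enum _) => [|j s IH].
    by exists 0 => p; rewrite big_nil normr0.
  under eq_fun do rewrite big_cons; apply: seq_boundedD => //.
  by apply: seq_boundedM => //; exact: seq_bounded_cst.
have E p : p%:R^-1 * dot (Y p *m y p) (Y p *m y p) =
    dot x (y p) ^+ 2 * U p + (2 * dot x (y p)) * (p%:R^-1 * dot (u p) (z p *m y p)) +
    p%:R^-1 * dot (z p *m y p) (z p *m y p).
  by rewrite YE dotDl !dotDr !dotZl !dotZr (dotC (z p *m y p)) /U; ring.
have xy2b : seq_bounded (fun p => dot x (y p) ^+ 2).
  by under eq_fun do rewrite expr2; exact: seq_boundedM.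
have H1 : asym (fun p => dot x (y p) ^+ 2 * U p) (fun p => dot x (y p) ^+ 2 * B2).
  exact: (asymM xy2b (seq_bounded_cst B2) (asym_refl _) (proj1 (asym_cst _ _) U_cvg)).
have H2 : asym (fun p => (2 * dot x (y p)) * (p%:R^-1 * dot (u p) (z p *m y p)))
  (fun=> 0).
  apply: (proj1 (asym_cst _ _)).
  have := cvg0_bounded (noise_factor yb) (seq_boundedM (seq_bounded_cst 2) xyb).
  by apply: cvg_eqfun => p; exact: mulrC.
have := asymD (asymD H1 H2) (noise_gram yb).
by apply: cvg_eqfun => p; rewrite E addr0 (mulrC _ B2).
Qed.

Let sg p := p%:R^-1 * (n%:R * s2 (Y p)).
Let chi p := normalize ((Y p)^T *m h p).
Let xi p := dot x (chi p).

Let n_gt0 : (0 < n)%N. Proof. exact: leq_trans n_ge2. Qed.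

Let chi_bounded j : seq_bounded (fun p => chi p j 0).
Proof.
by exists 1 => p; apply: normr_coord_le1; exact: dot_normalize_le1.
Qed.

Let low p := p%:R^-1 * dot (Y p *m x) (Y p *m x) / X2.

Let low_cvg : low p @[p --> \oo] --> lam.
Proof.
have H : p%:R^-1 * dot (Y p *m x) (Y p *m x) @[p --> \oo] --> B2 * X2 ^+ 2 +
  delta ^+ 2 * X2.
  by apply: (proj2 (asym_cst _ _)); apply: (quad (y := fun=> x)) => j;
    exact: seq_bounded_cst.
have -> : lam = (B2 * X2 ^+ 2 + delta ^+ 2 * X2) / X2 by rewrite /lam; field;
  rewrite gt_eqF.
by apply: cvgM => //; exact: cvg_cst.
Qed.

Let low_le_sg : \forall p \near \oo, low p <= sg p.
Proof.
apply: filterS near_p0 => p p0; rewrite /low /sg -mulrA.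
apply: ler_wpM2l; first by rewrite invr_ge0.
by rewrite ler_pdivrMr//; apply: dot_mulmx_le_s2 => //; exact: h_pca.
Qed.

Let sg_pos : \forall p \near \oo, 0 < sg p.
Proof.
have : \forall p \near \oo, 0 < low p by exact: (cvgr_gt lam).
by apply: filterS2 low_le_sg => p lo l0; exact: lt_le_trans lo.
Qed.

Let ns2E p : (0 < p)%N -> n%:R * s2 (Y p) = p%:R * sg p.
Proof. by move=> p0; rewrite mulrA mulfV ?mul1r// pnatr_eq0 -lt0n. Qed.

Let chi_unit : \forall p \near \oo, dot (chi p) (chi p) = 1.
Proof.
apply: filterS2 near_p0 sg_pos => p p0 sp; rewrite dot_normalize.
case: eqVneq => // h0; have := dot_pca_coeff n_gt0 (h_pca p0).
by rewrite h0 dot0r ns2E// => /esym/eqP; rewrite mulf_eq0 !gt_eqF// ltr0n.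
Qed.

Let Ychi p : (0 < p)%N -> 0 < sg p ->
  Y p *m chi p = Num.sqrt (n%:R * s2 (Y p)) *: h p.
Proof.
move=> p0 sp; rewrite -scalemxAr (pca_gram n_gt0 (h_pca p0)) scalerA; congr (_ *: _).
have ns0 : 0 < n%:R * s2 (Y p) by rewrite ns2E// mulr_gt0// ltr0n.
rewrite /enorm (dot_pca_coeff n_gt0 (h_pca p0)).
by rewrite -[X in _ * X](sqr_sqrtr (ltW ns0)) expr2 mulKf// gt_eqF// sqrtr_gt0.
Qed.

Let sgE : asym sg (fun p => B2 * xi p ^+ 2 + delta ^+ 2).
Proof.
have := quad chi_bounded; rewrite /asym => H.
apply: cvg_trans H; apply: near_eq_cvg.
apply: filterS2 near_p0 (filterI sg_pos chi_unit) => p p0 [sp c1].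
rewrite (Ychi p0 sp) dotZl dotZr mulrA -expr2 sqr_sqrtr; last first.
  by rewrite ns2E// mulr_ge0// ltW.
by have [_ h1 _] := h_pca p0; rewrite -enorm_sqr h1 expr1n mulr1 c1 mulr1.
Qed.

Let xi_le p : xi p ^+ 2 <= X2.
Proof.
apply: le_trans (dot_cauchy_schwarz _ _) _.
rewrite -[leRHS]mulr1; apply: ler_wpM2l; first exact: dot_ge0.
exact: dot_normalize_le1.
Qed.

(** Squeeze: the test vector x bounds [sg] below by [low], which tends to [lam]; above, [sg] is B2
    xi^2 + delta^2 up to a vanishing error, and this is at most [lam] by Cauchy-Schwarz. *)
Let sg_cvg : sg p @[p --> \oo] --> lam.
Proof.
pose e p := sg p - (B2 * xi p ^+ 2 + delta ^+ 2).
have up : lam + e p @[p --> \oo] --> lam.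
  by rewrite -[X in _ --> X]addr0; apply: cvgD; [exact: cvg_cst|exact: sgE].
apply: (squeeze_cvgr _ low_cvg up).
apply: filterS low_le_sg => p ->; rewrite /e /lam /=.
by have := xi_le p; have := B2_gt0; nra.
Qed.

Let xi2_cvg : xi p ^+ 2 @[p --> \oo] --> X2.
Proof.
have H : (sg p - delta ^+ 2) - (sg p - (B2 * xi p ^+ 2 + delta ^+ 2)) @[p --> \oo] -->
    (lam - delta ^+ 2) - 0.
  apply: cvgB; last exact: sgE.
  by apply: cvgB => //; exact: cvg_cst.
have -> : X2 = (lam - delta ^+ 2 - 0) / B2 by rewrite /lam; field; rewrite gt_eqF.
apply: (cvg_eqfun _ (cvgM H (cvg_cst (B2^-1)))) => p /=.
by field; rewrite gt_eqF.
Qed.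

Let sq_lam : Num.sqrt (sg p) @[p --> \oo] --> Num.sqrt lam.
Proof. by apply: (cvg_comp _ _ sg_cvg); exact: sqrt_continuous. Qed.

Let sq_U : Num.sqrt (U p) @[p --> \oo] --> Num.sqrt B2.
Proof. by apply: (cvg_comp _ _ U_cvg); exact: sqrt_continuous. Qed.

Let dot_h_q p : (0 < p)%N -> 0 < sg p ->
  dot (h p) (qvec p) * Num.sqrt (sg p) = xi p * mean (u p) + mean (z p *m chi p).
Proof.
move=> p0 sp; have sp0 : Num.sqrt p%:R != 0 :> R by rewrite gt_eqF// sqrtr_gt0 ltr0n.
apply: (mulfI sp0); rewrite mulrCA -sqrtrM ?ler0n// -ns2E// mulrC -dotZl -(Ychi p0 sp).
by rewrite dot_qvecr YE meanD meanZ.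
Qed.

(** The limit of xi^2 leaves the sign open. In sqrt(sg) (h, q) = xi mean(u) + mean(z chi) the means
    of u tend to mu > 0 and the noise term to 0, so a negative xi would make (h, q) negative,
    against the sign convention. *)
Let xi_cvg : xi p @[p --> \oo] --> Num.sqrt X2.
Proof.
have H : `|xi p| @[p --> \oo] --> Num.sqrt X2.
  under eq_fun do rewrite -sqrtr_sqr.
  by apply: (cvg_comp _ _ xi2_cvg); exact: sqrt_continuous.
apply: (cvg_trans _ H); apply: near_eq_cvg.
have sX : 0 < Num.sqrt X2 / 2 by rewrite divr_gt0// sqrtr_gt0.
have big : \forall p \near \oo, Num.sqrt X2 / 2 < `|xi p|.
  by apply: (cvgr_gt (Num.sqrt X2)) => //; have := sX; lra.
have e0 : 0 < Num.sqrt X2 / 2 * (mu / 2) by rewrite mulr_gt0// divr_gt0.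
have small : \forall p \near \oo, `|mean (z p *m chi p)| < Num.sqrt X2 / 2 * (mu / 2).
  by move/cvgr0Pnorm_lt: (noise_mean chi_bounded); exact.
have mbig : \forall p \near \oo, mu / 2 < mean (u p).
  by apply: (cvgr_gt mu) => //; have := mu0; lra.
apply: filterS2 (filterI near_p0 sg_pos) (filterI big (filterI small mbig)).
move=> p [p0 sp] [xb [ms mb]].
have [_ _ hq] := h_pca p0.
apply: ger0_norm; rewrite leNgt; apply/negP => xneg.
have := dot_h_q p0 sp; apply/eqP; rewrite gt_eqF//.
apply: (@lt_le_trans _ _ 0); last by rewrite mulr_ge0// sqrtr_ge0.
move: xb ms; rewrite ltr0_norm// ltr_norml => xb /andP[_ ms].
by have := mu0; nra.
Qed.

(** The trace of Y^T Y / p tends to B2 X2 + n delta^2; removing [lam] and dividing by n - 1 leaves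
    delta^2, so psi^2 tends to 1 - delta^2 / lam. *)
Lemma pca_psi_cvg : psi (Y p) @[p --> \oo] --> pca_cos.
Proof.
have tr : p%:R^-1 * \sum_j dot (col j (Y p)) (col j (Y p)) @[p --> \oo] -->
    B2 * X2 + n%:R * delta ^+ 2.
  have -> : B2 * X2 + n%:R * delta ^+ 2 = \sum_(j < n) (B2 * x j 0 ^+ 2 + delta ^+ 2).
    rewrite big_split /= -mulr_sumr sumr_const card_ord (mulr_natl (_ ^+ 2)).
    by congr (_ * _ + _).
  under eq_fun do rewrite mulr_sumr; apply: cvg_sum => j.
  pose e : 'cV[R]_n := delta_mx j 0.
  have xe : dot x e = x j 0.
    rewrite /dot (bigD1 j)//= mxE !eqxx mulr1 big1 ?addr0// => k kj.
    by rewrite mxE (negPf kj) mulr0.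
  have ee : dot e e = 1.
    rewrite /dot (bigD1 j)//= mxE !eqxx mulr1 big1 ?addr0// => k kj.
    by rewrite mxE (negPf kj) mulr0.
  have H : asym (fun p => p%:R^-1 * dot (Y p *m e) (Y p *m e))
      (fun p => B2 * dot x e ^+ 2 + delta ^+ 2 * dot e e).
    by apply: (quad (y := fun=> e)) => k; exact: seq_bounded_cst.
  move: (proj2 (asym_cst _ _) H); rewrite xe ee mulr1.
  by apply: cvg_eqfun => p; rewrite colE.
have n1 : 0 < n%:R - 1 :> R by rewrite subr_gt0 ltr1n.
have n0' : 0 < n%:R :> R by rewrite ltr0n.
pose w p := 1 - ((p%:R^-1 * \sum_j dot (col j (Y p)) (col j (Y p)) - sg p) / (n%:R - 1))
  * (sg p)^-1.
have wE : w p @[p --> \oo] --> B2 * X2 / lam.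
  have -> : B2 * X2 / lam = 1 - ((B2 * X2 + n%:R * delta ^+ 2 - lam) / (n%:R - 1)) *
    lam^-1.
    rewrite /lam; field; apply/andP; split; rewrite gt_eqF//.
  apply: cvgB; first exact: cvg_cst.
  apply: cvgM; last by apply: cvgV => //; rewrite gt_eqF.
  by apply: cvgM; [exact: cvgB|exact: cvg_cst].
have H : Num.sqrt (w p) @[p --> \oo] --> pca_cos.
  by apply: (cvg_comp _ _ wE); exact: sqrt_continuous.
apply: cvg_trans H; apply: near_eq_cvg.
apply: filterS2 near_p0 sg_pos => p p0 sp.
have pp : 0 < p%:R :> R by rewrite ltr0n.
rewrite /psi /w; congr Num.sqrt; rewrite /l2 mxtrace_sample_cov.
have -> : s2 (Y p) = n%:R^-1 * (p%:R * sg p) by rewrite -ns2E// mulKf// gt_eqF.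
by field; rewrite !gt_eqF.
Qed.

Let b p := normalize (u p).

Let enorm_u p : (0 < p)%N -> enorm (u p) = Num.sqrt p%:R * Num.sqrt (U p).
Proof.
move=> p0; rewrite -sqrtrM ?ler0n// /U mulrA mulfV ?mul1r// pnatr_eq0 -lt0n//.
Qed.

Let U_pos : \forall p \near \oo, 0 < U p.
Proof. exact: (cvgr_gt B2). Qed.

Let u_neq0 p : (0 < p)%N -> 0 < U p -> u p != 0.
Proof.
by move=> p0; rewrite /U; case: eqVneq => // ->; rewrite dot0r mulr0 ltxx.
Qed.

Lemma factor_unit : \forall p \near \oo, enorm (b p) = 1.
Proof.
apply: filterS2 near_p0 U_pos => p p0 Up.
by rewrite /enorm dot_normalize u_neq0// sqrtr1.
Qed.

Let u_b p : enorm (u p) *: b p = u p.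
Proof.
have [->|u0] := eqVneq (u p) 0; first by rewrite enorm0 scale0r.
rewrite scalerA mulfV ?scale1r//.
by rewrite sqrtr_eq0 -ltNge lt0r dot_ge0 andbT; apply: contra_neq u0 => /dot_eq0.
Qed.

Lemma factor_mean_cvg : dot (b p) (qvec p) ^+ 2 @[p --> \oo] --> mean_cos2.
Proof.
have H : mean (u p) ^+ 2 / U p @[p --> \oo] --> mu ^+ 2 / B2.
  apply: cvgM; first exact: cvgM.
  by apply: cvgV => //; rewrite gt_eqF.
have -> : mean_cos2 = mu ^+ 2 / B2.
  rewrite /mean_cos2 /B2; field; apply/andP; split; last by rewrite gt_eqF.
  by rewrite gt_eqF// ltr_pwDl// sqr_ge0.
apply: (cvg_trans _ H); apply: near_eq_cvg.
apply: filterS2 near_p0 U_pos => p p0 Up.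
have pp : 0 < p%:R :> R by rewrite ltr0n.
rewrite dotZl dot_qvecr enorm_u// -[X in _ / X](sqr_sqrtr (ltW Up)).
by field; rewrite !gt_eqF ?sqrtr_gt0.
Qed.

Lemma mean_cos2_itv : 0 <= mean_cos2 <= 1.
Proof.
have d1 : 1 <= 1 + disp ^+ 2 by rewrite lerDl sqr_ge0.
have d0 : 0 < 1 + disp ^+ 2 by exact: lt_le_trans d1.
by rewrite /mean_cos2 invr_ge0 ltW//= invf_le1.
Qed.

Let coef p := xi p * Num.sqrt (U p) / Num.sqrt (sg p).

Let coef_cvg : coef p @[p --> \oo] --> pca_cos.
Proof.
have -> : pca_cos = Num.sqrt X2 * Num.sqrt B2 / Num.sqrt lam.
  have BX : 0 <= B2 * X2 by rewrite mulr_ge0 ?ltW.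
  by rewrite /pca_cos (sqrtrM _ BX) sqrtrV ?ltW// sqrtrM ?ltW// (mulrC (Num.sqrt B2)).
apply: cvgM; first exact: cvgM.
by apply: cvgV => //; rewrite gt_eqF// sqrtr_gt0.
Qed.

(** Obtained from Y chi = sqrt(n s2) h by splitting Y into signal and noise; [coef] carries the
    limiting cosine. *)
Let h_decomp p : (0 < p)%N -> 0 < sg p ->
  h p = coef p *: b p + (Num.sqrt (n%:R * s2 (Y p)))^-1 *: (z p *m chi p).
Proof.
move=> p0 sp; have pp : 0 < p%:R :> R by rewrite ltr0n.
have ns0 : 0 < n%:R * s2 (Y p) by rewrite ns2E// mulr_gt0.
have sn0 : Num.sqrt (n%:R * s2 (Y p)) != 0 by rewrite gt_eqF// sqrtr_gt0.
have -> : h p = (Num.sqrt (n%:R * s2 (Y p)))^-1 *: (Y p *m chi p).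
  by rewrite Ychi// scalerA mulVf// scale1r.
rewrite YE scalerDr; congr (_ + _).
rewrite -[in LHS](u_b p) (scalerA _ _ (b p)) (scalerA _ _ (b p)); congr (_ *: _).
rewrite enorm_u// ns2E// sqrtrM ?ler0n// /coef -/(xi p).
by field; rewrite !gt_eqF ?sqrtr_gt0.
Qed.

(* The component of h along the noise is negligible on every subspace on which
   the projections of the columns of the noise are o(sqrt p). *)
Lemma pca_proj_cvg (V : forall p, {vspace 'cV[R]_p}) :
  (forall j, p%:R^-1 * dot (orthoproj (V p) (col j (z p))) (orthoproj (V p) (col j (z p)))
     @[p --> \oo] --> 0) ->
  enorm (orthoproj (V p) (h p) - pca_cos *: orthoproj (V p) (b p)) @[p --> \oo] --> 0.
Proof.
move=> Vz; pose N j p := Num.sqrt (p%:R^-1 *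
  dot (orthoproj (V p) (col j (z p))) (orthoproj (V p) (col j (z p)))).
have NN : \sum_j N j p @[p --> \oo] --> 0.
  rewrite [X in _ --> X](_ : 0 = \sum_(j < n) 0); last by rewrite big1.
  apply: cvg_sum => j; rewrite -[X in _ --> X](@sqrtr0 R).
  by apply: (cvg_comp _ _ (Vz j)); exact: sqrt_continuous.
pose e p := `|coef p - pca_cos| + (Num.sqrt (sg p))^-1 * \sum_j N j p.
have e0 : e p @[p --> \oo] --> 0.
  rewrite -[X in _ --> X](addr0 0); apply: cvgD.
    rewrite -[X in _ --> X](normr0 R); apply: cvg_norm.
    by apply/subr_cvg0.
  rewrite -[X in _ --> X](mulr0 (Num.sqrt lam)^-1); apply: cvgM => //.
  by apply: cvgV => //; rewrite gt_eqF// sqrtr_gt0.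
apply: (squeeze_cvgr _ (@cvg_cst _ (0 : R) nat \oo _) e0).
apply: filterS2 near_p0 sg_pos => p p0 sp; rewrite enorm_ge0 /=.
have pp : 0 < p%:R :> R by rewrite ltr0n.
rewrite {1}(h_decomp p0 sp) orthoprojD (orthoprojZ _ (coef p)).
rewrite (orthoprojZ _ _ (z p *m chi p)) addrAC -scalerBl.
apply: le_trans (enormD _ _) _; apply: lerD.
  rewrite enormZ -[leRHS]mulr1; apply: ler_wpM2l => //.
  apply: le_trans (enorm_orthoproj_le _ _) _.
  by rewrite -sqrtr1; apply: ler_wsqrtr; exact: dot_normalize_le1.
rewrite enormZ ger0_norm ?invr_ge0 ?sqrtr_ge0// ns2E// sqrtrM ?ler0n//.
rewrite invfM (mulrC (Num.sqrt p%:R)^-1) -(mulrA (Num.sqrt (sg p))^-1).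
apply: ler_wpM2l; first by rewrite invr_ge0 sqrtr_ge0.
rewrite mulmx_colE orthoproj_sum.
rewrite ler_pdivrMl ?sqrtr_gt0// mulr_sumr; apply: le_trans (enorm_sum _ _) _.
apply: ler_sum => j _; rewrite orthoprojZ enormZ.
rewrite /N -sqrtrM ?ler0n// mulrA mulfV ?gt_eqF// mul1r -[leRHS]mul1r.
apply: ler_wpM2r; first exact: enorm_ge0.
by apply: normr_coord_le1; exact: dot_normalize_le1.
Qed.

(** Pairing the decomposition of [h] with b leaves [coef] and a multiple of (u, z chi) / p, which
    vanishes. *)
Lemma pca_dot_cvg : dot (h p) (b p) @[p --> \oo] --> pca_cos.
Proof.
have H : coef p + p%:R^-1 * dot (u p) (z p *m chi p) / (Num.sqrt (sg p) * Num.sqrt (U p))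
    @[p --> \oo] --> pca_cos + 0 / (Num.sqrt lam * Num.sqrt B2).
  apply: cvgD => //; apply: cvgM; first exact: noise_factor.
  by apply: cvgV; [rewrite mulf_neq0// gt_eqF// sqrtr_gt0|exact: cvgM].
rewrite mul0r addr0 in H; apply: (cvg_trans _ H); apply: near_eq_cvg.
apply: filterS2 (filterI near_p0 U_pos) sg_pos => p [p0 Up] sp.
have pp : 0 < p%:R :> R by rewrite ltr0n.
rewrite [in RHS](h_decomp p0 sp) dotDl (dotZl (coef p)) dot_normalize u_neq0// mulr1;
  congr (_ + _).
rewrite dotZl dotZr (dotC _ (u p)) enorm_u// ns2E// (sqrtrM (sg p) (ler0n R p)).
rewrite -[X in X^-1 * dot _ _](sqr_sqrtr (ltW pp)).
by field; rewrite !gt_eqF ?sqrtr_gt0.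
Qed.

End PcaLimit.

(** * Pathwise limits *)

Lemma limn_esup_le (R : realType) (u w : nat -> R) (l : R) :
  (\forall p \near \oo, u p <= w p) -> w p @[p --> \oo] --> l ->
  (limn_esup (fun p => (u p)%:E) <= l%:E)%E.
Proof.
move=> uw wl; apply/lee_addgt0Pr => e e0.
have wle : \forall p \near \oo, w p < l + e by apply: (cvgr_lt l) => //; rewrite ltrDl.
(* The upper limit is an infimum of suprema over the sets of the filter, and the indices with u p <=
   l + e form one of these sets. *)
apply: le_trans (_ : (ereal_sup [set (u p)%:E | p in [set p | (u p <= l + e)%R]] <= _)%E).
  apply: ereal_inf_lbound => /=; eexists; last reflexivity.
  by apply: filterS2 uw wle => p /le_trans + /ltW; exact.
by apply: ge_ereal_sup => _ [p /= up <-]; rewrite -EFinD lee_fin.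
Qed.

Section Subspaces.
Context {R : realType}.

Lemma cvg0_near_le (u v : nat -> R) : (\forall p \near \oo, 0 <= u p <= v p) ->
  v p @[p --> \oo] --> 0 -> u p @[p --> \oo] --> 0.
Proof. by move=> uv; apply: squeeze_cvgr; [exact: uv|exact: cvg_cst]. Qed.

Variables (k : nat -> nat) (M : forall p, 'M[R]_p) (L : forall p, {vspace 'cV[R]_p}).
Hypotheses (MO : forall p, (2 <= p)%N -> orthogonal_group (M p))
  (LM : forall p, (2 <= p)%N -> L p = span_cols (k p) (M p)).

Let near_p2 : \forall p \near \oo, (2 <= p)%N. Proof. by exists 2%N. Qed.

Lemma span_cols_noise_cvg (z : forall p, 'cV[R]_p) :
  p%:R^-1 * (energy (k p) (M p) (z p) + dot (residual_dir (k p) (M p)) (z p) ^+ 2)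
    @[p --> \oo] --> 0 ->
  p%:R^-1 * dot (orthoproj (L p + <[qvec p]>) (z p)) (orthoproj (L p + <[qvec p]>) (z p))
    @[p --> \oo] --> 0 /\
  p%:R^-1 * dot (orthoproj (L p) (z p)) (orthoproj (L p) (z p)) @[p --> \oo] --> 0.
Proof.
move=> H; split; apply: cvg0_near_le H; apply: filterS near_p2 => p p2.
  rewrite mulr_ge0 ?invr_ge0 ?dot_ge0//= dot_orthoproj_addv_line LM//.
  rewrite (dot_orthoproj_span_cols _ _ (MO p2)).
  by rewrite (orthoproj_span_cols (k p) (qvec p) (MO p2)).
rewrite mulr_ge0 ?invr_ge0 ?dot_ge0//= LM// (dot_orthoproj_span_cols _ _ (MO p2)).
by apply: ler_wpM2l; rewrite ?invr_ge0// lerDl sqr_ge0.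
Qed.

(** With r = q - proj_L q, the enlarged space adds (r, b)^2 / |r|^2 to |proj_L b|^2. As |proj_L q|
    tends to 0, |r| tends to 1 and (r, b) - (q, b) tends to 0. *)
Lemma span_cols_factor_cvg (b : forall p, 'cV[R]_p) (c : R) :
  (forall p, dot (b p) (b p) <= 1) ->
  energy (k p) (M p) (b p) @[p --> \oo] --> 0 ->
  energy (k p) (M p) (qvec p) @[p --> \oo] --> 0 ->
  dot (b p) (qvec p) ^+ 2 @[p --> \oo] --> c ->
  dot (orthoproj (L p + <[qvec p]>) (b p)) (orthoproj (L p + <[qvec p]>) (b p))
    @[p --> \oo] --> c /\
  dot (orthoproj (L p) (b p)) (orthoproj (L p) (b p)) @[p --> \oo] --> 0.
Proof.
move=> b1 eb eq bq.
have Lb : dot (orthoproj (L p) (b p)) (orthoproj (L p) (b p)) @[p --> \oo] --> 0.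
  apply: (cvg_trans _ eb); apply: near_eq_cvg; apply: filterS near_p2 => p p2.
  by rewrite LM// (dot_orthoproj_span_cols _ _ (MO p2)).
have Lq : dot (orthoproj (L p) (qvec p)) (orthoproj (L p) (qvec p)) @[p --> \oo] --> 0.
  apply: (cvg_trans _ eq); apply: near_eq_cvg; apply: filterS near_p2 => p p2.
  by rewrite LM// (dot_orthoproj_span_cols _ _ (MO p2)).
split => //.
pose r p := qvec p - orthoproj (L p) (qvec p).
have rr p : (0 < p)%N -> dot (r p) (r p) =
  1 - dot (orthoproj (L p) (qvec p)) (orthoproj (L p) (qvec p)).
  move=> p0; rewrite /r dotBl !dotBr (dotC (orthoproj _ _) (qvec p)) -dot_orthoproj_id
    dot_qvec//.
  by ring.
pose x p := dot (orthoproj (L p) (qvec p)) (b p).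
have x2 : x p ^+ 2 @[p --> \oo] --> 0.
  apply: cvg0_near_le Lq; apply: nearW => p; rewrite sqr_ge0 /=.
  apply: le_trans (dot_cauchy_schwarz _ _) _; rewrite -[leRHS]mulr1.
  by apply: ler_wpM2l => //; exact: dot_ge0.
have x0 := sqr_cvg0 x2.
have bqb : seq_bounded (fun p => dot (b p) (qvec p)).
  exists 1 => p; rewrite -(expr_le1 (n := 2))// real_normK ?num_real//.
  case: p => [|p]; first by rewrite /dot big_ord0 expr0n.
  by apply: le_trans (dot_cauchy_schwarz _ _) _; rewrite dot_qvec// mulr1.
have rb : dot (r p) (b p) ^+ 2 @[p --> \oo] --> c.
  have H : dot (b p) (qvec p) ^+ 2 - 2 * (x p * dot (b p) (qvec p)) +
    x p ^+ 2 @[p --> \oo] -->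
      c - 2 * 0 + 0.
    apply: cvgD => //; apply: cvgB => //; apply: cvgM; first exact: cvg_cst.
    exact: cvg0_bounded.
  rewrite mulr0 subr0 addr0 in H; apply: cvg_eqfun H => p.
  by rewrite /r dotBl -/(x p) (dotC (qvec p)); ring.
have r1 : dot (r p) (r p) @[p --> \oo] --> (1 : R).
  have H : 1 - dot (orthoproj (L p) (qvec p)) (orthoproj (L p) (qvec p)) @[p --> \oo]
    --> (1 - 0 : R).
    by apply: cvgB => //; exact: cvg_cst.
  rewrite subr0 in H; apply: (cvg_trans _ H); apply: near_eq_cvg.
  by apply: filterS near_p2 => p p2; rewrite rr// ltnW.
have H : dot (orthoproj (L p) (b p)) (orthoproj (L p) (b p)) +
  dot (r p) (b p) ^+ 2 / dot (r p) (r p)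
    @[p --> \oo] --> 0 + c / 1.
  by apply: cvgD => //; apply: cvgM => //; apply: cvgV => //; exact: oner_neq0.
rewrite add0r divr1 in H; apply: cvg_eqfun H => p.
by rewrite dot_orthoproj_addv_line dotZl exprMn exprVn enorm_sqr mulrC.
Qed.

End Subspaces.

Section Pathwise.
Context {R : realType} {n : nat}.
Variables (n_ge2 : (2 <= n)%N) (u : forall p, 'cV[R]_p) (x : 'cV[R]_n)
  (z : forall p, 'M[R]_(p, n)) (h : forall p, 'cV[R]_p) (mu disp delta : R)
  (kL kH : nat -> nat) (ML MH : forall p, 'M[R]_p) (L H : forall p, {vspace 'cV[R]_p}).
Let Y p := u p *m x^T + z p.
Let b p := normalize (u p).
Hypotheses (mu0 : 0 < mu) (delta0 : 0 < delta) (x0 : x != 0)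
  (u_mean : mean (u p) @[p --> \oo] --> mu)
  (u_disp : dispersion (u p) @[p --> \oo] --> disp)
  (z_gram : forall j k, p%:R^-1 * dot (col j (z p)) (col k (z p)) @[p --> \oo]
     --> (j == k)%:R * delta ^+ 2)
  (z_factor : forall j, p%:R^-1 * dot (u p) (col j (z p)) @[p --> \oo] --> 0)
  (z_mean : forall j, mean (col j (z p)) @[p --> \oo] --> 0)
  (h_pca : forall p, (1 <= p)%N -> is_pca (Y p) (h p))
  (MLO : forall p, (2 <= p)%N -> orthogonal_group (ML p))
  (LM : forall p, (2 <= p)%N -> L p = span_cols (kL p) (ML p))
  (MHO : forall p, (2 <= p)%N -> orthogonal_group (MH p))
  (HM : forall p, (2 <= p)%N -> H p = span_cols (kH p) (MH p))
  (L_noise : forall j, p%:R^-1 * (energy (kL p) (ML p) (col j (z p)) +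
     dot (residual_dir (kL p) (ML p)) (col j (z p)) ^+ 2) @[p --> \oo] --> 0)
  (H_noise : forall j, p%:R^-1 * (energy (kH p) (MH p) (col j (z p)) +
     dot (residual_dir (kH p) (MH p)) (col j (z p)) ^+ 2) @[p --> \oo] --> 0)
  (H_factor : energy (kH p) (MH p) (b p) @[p --> \oo] --> 0)
  (H_mean : energy (kH p) (MH p) (qvec p) @[p --> \oo] --> 0).

Let s := pca_cos x mu disp delta.
Let c := mean_cos2 disp.

Let s01 : 0 < s < 1. Proof. exact: pca_cos_itv. Qed.

Let b_le1 p : dot (b p) (b p) <= 1. Proof. exact: dot_normalize_le1. Qed.

Let near_p0 : \forall p \near \oo, (0 < p)%N. Proof. by exists 1%N. Qed.

Let h1 : \forall p \near \oo, enorm (h p) = 1.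
Proof. by apply: filterS near_p0 => p p0; have [] := h_pca p0. Qed.

Let b1 : \forall p \near \oo, enorm (b p) = 1.
Proof. exact: (factor_unit mu0 u_mean u_disp). Qed.

Let hb : dot (h p) (b p) @[p --> \oo] --> s.
Proof. exact: (pca_dot_cvg n_ge2 mu0 delta0 x0 u_mean u_disp z_gram z_factor z_mean
  h_pca). Qed.

Let bq : dot (b p) (qvec p) ^+ 2 @[p --> \oo] --> c.
Proof. exact: (factor_mean_cvg mu0 u_mean u_disp). Qed.

Let maps_asym (V : forall p, {vspace 'cV[R]_p}) :
  (forall j, p%:R^-1 * dot (orthoproj (V p) (col j (z p))) (orthoproj (V p) (col j (z p)))
     @[p --> \oo] --> 0) ->
  asym (fun p => enorm (maps (Y p) (h p) (V p) - b p))
    (fun p => maps_dist s (dot (orthoproj (V p) (b p)) (orthoproj (V p) (b p)))).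
Proof.
move=> Vz; apply: (maps_err_asym s01 _ h1 b1 b_le1 hb).
  exact: (pca_psi_cvg n_ge2 mu0 delta0 x0 u_mean u_disp z_gram z_factor h_pca).
exact: (pca_proj_cvg n_ge2 mu0 delta0 x0 u_mean u_disp z_gram z_factor z_mean h_pca Vz).
Qed.

Let c01 : 0 <= c <= 1. Proof. exact: mean_cos2_itv. Qed.

Let maps_cvg (V : forall p, {vspace 'cV[R]_p}) (t : R) :
  (forall j, p%:R^-1 * dot (orthoproj (V p) (col j (z p))) (orthoproj (V p) (col j (z p)))
     @[p --> \oo] --> 0) -> 0 <= t <= 1 ->
  dot (orthoproj (V p) (b p)) (orthoproj (V p) (b p)) @[p --> \oo] --> t ->
  enorm (maps (Y p) (h p) (V p) - b p) @[p --> \oo] --> maps_dist s t.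
Proof.
move=> Vz t01 Vt; apply: asym_cvg (maps_asym Vz) _.
by apply: (proj2 (asym_cst _ _)); apply: (asym_maps_dist s01) => //;
  exact: (proj1 (asym_cst _ _) Vt).
Qed.

Let bq01 p : 0 <= dot (b p) (qvec p) ^+ 2 <= 1.
Proof.
rewrite sqr_ge0 /=; case: p => [|p]; first by rewrite /dot big_ord0 expr0n.
by apply: le_trans (dot_cauchy_schwarz _ _) _; rewrite dot_qvec// mulr1.
Qed.

Lemma pathwise_maps_limits :
  [/\ enorm (gps (Y p) (h p) - b p) @[p --> \oo] --> maps_dist s c /\
      enorm (h p - b p) @[p --> \oo] --> maps_dist s 0,
      (limn_esup (fun p => (enorm (maps (Y p) (h p) (L p + <[qvec p]>) - b p))%:E)
         <= (maps_dist s c)%:E)%E,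
      enorm (maps (Y p) (h p) (H p + <[qvec p]>) - b p) @[p --> \oo] --> maps_dist s c &
      enorm (maps (Y p) (h p) (H p) - b p) @[p --> \oo] --> maps_dist s 0].
Proof.
have Lz j := span_cols_noise_cvg MLO LM (L_noise j).
have Hz j := span_cols_noise_cvg MHO HM (H_noise j).
have [Hqb Hb] := span_cols_factor_cvg MHO HM b_le1 H_factor H_mean bq.
split; first split.
- apply: (maps_cvg (V := fun p => <[qvec p]>%VS)) => //.
    (* On span{q}, the squared length of the projected noise column divided by p is the square of
       its mean. *)
    move=> j; have H0 : mean (col j (z p)) * mean (col j (z p)) @[p --> \oo] -->
      (0 * 0 : R).
      by apply: cvgM; exact: z_mean.
    rewrite mulr0 in H0; apply: (cvg_trans _ H0); apply: near_eq_cvg.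
    apply: filterS near_p0 => p p0.
    rewrite orthoproj_line ?dot_qvec// dotZl dotZr dot_qvec// mulr1 dot_qvecr.
    have pp : 0 < p%:R :> R by rewrite ltr0n.
    rewrite -[X in X^-1 * _](sqr_sqrtr (ltW pp)).
    by field; rewrite gt_eqF// sqrtr_gt0.
  apply: (cvg_trans _ bq); apply: near_eq_cvg; apply: filterS near_p0 => p p0.
  by rewrite orthoproj_line ?dot_qvec// dotZl dotZr dot_qvec// mulr1 expr2.
- have H0 : Num.sqrt (2 - 2 * dot (h p) (b p)) @[p --> \oo] --> maps_dist s 0.
    rewrite (maps_dist0 s01).
    have H1 : 2 - 2 * dot (h p) (b p) @[p --> \oo] --> 2 - 2 * s.
      by apply: cvgB; [exact: cvg_cst|apply: cvgM => //; exact: cvg_cst].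
    by apply: (cvg_comp _ _ H1); exact: sqrt_continuous.
  apply: (cvg_trans _ H0); apply: near_eq_cvg; apply: filterS2 h1 b1 => p hp bp.
  rewrite /enorm; congr Num.sqrt.
  rewrite dotBl !dotBr -!enorm_sqr hp bp (dotC (b p)) expr1n; ring.
(* Here |proj b|^2 is only bounded below, by (b, q)^2. The vanishing [e] absorbs the asymptotic
   formula, and the decrease of [maps_dist] gives the inequality. *)
- pose e p := enorm (maps (Y p) (h p) (L p + <[qvec p]>) - b p) - maps_dist s
    (dot (orthoproj (L p + <[qvec p]>) (b p)) (orthoproj (L p + <[qvec p]>) (b p))).
  apply: (@limn_esup_le _ _ (fun p => e p + maps_dist s (dot (b p) (qvec p) ^+ 2))).
    apply: filterS near_p0 => p p0; rewrite /e addrAC -addrA lerDl subr_ge0.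
    apply: (maps_dist_anti s01) => //.
      by rewrite dot_ge0 (le_trans (dot_orthoproj_le _ _)).
    apply: dot_sqr_le_orthoproj; last exact: dot_qvec.
    by apply: (subvP (addvSr (L p) <[qvec p]>)); exact: memv_line.
  rewrite -[X in _ --> X]add0r; apply: cvgD.
    by apply: maps_asym => j; exact: (Lz j).1.
  apply: (proj2 (asym_cst _ _)); apply: (asym_maps_dist s01) => //.
  exact: (proj1 (asym_cst _ _) bq).
- by apply: maps_cvg => // j; exact: (Hz j).1.
- apply: maps_cvg => //; last by rewrite lexx ler01.
  by move=> j; exact: (Hz j).2.
Qed.

End Pathwise.

(** * From almost sure events to the limits on one path *)

Theorem theorem2p2 (R : realType) (d : measure_display) (T : measurableType d)
  (P : probability T R) (n : nat) (n_ge2 : (2 <= n)%N)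
  (beta : nat -> {RV P >-> R}) (X : 'I_n -> {RV P >-> R})
  (Z : nat -> 'I_n -> {RV P >-> R}) (sigma delta : R)
  (A1 : assumption1 beta) (A2 : assumption2 beta X Z)
  (A3 : assumption3 X sigma) (A4 : assumption4 Z delta)
  (h : forall p, T -> 'cV[R]_p)
  (h_pca : forall p w, (1 <= p)%N -> is_pca (returns beta X Z p w) (h p w))
  (kL kH : nat -> nat) (xiL xiH : forall p, {RV P >-> borel_mx R p})
  (L H : forall p, T -> {vspace 'cV[R]_p})
  (L_random : forall p, (2 <= p)%N ->
    random_subspace (kL p) (xiL p) (L p))
  (H_haar : forall p, (2 <= p)%N ->
    haar_random_subspace (kH p) (xiH p) (H p))
  (L_beta : forall p, (2 <= p)%N ->
    indep2 P (g_sigma_algebra_preimage (xiL p)) (sigma_gen beta))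
  (L_Z : forall p, (2 <= p)%N ->
    indep2 P (g_sigma_algebra_preimage (xiL p))
      (sigma_gen (fun ij : nat * 'I_n => Z ij.1 ij.2)))
  (H_beta : forall p, (2 <= p)%N ->
    indep2 P (g_sigma_algebra_preimage (xiH p)) (sigma_gen beta))
  (H_Z : forall p, (2 <= p)%N ->
    indep2 P (g_sigma_algebra_preimage (xiH p))
      (sigma_gen (fun ij : nat * 'I_n => Z ij.1 ij.2)))
  (kL_dom : sqrt_dominated R kL) (kH_dom : sqrt_dominated R kH) :
  {ae P, forall w,
    let err p (v : 'cV[R]_p) := enorm (v - b_vec beta p w) in
    let maps_err (V : forall p, {vspace 'cV[R]_p}) p :=
      err p (maps (returns beta X Z p w) (h p w) (V p)) in
    let gps_err p := err p (gps (returns beta X Z p w) (h p w)) in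
    let pca_err p := err p (h p w) in
    let L' p := (L p w + <[qvec p]>)%VS in
    let L'' p := (H p w + <[qvec p]>)%VS in
    [/\ cvgn gps_err /\ cvgn pca_err,
        (limn_esup (fun p => (maps_err L' p)%:E) <= (limn gps_err)%:E)%E,
        maps_err L'' @ \oo --> limn gps_err &
        maps_err (fun p => H p w) @ \oo --> limn pca_err]}.
Proof.
have [[C betaC] _ mean_cv disp_cv] := A1.
have [_ _ _ _ X0] := A3.
have delta0 : 0 < delta by case: A4 => -[].
have betaZ : indep2 P (sigma_gen (fun i => beta i : T -> R))
    (sigma_gen (fun ij : nat * 'I_n => Z ij.1 ij.2 : T -> R)).
  (* Positions 0 and 2 of the triple beta, X, Z. *)
  exact: (mutual_indep_pair A2 (i := @Ordinal 3 0 isT) (j := @Ordinal 3 2 isT) isT).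
pose Cb := \bigcup_i g_sigma_algebra_preimage (beta i : T -> R).
have CbT : Cb `<=` measurable by move=> A [i _]; exact: preimage_sub_measurable.
have LO p : (2 <= p)%N -> forall w, orthogonal_group (xiL p w : 'M[R]_p).
  by move=> /L_random[].
have HO p : (2 <= p)%N -> forall w, orthogonal_group (xiH p w : 'M[R]_p).
  by move=> /H_haar[[]].
have Hhaar p : (2 <= p)%N -> is_haar (distribution P (xiH p)) by move=> /H_haar[].
have mbeta i : @measurable_fun _ _ (g_sigma_algebraType Cb) R setT (beta i).
  exact: (@measurable_fun_sigma_gen _ T _ _ R (fun i => beta i : T -> R) i).
have gram : {ae P, forall w, forall j k,
  p%:R^-1 * dot (col j (Z_mx Z p w)) (col k (Z_mx Z p w))
    @[p --> \oo] --> (j == k)%:R * delta ^+ 2}.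
  (* The column indices range over a finite type, so the exceptional null sets can be united. *)
  apply: filter_forall => j; apply: filter_forall => k.
  apply: filterS (noise_gram_cvg A4 j k) => w; apply: cvg_eqfun => p.
  by congr (_ * _); apply: eq_bigr => i _; rewrite !mxE.
have factor : {ae P, forall w, forall j,
  p%:R^-1 * dot (beta_vec beta p w) (col j (Z_mx Z p w))
    @[p --> \oo] --> 0}.
  apply: filter_forall => j.
  apply: filterS (noise_factor_cvg A4 betaC betaZ j) => w; apply: cvg_eqfun => p.
  by congr (_ * _); apply: eq_bigr => i _; rewrite !mxE.
have nmean : {ae P, forall w, forall j, mean (col j (Z_mx Z p w)) @[p --> \oo] --> 0}.
  apply: filter_forall => j.
  apply: filterS (noise_mean_cvg A4 j) => w; apply: cvg_eqfun => p.
  by congr (_ * _); apply: eq_bigr => i _; rewrite !mxE.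
have Ln := filter_forall (ae_filter_ringOfSetsType P) (energy_noise_ae A4 kL_dom LO L_Z).
have Hn := filter_forall (ae_filter_ringOfSetsType P) (energy_noise_ae A4 kH_dom HO H_Z).
have Hb : {ae P, forall w, energy (kH p) (xiH p w) (b_vec beta p w) @[p --> \oo] --> 0}.
  apply: (energy_haar_ae CbT kH_dom HO Hhaar H_beta) => [p i|p w].
    by apply: measurable_normalize => k; under eq_fun do rewrite mxE; exact: mbeta.
  exact: dot_normalize_le1.
(* The constant vector q is measurable for the sigma-algebra of beta, so the lemma used for b
   applies again. *)
have Hq : {ae P, forall w, energy (kH p) (xiH p w) (qvec p) @[p --> \oo] --> 0}.
  apply: (energy_haar_ae CbT kH_dom HO Hhaar H_beta (b := fun p _ => qvec p)).
    by move=> p i; exact: measurable_cst.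
  move=> [|p] w; first by rewrite /dot big_ord0.
  by rewrite dot_qvec.
have FP : Filter (almost_everywhere P) := ae_filter_ringOfSetsType P.
have aeI A B := @filterI _ _ FP A B.
have model := aeI _ _ (aeI _ _ X0 (aeI _ _ mean_cv disp_cv))
  (aeI _ _ gram (aeI _ _ factor nmean)).
have spaces := aeI _ _ (aeI _ _ Ln Hn) (aeI _ _ Hb Hq).
apply: (@filterS2 _ _ FP _ _ _ _ model spaces) => w
  [[Xw [[mu mu0 muw] [disp disp0 dispw]]] [gw [fw nw]]].
move=> [[Lw Hw] [Hbw Hqw]].
have LE p : (2 <= p)%N -> L p w = span_cols (kL p) (xiL p w) by move=> /L_random[].
have HE p : (2 <= p)%N -> H p w = span_cols (kH p) (xiH p w) by move=> /H_haar[[]].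
have [[gps_cvg pca_cvg] L'_le L''_cvg H_cvg] :=
  pathwise_maps_limits n_ge2 mu0 delta0 Xw muw dispw gw fw nw (fun p => @h_pca p w)
    (fun p p2 => LO p p2 w) LE (fun p p2 => HO p p2 w) HE Lw Hw Hbw Hqw.
have gpsE := cvg_lim (@Rhausdorff R) gps_cvg.
have pcaE := cvg_lim (@Rhausdorff R) pca_cvg.
by rewrite gpsE pcaE.
Qed.
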